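(* Let $\mathcal C$ be a tensor $*$-category with simple unit, finitely many isomorphism classes of simple objects, conjugates, direct sums and subobjects. Then the unitary quantum double $\mathcal Z_1^*(\mathcal C)$ is monoidally equivalent to $\mathcal Z_1(\mathcal C)$, thus modular.
   Context: A tensor $*$-category is a (strict) $\mathbb C$-linear tensor category with finite dimensional Hom-spaces and a positive $*$-operation: antilinear maps $*:\mathrm{Hom}(X,Y)\to\mathrm{Hom}(Y,X)$, involutive, contravariant, with $(s\otimes t)^*=s^*\otimes t^*$ and such that $s^*\circ s=0$ implies $s=0$. Conjugates: for every $X$ there are $\overline X$ and $r_X:\mathbf 1\to\overline XX$, $\overline r_X:\mathbf 1\to X\overline X$ with $(\overline r_X^*\otimes\mathrm{id}_X)(\mathrm{id}_X\otimes r_X)=\mathrm{id}_X$ and $(r_X^*\otimes\mathrm{id}_{\overline X})(\mathrm{id}_{\overline X}\otimes\overline r_X)=\mathrm{id}_{\overline X}$. Dimensions, traces and twists are defined using standard solutions of these equations (those for which left and right traces on $\mathrm{End}(X)$ agree, i.e. the canonical spherical structure). Subobjects: idempotents split. A half braiding for $X\in\mathcal C$ is a family of isomorphisms $e_X(Y):XY\to YX$, $Y\in\mathcal C$, natural in $Y$, with $e_X(YZ)=(\mathrm{id}_Y\otimes e_X(Z))(e_X(Y)\otimes\mathrm{id}_Z)$ and $e_X(\mathbf 1)=\mathrm{id}_X$. The center (quantum double) $\mathcal Z_1(\mathcal C)$ has objects $(X,e_X)$; morphisms $(X,e_X)\to(Y,e_Y)$ are $t\in\mathrm{Hom}_{\mathcal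 C}(X,Y)$ with $(\mathrm{id}_Z\otimes t)e_X(Z)=e_Y(Z)(t\otimes\mathrm{id}_Z)$ for all $Z$; $(X,e_X)\otimes(Y,e_Y)=(XY,e_{XY})$ with $e_{XY}(Z)=(e_X(Z)\otimes\mathrm{id}_Y)(\mathrm{id}_X\otimes e_Y(Z))$; the braiding is $c((X,e_X),(Y,e_Y))=e_X(Y)$. The unitary quantum double $\mathcal Z_1^*(\mathcal C)$ is the full subcategory of $\mathcal Z_1(\mathcal C)$ consisting of the $(X,e_X)$ for which all $e_X(Y)$ are unitary; it is a tensor $*$-category with the $*$-operation of $\mathcal C$. Modular: semisimple (finite direct sums, split idempotents, every object a finite direct sum of objects with $\mathrm{End}(X)\cong\mathbb C$) braided category with duals and spherical structure, simple unit and finitely many classes of simple objects $X_i$, such that the matrix $S(X_i,X_j)=tr_{X_iX_j}(c(X_j,X_i)\circ c(X_i,X_j))$ is invertible. *)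

(* Defs.v *)
From HB Require Import structures.
From mathcomp Require Import all_boot all_order all_algebra.
From mathcomp Require Import boolp reals.
From mathcomp Require Import complex.

Set Implicit Arguments.
Unset Strict Implicit.
Unset Printing Implicit Defensive.

Import GRing.Theory Num.Theory.
Local Open Scope ring_scope.

Reserved Notation "g ∘ f" (at level 40, left associativity).
Reserved Notation "X ⊗ Y" (at level 30, right associativity).
Reserved Notation "f ⊠ g" (at level 30, right associativity).

Record lincat (K : fieldType) := LinCat {
  ob : Type;
  hom : ob -> ob -> lmodType K;
  idm : forall X, hom X X;
  compm : forall X Y Z, hom Y Z -> hom X Y -> hom X Z;
  comp1f : forall X Y (f : hom X Y), compm (idm Y) f = f;
  compf1 : forall X Y (f : hom X Y), compm f (idm X) = f;
  compA : forall W X Y Z (h : hom Y Z) (g : hom X Y) (f : hom W X),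
    compm h (compm g f) = compm (compm h g) f;
  comp_linear_l : forall X Y Z (f : hom X Y), linear (fun g : hom Y Z => compm g f);
  comp_linear_r : forall X Y Z (g : hom Y Z), linear (fun f : hom X Y => compm g f)
}.
Arguments idm {K l} X.
Arguments compm {K l X Y Z} g f.
Notation "g ∘ f" := (compm g f).

(* The identity of X seen as a morphism X -> Y when X and Y are equal objects;
   it is what makes the formulas of a strict tensor category well-typed. *)
Definition eqh (K : fieldType) (C : lincat K) (X Y : ob C) (p : X = Y) : hom X Y :=
  match p in _ = Z return hom X Z with erefl => idm X end.

Record tcat (K : fieldType) := TCat {
  tc_cat :> lincat K;
  unit_ob : ob tc_cat;
  tens : ob tc_cat -> ob tc_cat -> ob tc_cat;
  tensm : forall X X' Y Y' : ob tc_cat,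
    hom X X' -> hom Y Y' -> hom (tens X Y) (tens X' Y');
  tensm_linear_l : forall X X' Y Y' (g : hom Y Y'),
    linear (fun f : hom X X' => tensm f g);
  tensm_linear_r : forall X X' Y Y' (f : hom X X'),
    linear (fun g : hom Y Y' => tensm f g);
  tensm1 : forall X Y, tensm (idm X) (idm Y) = idm (tens X Y);
  tensm_comp : forall X X' X'' Y Y' Y'' (f' : hom X' X'') (f : hom X X')
      (g' : hom Y' Y'') (g : hom Y Y'),
    tensm (f' ∘ f) (g' ∘ g) = tensm f' g' ∘ tensm f g;
  tensA : forall X Y Z, tens X (tens Y Z) = tens (tens X Y) Z;
  tens1o : forall X, tens unit_ob X = X;
  tenso1 : forall X, tens X unit_ob = X;
  tensmA : forall X X' Y Y' Z Z' (f : hom X X') (g : hom Y Y') (h : hom Z Z'),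
    eqh (tensA X' Y' Z') ∘ tensm f (tensm g h)
      = tensm (tensm f g) h ∘ eqh (tensA X Y Z);
  tens1m : forall X X' (f : hom X X'),
    eqh (tens1o X') ∘ tensm (idm unit_ob) f = f ∘ eqh (tens1o X);
  tensm1r : forall X X' (f : hom X X'),
    eqh (tenso1 X') ∘ tensm f (idm unit_ob) = f ∘ eqh (tenso1 X)
}.
Arguments unit_ob {K t}.
Arguments tens {K t} X Y.
Arguments tensm {K t X X' Y Y'} f g.
Arguments tensA {K t} X Y Z.
Arguments tens1o {K t} X.
Arguments tenso1 {K t} X.
Notation "X ⊗ Y" := (tens X Y).
Notation "f ⊠ g" := (tensm f g).

Section Strictness.
Context {K : fieldType} {C : tcat K}.
Implicit Types X Y Z : ob C.

Definition asc X Y Z : hom (X ⊗ (Y ⊗ Z)) ((X ⊗ Y) ⊗ Z) := eqh (tensA X Y Z).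
Definition asc' X Y Z : hom ((X ⊗ Y) ⊗ Z) (X ⊗ (Y ⊗ Z)) := eqh (esym (tensA X Y Z)).
Definition lu X : hom (unit_ob ⊗ X) X := eqh (tens1o X).
Definition lu' X : hom X (unit_ob ⊗ X) := eqh (esym (tens1o X)).
Definition ru X : hom (X ⊗ unit_ob) X := eqh (tenso1 X).
Definition ru' X : hom X (X ⊗ unit_ob) := eqh (esym (tenso1 X)).

End Strictness.

Section LinearNotions.
Context {K : fieldType} {C : lincat K}.
Implicit Types X Y Z : ob C.

Definition is_iso X Y (f : hom X Y) := exists2 g : hom Y X, g ∘ f = idm X & f ∘ g = idm Y.
Definition isomorphic X Y := exists f : hom X Y, is_iso f.

Definition is_simple X := idm X <> 0 /\ forall f : hom X X, exists a : K, f = a *: idm X.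

Definition simple_representatives (n : nat) (S : 'I_n -> ob C) :=
  [/\ forall i, is_simple (S i),
      forall i j, isomorphic (S i) (S j) -> i = j
    & forall X, is_simple X -> exists i, isomorphic X (S i)].

Definition finitely_many_simples := exists n (S : 'I_n -> ob C), simple_representatives S.

Definition is_direct_sum n (S : 'I_n -> ob C) X :=
  exists (v : forall i, hom (S i) X) (w : forall i, hom X (S i)),
    [/\ forall i, w i ∘ v i = idm (S i),
        forall i j, i != j -> w i ∘ v j = 0
      & \sum_i v i ∘ w i = idm X].

Definition has_direct_sums :=
  forall n (S : 'I_n -> ob C), exists X, is_direct_sum S X.

Definition idempotents_split :=
  forall X (p : hom X X), p ∘ p = p ->
    exists Y (v : hom Y X) (w : hom X Y), w ∘ v = idm Y /\ v ∘ w = p.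

Definition semisimple :=
  [/\ has_direct_sums, idempotents_split
    & forall X, exists n (S : 'I_n -> ob C),
        (forall i, is_simple (S i)) /\ is_direct_sum S X].

End LinearNotions.
Arguments finitely_many_simples {K} C.
Arguments has_direct_sums {K} C.
Arguments idempotents_split {K} C.
Arguments semisimple {K} C.

Section CastTheory.
Context {K : fieldType}.

Lemma eqh1 (C : lincat K) (X : ob C) (p : X = X) : eqh p = idm X.
Proof. by rewrite (Prop_irrelevance p erefl). Qed.

Lemma eqh_irr (C : lincat K) (X Y : ob C) (p q : X = Y) : eqh p = eqh q.
Proof. by rewrite (Prop_irrelevance p q). Qed.

Lemma eqh_comp (C : lincat K) (X Y Z : ob C) (p : X = Y) (q : Y = Z) :
  eqh q ∘ eqh p = eqh (etrans p q).
Proof. by case: _ / q; rewrite comp1f. Qed.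

Lemma eqh_compA (C : lincat K) (W X Y Z : ob C) (p : X = Y) (q : Y = Z) (f : hom W X) :
  eqh q ∘ (eqh p ∘ f) = eqh (etrans p q) ∘ f.
Proof. by rewrite compA eqh_comp. Qed.

Lemma eqhK (C : lincat K) (X Y : ob C) (p : X = Y) (q : Y = X) : eqh q ∘ eqh p = idm X.
Proof. by rewrite eqh_comp eqh1. Qed.

Lemma eqh_tens (C : tcat K) (X X' Y Y' : ob C) (p : X = X') (q : Y = Y') :
  eqh p ⊠ eqh q = eqh (f_equal2 tens p q).
Proof. by case: _ / p; case: _ / q; rewrite tensm1 eqh1. Qed.

Lemma eqh_tensl (C : tcat K) (X X' Y : ob C) (p : X = X') :
  eqh p ⊠ idm Y = eqh (f_equal2 tens p (erefl Y)).
Proof. exact: (eqh_tens p erefl). Qed.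

Lemma eqh_tensr (C : tcat K) (X Y Y' : ob C) (p : Y = Y') :
  idm X ⊠ eqh p = eqh (f_equal2 tens (erefl X) p).
Proof. exact: (eqh_tens erefl p). Qed.

Lemma eqh_iso (C : lincat K) (X Y : ob C) (p : X = Y) : is_iso (eqh p).
Proof. by exists (eqh (esym p)); rewrite eqhK. Qed.

Lemma iso_comp (C : lincat K) (X Y Z : ob C) (g : hom Y Z) (f : hom X Y) :
  is_iso g -> is_iso f -> is_iso (g ∘ f).
Proof.
move=> [g' gK g'K] [f' fK f'K]; exists (f' ∘ g').
  by rewrite -compA (compA g') gK comp1f.
by rewrite -compA (compA f) f'K comp1f.
Qed.

Lemma iso_tens (C : tcat K) (X X' Y Y' : ob C) (f : hom X X') (g : hom Y Y') :
  is_iso f -> is_iso g -> is_iso (f ⊠ g).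
Proof.
move=> [f' fK f'K] [g' gK g'K]; exists (f' ⊠ g').
  by rewrite -tensm_comp fK gK tensm1.
by rewrite -tensm_comp f'K g'K tensm1.
Qed.

Lemma iso_idm (C : lincat K) (X : ob C) : is_iso (idm X).
Proof. by exists (idm X); rewrite comp1f. Qed.

(* Equality of morphisms up to equality of their sources and targets. *)
Definition heq (C : lincat K) (X Y X' Y' : ob C) (f : hom X Y) (g : hom X' Y') :=
  exists (p : X = X') (q : Y = Y'), eqh q ∘ f = g ∘ eqh p.

Lemma heq_eq (C : lincat K) (X Y : ob C) (f g : hom X Y) : heq f g -> f = g.
Proof. by move=> [p [q]]; rewrite !eqh1 comp1f compf1. Qed.

Lemma heqP (C : lincat K) (X Y X' Y' : ob C) (f : hom X Y) (g : hom X' Y')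
  (p : X = X') (q : Y = Y') : heq f g <-> eqh q ∘ f = g ∘ eqh p.
Proof.
split=> [[p' [q']]|]; last by exists p, q.
by rewrite (eqh_irr p' p) (eqh_irr q' q).
Qed.

Lemma heq_refl (C : lincat K) (X Y : ob C) (f : hom X Y) : heq f f.
Proof. by exists erefl, erefl; rewrite /= comp1f compf1. Qed.

Lemma heq_sym (C : lincat K) (X Y X' Y' : ob C) (f : hom X Y) (g : hom X' Y') :
  heq f g -> heq g f.
Proof.
move=> [p [q]]; case: _ / p g => g; case: _ / q g => g /=.
by rewrite comp1f compf1 => ->; apply: heq_refl.
Qed.

Lemma heq_trans (C : lincat K) (X Y X' Y' X'' Y'' : ob C)
    (f : hom X Y) (g : hom X' Y') (h : hom X'' Y'') :
  heq f g -> heq g h -> heq f h.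
Proof.
move=> [p [q]]; case: _ / p g => g; case: _ / q g => g /=.
by rewrite comp1f compf1 => ->.
Qed.

Lemma heq_comp (C : lincat K) (X Y Z X' Y' Z' : ob C) (f : hom X Y) (g : hom Y Z)
    (f' : hom X' Y') (g' : hom Y' Z') :
  heq f f' -> heq g g' -> heq (g ∘ f) (g' ∘ f').
Proof.
move=> [p [q e]] [q' [r e']]; exists p, r.
by rewrite compA e' -!compA -e (eqh_irr q' q).
Qed.

Lemma heq_castl (C : lincat K) (X Y Y' : ob C) (p : Y = Y') (f : hom X Y) :
  heq (eqh p ∘ f) f.
Proof. by case: _ / p; rewrite /= comp1f; apply: heq_refl. Qed.

Lemma heq_castr (C : lincat K) (X X' Y : ob C) (p : X' = X) (f : hom X Y) :
  heq (f ∘ eqh p) f.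
Proof. by case: _ / p f => f; rewrite /= compf1; apply: heq_refl. Qed.

Lemma heq_mid (C : lincat K) (X Y Y1 Z X' Y' Y1' Z' : ob C) (p : Y = Y1) (p' : Y' = Y1')
    (f : hom X Y) (g : hom Y1 Z) (f' : hom X' Y') (g' : hom Y1' Z') :
  heq f f' -> heq g g' -> heq (g ∘ (eqh p ∘ f)) (g' ∘ (eqh p' ∘ f')).
Proof.
move=> hf hg; apply: heq_comp => //.
apply: heq_trans (heq_castl _ _) _; apply: heq_trans hf _.
exact/heq_sym/heq_castl.
Qed.

Lemma heq_tens (C : tcat K) (X Y X' Y' Z W Z' W' : ob C) (f : hom X Y) (f' : hom X' Y')
    (g : hom Z W) (g' : hom Z' W') :
  heq f f' -> heq g g' -> heq (f ⊠ g) (f' ⊠ g').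
Proof.
move=> [p [q e]] [p' [q' e']].
exists (f_equal2 tens p p'), (f_equal2 tens q q').
by rewrite -!eqh_tens -!tensm_comp e e'.
Qed.

Lemma heq_tensA (C : tcat K) (X X' Y Y' Z Z' : ob C)
    (f : hom X X') (g : hom Y Y') (h : hom Z Z') :
  heq (f ⊠ (g ⊠ h)) ((f ⊠ g) ⊠ h).
Proof. by exists (tensA X Y Z), (tensA X' Y' Z'); rewrite tensmA. Qed.

Lemma heq_tens1m (C : tcat K) (X X' : ob C) (f : hom X X') : heq (idm unit_ob ⊠ f) f.
Proof. by exists (tens1o X), (tens1o X'); rewrite tens1m. Qed.

Lemma heq_tensm1r (C : tcat K) (X X' : ob C) (f : hom X X') : heq (f ⊠ idm unit_ob) f.
Proof. by exists (tenso1 X), (tenso1 X'); rewrite tensm1r. Qed.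

Lemma heq_idm (C : lincat K) (X Y : ob C) : X = Y -> heq (idm X) (idm Y).
Proof. by move=> ->; apply: heq_refl. Qed.

Lemma heq_eqh (C : lincat K) (X Y : ob C) (p : X = Y) : heq (eqh p) (idm X).
Proof. by case: _ / p; apply: heq_refl. Qed.

Lemma heq_eqh2 (C : lincat K) (X Y X' Y' : ob C) (p : X = Y) (p' : X' = Y') :
  X = X' -> heq (eqh p) (eqh p').
Proof.
move=> e; apply: heq_trans (heq_eqh p) _.
by apply: heq_trans (heq_idm e) _; apply/heq_sym/heq_eqh.
Qed.

End CastTheory.

Section Center.
Context {K : fieldType} (C : tcat K).
Implicit Types X Y Z : ob C.

Record half_braiding X := HalfBraiding {
  hb :> forall Y, hom (X ⊗ Y) (Y ⊗ X);
  hb_iso : forall Y, is_iso (hb Y);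
  hb_nat : forall Y Z (f : hom Y Z), (f ⊠ idm X) ∘ hb Y = hb Z ∘ (idm X ⊠ f);
  hb_tens : forall Y Z,
    hb (Y ⊗ Z) = asc Y Z X ∘ (idm Y ⊠ hb Z) ∘ asc' Y X Z ∘ (hb Y ⊠ idm Z) ∘ asc X Y Z;
  hb_one : hb unit_ob = lu' X ∘ ru X
}.

Record center_ob := CenterOb { cob :> ob C; cbr : half_braiding cob }.
Implicit Types A B D E : center_ob.

Definition center_morphism A B : {pred hom (cob A) (cob B)} :=
  fun t => `[< forall Z, (idm Z ⊠ t) ∘ cbr A Z = cbr B Z ∘ (t ⊠ idm Z) >].

Lemma center_morphismP A B (t : hom (cob A) (cob B)) :
  reflect (forall Z, (idm Z ⊠ t) ∘ cbr A Z = cbr B Z ∘ (t ⊠ idm Z))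
          (t \in @center_morphism A B).
Proof. exact: asboolP. Qed.

Lemma comp_lin_l X Y Z (f : hom X Y) (a : K) (g h : hom Y Z) :
  (a *: g + h) ∘ f = a *: (g ∘ f) + h ∘ f.
Proof. exact: comp_linear_l. Qed.

Lemma comp_lin_r X Y Z (f : hom Y Z) (a : K) (g h : hom X Y) :
  f ∘ (a *: g + h) = a *: (f ∘ g) + f ∘ h.
Proof. exact: comp_linear_r. Qed.

Lemma tens_lin_l X X' Y Y' (f : hom Y Y') (a : K) (g h : hom X X') :
  (a *: g + h) ⊠ f = a *: (g ⊠ f) + h ⊠ f.
Proof. exact: tensm_linear_l. Qed.

Lemma tens_lin_r X X' Y Y' (f : hom X X') (a : K) (g h : hom Y Y') :
  f ⊠ (a *: g + h) = a *: (f ⊠ g) + f ⊠ h.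
Proof. exact: tensm_linear_r. Qed.

Lemma comp0f X Y Z (f : hom X Y) : (0 : hom Y Z) ∘ f = 0.
Proof.
have := comp_lin_l f 1 (0 : hom Y Z) 0; rewrite !scale1r addr0.
by move/(congr1 (fun x => x - 0 ∘ f)); rewrite subrr addrK => ->.
Qed.

Lemma compf0 X Y Z (f : hom Y Z) : f ∘ (0 : hom X Y) = 0.
Proof.
have := comp_lin_r f 1 (0 : hom X Y) 0; rewrite !scale1r addr0.
by move/(congr1 (fun x => x - f ∘ 0)); rewrite subrr addrK => ->.
Qed.

Lemma tens0f X X' Y Y' (f : hom Y Y') : (0 : hom X X') ⊠ f = 0.
Proof.
have := tens_lin_l f 1 (0 : hom X X') 0; rewrite !scale1r addr0.
by move/(congr1 (fun x => x - 0 ⊠ f)); rewrite subrr addrK => ->.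
Qed.

Lemma tensf0 X X' Y Y' (f : hom Y Y') : f ⊠ (0 : hom X X') = 0.
Proof.
have := tens_lin_r f 1 (0 : hom X X') 0; rewrite !scale1r addr0.
by move/(congr1 (fun x => x - f ⊠ 0)); rewrite subrr addrK => ->.
Qed.

Lemma center_morphism_submod A B : submod_closed (@center_morphism A B).
Proof.
split=> [|a f g /center_morphismP hf /center_morphismP hg]; apply/center_morphismP => Z.
  by rewrite tens0f tensf0 comp0f compf0.
by rewrite tens_lin_l tens_lin_r comp_lin_l comp_lin_r hf hg.
Qed.

HB.instance Definition _ A B :=
  GRing.isSubmodClosed.Build K (hom (cob A) (cob B)) (@center_morphism A B)
    (center_morphism_submod A B).

Definition center_homt A B := {t : hom (cob A) (cob B) | t \in @center_morphism A B}.
HB.instance Definition _ A B := SubChoice.on (center_homt A B).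
HB.instance Definition _ A B := [SubChoice_isSubLmodule of center_homt A B by <:].
Definition center_hom A B : lmodType K := center_homt A B.

Lemma tens_compl X X' X'' Y (f' : hom X' X'') (f : hom X X') :
  (f' ∘ f) ⊠ idm Y = (f' ⊠ idm Y) ∘ (f ⊠ idm Y).
Proof. by rewrite -tensm_comp comp1f. Qed.

Lemma tens_compr X Y Y' Y'' (f' : hom Y' Y'') (f : hom Y Y') :
  idm X ⊠ (f' ∘ f) = (idm X ⊠ f') ∘ (idm X ⊠ f).
Proof. by rewrite -tensm_comp comp1f. Qed.

Lemma asc_nat X X' Y Y' Z Z' (f : hom X X') (g : hom Y Y') (h : hom Z Z') :
  asc X' Y' Z' ∘ (f ⊠ (g ⊠ h)) = ((f ⊠ g) ⊠ h) ∘ asc X Y Z.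
Proof. exact: tensmA. Qed.

Lemma asc'_nat X X' Y Y' Z Z' (f : hom X X') (g : hom Y Y') (h : hom Z Z') :
  asc' X' Y' Z' ∘ ((f ⊠ g) ⊠ h) = (f ⊠ (g ⊠ h)) ∘ asc' X Y Z.
Proof.
rewrite -[LHS]compf1 -(eqhK (esym (tensA X Y Z)) (tensA X Y Z)).
rewrite compA -(compA (asc' _ _ _)) -tensmA compA eqh_comp eqh1 comp1f.
by [].
Qed.

Lemma heq_exchange X X' Y Y' (f : hom X X') (g : hom Y Y') X1 X2 X1' X2'
    (a : hom X1 X1') (b : hom X2 X2') (p : X2' = X1) :
  heq a (f ⊠ idm Y') -> heq b (idm X ⊠ g) -> heq (a ∘ (eqh p ∘ b)) (f ⊠ g).
Proof.
move=> ha hb; have -> : f ⊠ g = (f ⊠ idm Y') ∘ (eqh erefl ∘ (idm X ⊠ g)).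
  by rewrite /= comp1f -tensm_comp comp1f compf1.
exact: heq_mid.
Qed.

Lemma heq_exchange' X X' Y Y' (f : hom X X') (g : hom Y Y') X1 X2 X1' X2'
    (a : hom X1 X1') (b : hom X2 X2') (p : X1' = X2) :
  heq a (f ⊠ idm Y) -> heq b (idm X' ⊠ g) -> heq (b ∘ (eqh p ∘ a)) (f ⊠ g).
Proof.
move=> ha hb; have -> : f ⊠ g = (idm X' ⊠ g) ∘ (eqh erefl ∘ (f ⊠ idm Y)).
  by rewrite /= comp1f -tensm_comp comp1f compf1.
exact: heq_mid.
Qed.

Lemma heq_cl X Y Y1 X' Y' Y1' (f : hom X Y) (f' : hom X' Y') (q : Y = Y1) (q' : Y' = Y1') :
  heq f f' -> heq (eqh q ∘ f) (eqh q' ∘ f').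
Proof.
move=> h; apply: heq_trans (heq_castl _ _) _; apply: heq_trans h _.
exact/heq_sym/heq_castl.
Qed.

Lemma heq_cr X X1 Y X' X1' Y' (f : hom X Y) (f' : hom X' Y') (p : X1 = X) (p' : X1' = X') :
  heq f f' -> heq (f ∘ eqh p) (f' ∘ eqh p').
Proof.
move=> h; apply: heq_trans (heq_castr _ _) _; apply: heq_trans h _.
exact/heq_sym/heq_castr.
Qed.

Lemma heq_tensA' X X' Y Y' Z Z' (f : hom X X') (g : hom Y Y') (h : hom Z Z') :
  heq ((f ⊠ g) ⊠ h) (f ⊠ (g ⊠ h)).
Proof. exact/heq_sym/heq_tensA. Qed.

Definition center_one_e Y : hom (unit_ob ⊗ Y) (Y ⊗ unit_ob) := ru' Y ∘ lu Y.

Lemma center_one_iso Y : is_iso (center_one_e Y).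
Proof. by apply: iso_comp; apply: eqh_iso. Qed.

Lemma center_one_nat Y Z (f : hom Y Z) :
  (f ⊠ idm unit_ob) ∘ center_one_e Y = center_one_e Z ∘ (idm unit_ob ⊠ f).
Proof.
apply: heq_eq; rewrite /center_one_e /ru' /lu !eqh_comp.
apply: heq_trans (heq_castr _ _) _; apply: heq_trans (heq_tensm1r f) _.
by apply: heq_sym; apply: heq_trans (heq_castl _ _) _; exact: heq_tens1m.
Qed.

Lemma center_one_tens Y Z :
  center_one_e (Y ⊗ Z) = asc Y Z unit_ob ∘ (idm Y ⊠ center_one_e Z) ∘ asc' Y unit_ob Z
    ∘ (center_one_e Y ⊠ idm Z) ∘ asc unit_ob Y Z.
Proof.
rewrite /center_one_e /ru' /lu !eqh_comp /asc /asc' eqh_tensl eqh_tensr !eqh_comp.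
exact: eqh_irr.
Qed.

Lemma center_one_one : center_one_e unit_ob = lu' unit_ob ∘ ru unit_ob.
Proof. by rewrite /center_one_e /ru' /lu /lu' /ru !eqh_comp; apply: eqh_irr. Qed.

Definition center_one : center_ob :=
  CenterOb (HalfBraiding center_one_iso center_one_nat center_one_tens center_one_one).

Definition center_tens_e A B Z : hom ((A ⊗ B) ⊗ Z) (Z ⊗ (A ⊗ B)) :=
  asc' Z A B ∘ (cbr A Z ⊠ idm B) ∘ asc A Z B ∘ (idm A ⊠ cbr B Z) ∘ asc' A B Z.

Lemma center_tens_iso A B Z : is_iso (center_tens_e A B Z).
Proof.
rewrite /center_tens_e; repeat apply: iso_comp; try exact: eqh_iso.
  exact: iso_tens (hb_iso _ _) (iso_idm _).
exact: iso_tens (iso_idm _) (hb_iso _ _).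
Qed.

Lemma center_tens_nat A B Y Z (f : hom Y Z) :
  (f ⊠ idm (A ⊗ B)) ∘ center_tens_e A B Y = center_tens_e A B Z ∘ (idm (A ⊗ B) ⊠ f).
Proof.
rewrite /center_tens_e -!compA -tensm1.
rewrite compA -asc'_nat -!compA asc'_nat.
rewrite (compA (idm A ⊠ _)) -tens_compr -hb_nat tens_compr -!compA.
rewrite (compA (asc _ _ _) (_ ⊠ (f ⊠ _))) asc_nat -!compA.
by rewrite !(compA (_ ⊠ idm (cob B))) -!tens_compl hb_nat.
Qed.

Lemma center_tens_tens A B Z W :
  center_tens_e A B (Z ⊗ W) =
  asc Z W (A ⊗ B) ∘ (idm Z ⊠ center_tens_e A B W) ∘ asc' Z (A ⊗ B) W
    ∘ (center_tens_e A B Z ⊠ idm W) ∘ asc (A ⊗ B) Z W.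
Proof.
rewrite /center_tens_e !hb_tens.
rewrite !tens_compl !tens_compr /asc /asc' !eqh_tensl !eqh_tensr -!compA.
rewrite !eqh_compA !eqh_comp.
set l4 := (_ ⊠ cbr A W) ⊠ _; set l3 := (cbr A Z ⊠ _) ⊠ idm B.
set l2 := idm A ⊠ (_ ⊠ cbr B W); set l1 := idm A ⊠ (cbr B Z ⊠ _).
set r4 := _ ⊠ (cbr A W ⊠ _); set r3 := _ ⊠ (_ ⊠ cbr B W).
set r2 := (cbr A Z ⊠ _) ⊠ idm W; set r1 := (idm A ⊠ cbr B Z) ⊠ _.
apply: heq_eq.
have h4 : heq l4 r4 by exact: heq_tensA'.
have h1 : heq l1 r1 by exact: heq_tensA.
have hm p p' : heq (l3 ∘ (eqh p ∘ l2)) (r3 ∘ (eqh p' ∘ r2)).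
  apply: (@heq_trans _ _ _ _ _ _ _ _ _ (cbr A Z ⊠ cbr B W)).
    apply: heq_exchange.
      by apply: heq_trans (heq_tensA' _ _ _) _; rewrite tensm1; apply: heq_refl.
    by apply: heq_trans (heq_tensA _ _ _) _; rewrite tensm1; apply: heq_refl.
  apply/heq_sym; apply: heq_exchange'.
    by apply: heq_trans (heq_tensA' _ _ _) _; rewrite tensm1; apply: heq_refl.
  by apply: heq_trans (heq_tensA _ _ _) _; rewrite tensm1; apply: heq_refl.
rewrite (compA l3) (compA (l3 ∘ _)) -(compA l3) (compA r3) (compA (r3 ∘ _)) -(compA r3).
by apply: heq_cl; apply: heq_mid h4; apply: heq_mid (hm _ _); apply: heq_cr.
Qed.

Lemma center_tens_one A B : center_tens_e A B unit_ob = lu' (A ⊗ B) ∘ ru (A ⊗ B).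
Proof.
rewrite /center_tens_e !hb_one !tens_compl !tens_compr.
rewrite /lu' /ru /asc /asc' !eqh_tensl !eqh_tensr !eqh_comp.
exact: eqh_irr.
Qed.

Definition center_tens A B : center_ob :=
  CenterOb (HalfBraiding (center_tens_iso A B) (@center_tens_nat A B)
              (center_tens_tens A B) (center_tens_one A B)).

Definition cval A B (t : center_hom A B) : hom (cob A) (cob B) := sval t.

Lemma cval_inj A B : injective (@cval A B).
Proof. exact: val_inj. Qed.

Lemma cval_linear A B : linear (@cval A B).
Proof. by []. Qed.

Definition cmor A B (t : hom (cob A) (cob B))
    (h : forall Z, (idm Z ⊠ t) ∘ cbr A Z = cbr B Z ∘ (t ⊠ idm Z)) : center_hom A B :=
  exist _ t (introT (center_morphismP t) h).

Lemma cmorP A B (t : center_hom A B) Z :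
  (idm Z ⊠ cval t) ∘ cbr A Z = cbr B Z ∘ (cval t ⊠ idm Z).
Proof. exact: (center_morphismP _ (valP t)). Qed.

Lemma center_idm_subproof A Z :
  (idm Z ⊠ idm (cob A)) ∘ cbr A Z = cbr A Z ∘ (idm (cob A) ⊠ idm Z).
Proof. by rewrite !tensm1 comp1f compf1. Qed.

Lemma center_comp_subproof A B D (g : center_hom B D) (f : center_hom A B) Z :
  (idm Z ⊠ (cval g ∘ cval f)) ∘ cbr A Z = cbr D Z ∘ ((cval g ∘ cval f) ⊠ idm Z).
Proof. by rewrite tens_compr tens_compl -compA cmorP !compA cmorP. Qed.

Lemma center_tensm_subproof A A' B B' (f : center_hom A A') (g : center_hom B B') Z :
  (idm Z ⊠ (cval f ⊠ cval g)) ∘ cbr (center_tens A B) Z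
    = cbr (center_tens A' B') Z ∘ ((cval f ⊠ cval g) ⊠ idm Z).
Proof.
rewrite /= /center_tens_e -!compA asc'_nat.
rewrite compA -asc'_nat -!compA; congr (_ ∘ _).
rewrite compA -tensm_comp cmorP compf1 -[X in _ ⊠ X](comp1f (cval g)) tensm_comp -!compA.
congr (_ ∘ _); rewrite compA -asc_nat -!compA; congr (_ ∘ _).
rewrite !compA -!tensm_comp; congr (_ ∘ _).
by rewrite compf1 comp1f cmorP.
Qed.

Definition center_idm A : center_hom A A := cmor (center_idm_subproof A).
Definition center_comp A B D (g : center_hom B D) (f : center_hom A B) : center_hom A D :=
  cmor (center_comp_subproof g f).
Definition center_tensm A A' B B' (f : center_hom A A') (g : center_hom B B') :
    center_hom (center_tens A B) (center_tens A' B') :=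
  @cmor (center_tens A B) (center_tens A' B') (cval f ⊠ cval g) (center_tensm_subproof f g).

Definition center_lincat : lincat K.
Proof.
apply: (@LinCat K center_ob center_hom center_idm center_comp).
- by move=> A B f; apply: val_inj; exact: comp1f.
- by move=> A B f; apply: val_inj; exact: compf1.
- by move=> A B D E h g f; apply: val_inj; exact: compA.
- by move=> A B D f a g h; apply: val_inj; exact: comp_linear_l.
- by move=> A B D f a g h; apply: val_inj; exact: comp_linear_r.
Defined.

Lemma center_ob_eq A B (p : cob A = cob B) :
  (forall Z, (idm Z ⊠ eqh p) ∘ cbr A Z = cbr B Z ∘ (eqh p ⊠ idm Z)) -> A = B.
Proof.
case: A B p => [X e] [Y f] /= p; case: _ / p f => f /= ef.
congr CenterOb; case: e f ef => [e e1 e2 e3 e4] [f f1 f2 f3 f4] /= ef.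
have ee : e = f.
  by apply: functional_extensionality_dep => Z; have:= ef Z; rewrite !tensm1 comp1f compf1.
by subst f; congr HalfBraiding; apply: Prop_irrelevance.
Qed.

Lemma cval_eqh A B (q : A = B) :
  cval (@eqh K center_lincat A B q) = eqh (f_equal cob q).
Proof. by case: _ / q; rewrite eqh1. Qed.

Lemma center_tensA A B D :
  center_tens A (center_tens B D) = center_tens (center_tens A B) D.
Proof.
apply: (@center_ob_eq (center_tens A (center_tens B D)) (center_tens (center_tens A B) D)
          (tensA A B D)) => Z /=.
rewrite /center_tens_e !tens_compl !tens_compr /asc /asc' !eqh_tensl !eqh_tensr -!compA.
rewrite !eqh_compA !eqh_comp.
apply/heq_eq/heq_cl; apply: heq_mid.
  apply: heq_mid.
    apply: heq_cr; apply: heq_trans (heq_tensA _ _ _) _.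
    by rewrite tensm1; apply: heq_refl.
  exact: heq_tensA.
by apply/heq_sym; apply: heq_trans (heq_tensA' _ _ _) _; rewrite tensm1; apply: heq_refl.
Qed.

Lemma center_tens1o A : center_tens center_one A = A.
Proof.
apply: (@center_ob_eq (center_tens center_one A) A (tens1o A)) => Z /=.
rewrite /center_tens_e /center_one_e /= !tens_compl /ru' /lu /asc /asc' !eqh_tensl !eqh_tensr.
rewrite -!compA !eqh_compA; apply/heq_eq/heq_trans; last by apply/heq_sym/heq_castr.
apply: heq_trans (heq_castl _ _) _; apply: heq_trans (heq_castr _ _) _.
exact: heq_tens1m.
Qed.

Lemma center_tenso1 A : center_tens A center_one = A.
Proof.
apply: (@center_ob_eq (center_tens A center_one) A (tenso1 A)) => Z /=.
rewrite /center_tens_e /center_one_e /= !tens_compr /ru' /lu /asc /asc' !eqh_tensl !eqh_tensr.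
rewrite -!compA !eqh_compA !eqh_comp; apply/heq_eq/heq_trans; last by apply/heq_sym/heq_castr.
apply: heq_trans (heq_castl _ _) _; apply: heq_trans (heq_castr _ _) _.
exact: heq_tensm1r.
Qed.

Definition center_tcat : tcat K.
Proof.
apply: (@TCat K center_lincat center_one center_tens center_tensm _ _ _ _
          center_tensA center_tens1o center_tenso1).
- by move=> A A' B B' f a g h; apply: val_inj; exact: tensm_linear_l.
- by move=> A A' B B' f a g h; apply: val_inj; exact: tensm_linear_r.
- by move=> A B; apply: val_inj; exact: tensm1.
- by move=> *; apply: val_inj; exact: tensm_comp.
- move=> A A' B B' D D' f g h; apply: val_inj; rewrite /= -!/(cval _) !cval_eqh.
  by rewrite (eqh_irr _ (tensA A' B' D')) (eqh_irr _ (tensA A B D)) tensmA.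
- move=> A A' f; apply: val_inj; rewrite /= -!/(cval _) !cval_eqh.
  by rewrite (eqh_irr _ (tens1o (cob A'))) (eqh_irr _ (tens1o (cob A))) tens1m.
- move=> A A' f; apply: val_inj; rewrite /= -!/(cval _) !cval_eqh.
  by rewrite (eqh_irr _ (tenso1 (cob A'))) (eqh_irr _ (tenso1 (cob A))) tensm1r.
Defined.

(* e_A(B) as a morphism of the center. *)
Lemma center_braid_subproof A B Z :
  (idm Z ⊠ cbr A B) ∘ cbr (center_tens A B) Z
    = cbr (center_tens B A) Z ∘ (cbr A B ⊠ idm Z).
Proof.
have := hb_nat (cbr A) (cbr B Z); rewrite !hb_tens /= /center_tens_e.
move=> /(congr1 (fun x => asc' Z B A ∘ x ∘ asc' A B Z)).
rewrite -!compA /asc /asc' eqhK compf1 => e.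
by apply/esym/(etrans e); rewrite !eqh_compA eqh1 comp1f.
Qed.

Definition center_braid A B : center_hom (center_tens A B) (center_tens B A) :=
  @cmor (center_tens A B) (center_tens B A) (cbr A B) (center_braid_subproof A B).

End Center.

Section FullSubcategory.
Context {K : fieldType} (D : tcat K) (P : ob D -> Prop).
Hypothesis P1 : P unit_ob.
Hypothesis PM : forall X Y, P X -> P Y -> P (X ⊗ Y).

Definition full_ob := {X : ob D | P X}.

Lemma full_ob_eq (X Y : full_ob) : sval X = sval Y -> X = Y.
Proof. by case: X Y => [X p] [Y q] /= e; subst Y; rewrite (Prop_irrelevance p q). Qed.

Definition full_lincat : lincat K.
Proof.
apply: (@LinCat K full_ob (fun X Y => hom (sval X) (sval Y))
  (fun X => idm (sval X)) (fun X Y Z g f => g ∘ f)).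
- by move=> *; exact: comp1f.
- by move=> *; exact: compf1.
- by move=> *; exact: compA.
- by move=> *; exact: comp_linear_l.
- by move=> *; exact: comp_linear_r.
Defined.

Lemma eqh_full (X Y : full_ob) (q : X = Y) :
  @eqh K full_lincat X Y q = eqh (f_equal sval q).
Proof. by case: _ / q; rewrite eqh1. Qed.

Definition full_one : full_ob := exist _ unit_ob P1.
Definition full_tens (X Y : full_ob) : full_ob :=
  exist _ (sval X ⊗ sval Y) (PM (svalP X) (svalP Y)).

Definition full_tcat : tcat K.
Proof.
apply: (@TCat K full_lincat full_one full_tens (fun X X' Y Y' f g => f ⊠ g) _ _ _ _
  (fun X Y Z => @full_ob_eq (full_tens X (full_tens Y Z)) (full_tens (full_tens X Y) Z)
      (tensA (sval X) (sval Y) (sval Z)))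
  (fun X => @full_ob_eq (full_tens full_one X) X (tens1o (sval X)))
  (fun X => @full_ob_eq (full_tens X full_one) X (tenso1 (sval X)))).
- by move=> *; exact: tensm_linear_l.
- by move=> *; exact: tensm_linear_r.
- by move=> *; exact: tensm1.
- by move=> *; exact: tensm_comp.
- move=> X X' Y Y' Z Z' f g h; rewrite /= !eqh_full.
  by rewrite (eqh_irr _ (tensA _ _ _)) (eqh_irr _ (tensA (sval X) _ _)) tensmA.
- move=> X X' f; rewrite /= !eqh_full.
  by rewrite (eqh_irr _ (tens1o _)) (eqh_irr _ (tens1o (sval X))) tens1m.
- move=> X X' f; rewrite /= !eqh_full.
  by rewrite (eqh_irr _ (tenso1 _)) (eqh_irr _ (tenso1 (sval X))) tensm1r.
Defined.

End FullSubcategory.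

Section FiniteDimension.
Context {K : fieldType}.

Definition finite_dimensional (V : lmodType K) :=
  exists n (b : 'I_n -> V), forall v, exists c : 'I_n -> K, v = \sum_i c i *: b i.

Lemma finite_dimensional_sub (U V : lmodType K) (f : U -> V) :
  linear f -> injective f -> finite_dimensional V -> finite_dimensional U.
Proof.
move=> flin finj [n [b bspan]].
pose fl := GRing.isLinear.Build K U V _ f flin.
pose F : {linear U -> V} := HB.pack f fl.
pose phi (x : 'rV[K]_n) : V := \sum_i x 0 i *: b i.
have philin : linear phi.
  move=> a x y; rewrite /phi scaler_sumr -big_split; apply: eq_bigr => i _ /=.
  by rewrite !mxE scalerDl scalerA.
pose pl := GRing.isLinear.Build K 'rV[K]_n V _ phi philin.
pose Phi : {linear 'rV[K]_n -> V} := HB.pack phi pl.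
pose W x := exists u, Phi x = F u.
pose Q r := `[< exists M : 'M[K]_n, \rank M = r /\ forall y : 'rV_n, (y <= M)%MS -> W y >].
have Q0 : exists r, Q r.
  exists 0%N; apply/asboolP; exists 0; split; first exact: mxrank0.
  by move=> y; rewrite submx0 => /eqP ->; exists 0; rewrite !linear0.
have Qle r : Q r -> (r <= n)%N by move=> /asboolP[M [<- _]]; exact: rank_leq_row.
case: (ex_maxnP Q0 Qle) => r /asboolP[M [Mr MW]] rmax.
have WM x : W x -> (x <= M)%MS.
  move=> [u xu]; suff le : (\rank (M + x)%MS <= \rank M)%N.
    have [_] := mxrank_leqif_sup (addsmxSl M x).
    rewrite eqn_leq le mxrankS ?addsmxSl //= => /esym h.
    exact: submx_trans (addsmxSr M x) h.
  rewrite Mr; apply: rmax; apply/asboolP; exists (M + x)%MS; split=> // y.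
  move=> /sub_addsmxP[[c1 c2] /= ->].
  have [u1 e1] := MW (c1 *m M) (submxMl _ _).
  exists (u1 + c2 0 0 *: u); rewrite {1}(mx11_scalar c2) mul_scalar_mx.
  by rewrite !linearD !linearZ e1 xu.
have /choice[g gE] : forall i, exists u, Phi (row i M) = F u.
  by move=> i; apply: MW; exact: row_sub.
exists n, g => u; have [c cE] := bspan (F u).
have xE : Phi (\row_i c i) = F u.
  by rewrite cE; apply: eq_bigr => i _; rewrite mxE.
have /submxP[d dE] : (\row_i c i <= M)%MS by apply: WM; exists u.
exists (fun i => d 0 i); apply: finj; rewrite -[f u]/(F u) -[f _]/(F _) -xE dE.
rewrite mulmx_sum_row !linear_sum; apply: eq_bigr => i _.
by rewrite !linearZ /= -[phi _]/(Phi _) gE.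
Qed.

End FiniteDimension.

Record star_tcat (K : numClosedFieldType) := StarTCat {
  star_tc :> tcat K;
  hom_findim : forall X Y : ob star_tc, finite_dimensional (hom X Y);
  star : forall X Y : ob star_tc, hom X Y -> hom Y X;
  star_antilinear : forall X Y (a : K) (f g : hom X Y),
    star (a *: f + g) = a^* *: star f + star g;
  starK : forall X Y (f : hom X Y), star (star f) = f;
  star_comp : forall X Y Z (g : hom Y Z) (f : hom X Y),
    star (g ∘ f) = star f ∘ star g;
  star_tens : forall X X' Y Y' (f : hom X X') (g : hom Y Y'),
    star (f ⊠ g) = star f ⊠ star g;
  star_positive : forall X Y (f : hom X Y), star f ∘ f = 0 -> f = 0
}.
Arguments star {K s X Y} f.

Section StarNotions.
Context {K : numClosedFieldType} (C : star_tcat K).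
Implicit Types X Y Z : ob C.

Definition unitary X Y (f : hom X Y) := star f ∘ f = idm X /\ f ∘ star f = idm Y.

(* In a *-category direct sums are orthogonal: the injections are isometries. *)
Definition has_orthogonal_sums := forall n (S : 'I_n -> ob C),
  exists X (v : forall i, hom (S i) X),
    [/\ forall i, star (v i) ∘ v i = idm (S i),
        forall i j, i != j -> star (v i) ∘ v j = 0
      & \sum_i v i ∘ star (v i) = idm X].

Lemma star_idm X : star (idm X) = idm X.
Proof. by rewrite -[LHS]comp1f -{1}(starK (idm X)) -star_comp comp1f starK. Qed.

Lemma star_eqh X Y (p : X = Y) : star (eqh p) = eqh (esym p).
Proof. by case: _ / p; exact: star_idm. Qed.

Lemma unitary_eqh X Y (p : X = Y) : unitary (eqh p).
Proof. by split; rewrite star_eqh eqhK. Qed.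

Lemma unitary_comp X Y Z (g : hom Y Z) (f : hom X Y) :
  unitary g -> unitary f -> unitary (g ∘ f).
Proof.
move=> [g1 g2] [f1 f2]; split; rewrite star_comp.
  by rewrite -compA (compA _ g) g1 comp1f.
by rewrite -compA (compA f) f2 comp1f.
Qed.

Lemma unitary_tens X X' Y Y' (f : hom X X') (g : hom Y Y') :
  unitary f -> unitary g -> unitary (f ⊠ g).
Proof.
move=> [f1 f2] [g1 g2]; split; rewrite star_tens -tensm_comp.
  by rewrite f1 g1 tensm1.
by rewrite f2 g2 tensm1.
Qed.

Lemma unitary_idm X : unitary (idm X).
Proof. exact: (unitary_eqh erefl). Qed.

Definition unitary_hb (A : ob (center_tcat C)) := forall Y, unitary (cbr A Y).

Lemma unitary_hb_one : unitary_hb (unit_ob : ob (center_tcat C)).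
Proof. by move=> Y; apply: unitary_comp; apply: unitary_eqh. Qed.

Lemma unitary_hb_tens (A B : ob (center_tcat C)) :
  unitary_hb A -> unitary_hb B -> unitary_hb (A ⊗ B).
Proof.
move=> uA uB Y; rewrite /= /center_tens_e; repeat apply: unitary_comp; try exact: unitary_eqh.
  exact: unitary_tens (uA Y) (unitary_idm _).
exact: unitary_tens (unitary_idm _) (uB Y).
Qed.

Definition unitary_center : tcat K := full_tcat unitary_hb_one unitary_hb_tens.

Section CenterStar.
Variables (A B : center_ob C) (uA : unitary_hb A) (uB : unitary_hb B).

Lemma center_star_subproof (t : center_hom A B) Z :
  (idm Z ⊠ star (cval t)) ∘ cbr B Z = cbr A Z ∘ (star (cval t) ⊠ idm Z).
Proof.
have [_ a2] := uA Z; have [b1 _] := uB Z.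
have /(congr1 star) := cmorP t Z; rewrite !star_comp !star_tens star_idm => e.
rewrite -[LHS]comp1f -a2 -compA (compA (star _)) e.
by rewrite -(compA _ (star (cbr B Z))) b1 compf1.
Qed.

Definition center_star (t : center_hom A B) : center_hom B A :=
  cmor (center_star_subproof t).

Lemma center_star_antilinear (a : K) (f g : center_hom A B) :
  center_star (a *: f + g) = a^* *: center_star f + center_star g.
Proof. by apply: cval_inj; rewrite cval_linear; exact: star_antilinear. Qed.

Lemma center_hom_findim : finite_dimensional (center_hom A B).
Proof.
exact: (@finite_dimensional_sub _ _ _ (@cval K C A B) (@cval_linear _ _ _ _)
          (@cval_inj _ _ _ _) (hom_findim _ _)).
Qed.

End CenterStar.

Lemma center_star_positive (A B : center_ob C) (uA : unitary_hb A) (uB : unitary_hb B)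
    (f : center_hom A B) : center_comp (center_star uA uB f) f = 0 -> f = 0.
Proof. by move=> /(congr1 (@cval _ _ _ _)) e; apply: cval_inj; exact: star_positive. Qed.

Definition unitary_center_star (A B : ob unitary_center) (t : hom A B) : hom B A :=
  center_star (svalP A) (svalP B) t.

Definition unitary_double : star_tcat K.
Proof.
apply: (@StarTCat K unitary_center _ unitary_center_star).
- by move=> A B; exact: center_hom_findim.
- by move=> A B a f g; exact: (center_star_antilinear (svalP A) (svalP B)).
- by move=> A B f; apply: (@cval_inj _ _ (sval A) (sval B)); exact: starK.
- by move=> A B D g f; apply: (@cval_inj _ _ (sval D) (sval A)); exact: star_comp.
- by move=> A A' B B' f g; apply: cval_inj; exact: star_tens.
- by move=> A B f; exact: center_star_positive.
Defined.

Definition unitary_double_braid (A B : ob unitary_double) : hom (A ⊗ B) (B ⊗ A) :=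
  center_braid (sval A) (sval B).

End StarNotions.

Record monoidal_functor (K : fieldType) (D E : tcat K) := MonoidalFunctor {
  fob :> ob D -> ob E;
  fmor : forall X Y, hom X Y -> hom (fob X) (fob Y);
  fmor_linear : forall X Y, linear (@fmor X Y);
  fmor_idm : forall X, fmor (idm X) = idm (fob X);
  fmor_comp : forall X Y Z (g : hom Y Z) (f : hom X Y), fmor (g ∘ f) = fmor g ∘ fmor f;
  fone : hom unit_ob (fob unit_ob);
  ftens : forall X Y, hom (fob X ⊗ fob Y) (fob (X ⊗ Y));
  fone_iso : is_iso fone;
  ftens_iso : forall X Y, is_iso (ftens X Y);
  ftens_nat : forall X X' Y Y' (f : hom X X') (g : hom Y Y'),
    fmor (f ⊠ g) ∘ ftens X Y = ftens X' Y' ∘ (fmor f ⊠ fmor g);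
  ftens_assoc : forall X Y Z,
    fmor (asc X Y Z) ∘ ftens X (Y ⊗ Z) ∘ (idm (fob X) ⊠ ftens Y Z)
      = ftens (X ⊗ Y) Z ∘ (ftens X Y ⊠ idm (fob Z)) ∘ asc (fob X) (fob Y) (fob Z);
  ftens_one_l : forall X, fmor (lu X) ∘ ftens unit_ob X ∘ (fone ⊠ idm (fob X)) = lu (fob X);
  ftens_one_r : forall X, fmor (ru X) ∘ ftens X unit_ob ∘ (idm (fob X) ⊠ fone) = ru (fob X)
}.
Arguments fmor {K D E} m {X Y} f.
Arguments fone {K D E} m.
Arguments ftens {K D E} m X Y.

(* A monoidal natural isomorphism from the composite G F to the identity. *)
Definition monoidal_retract (K : fieldType) (D E : tcat K)
    (F : monoidal_functor D E) (G : monoidal_functor E D) :=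
  exists t : forall X, hom (G (F X)) X,
    [/\ forall X, is_iso (t X),
        forall X Y (f : hom X Y), f ∘ t X = t Y ∘ fmor G (fmor F f),
        forall X Y, t (X ⊗ Y) ∘ (fmor G (ftens F X Y) ∘ ftens G (F X) (F Y)) = t X ⊠ t Y
      & t unit_ob ∘ (fmor G (fone F) ∘ fone G) = idm unit_ob].

Definition monoidally_equivalent (K : fieldType) (D E : tcat K) :=
  exists (F : monoidal_functor D E) (G : monoidal_functor E D),
    monoidal_retract F G /\ monoidal_retract G F.

Section Duality.
Context {K : fieldType} {D : tcat K}.
Implicit Types X Y Z : ob D.

(* (ev ⊗ id_X) (id_X ⊗ coev) *)
Definition zigzag X Y (ev : hom (X ⊗ Y) unit_ob) (coev : hom unit_ob (Y ⊗ X)) : hom X X :=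
  lu X ∘ (ev ⊠ idm X) ∘ asc X Y X ∘ (idm X ⊠ coev) ∘ ru' X.

(* (id_X ⊗ ev) (coev ⊗ id_X) *)
Definition zagzig X Y (ev : hom (Y ⊗ X) unit_ob) (coev : hom unit_ob (X ⊗ Y)) : hom X X :=
  ru X ∘ (idm X ⊠ ev) ∘ asc' X Y X ∘ (coev ⊠ idm X) ∘ lu' X.

Record two_sided_dual X := TwoSidedDual {
  dob :> ob D;
  coevL : hom unit_ob (X ⊗ dob);
  evL : hom (dob ⊗ X) unit_ob;
  coevR : hom unit_ob (dob ⊗ X);
  evR : hom (X ⊗ dob) unit_ob
}.

Definition is_two_sided_dual X (d : two_sided_dual X) :=
  [/\ zagzig (evL d) (coevL d) = idm X, zigzag (evL d) (coevL d) = idm (dob d),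
      zigzag (evR d) (coevR d) = idm X & zagzig (evR d) (coevR d) = idm (dob d)].

Definition dual_one : two_sided_dual (unit_ob : ob D) :=
  TwoSidedDual (lu' unit_ob) (lu unit_ob) (lu' unit_ob) (lu unit_ob).

Definition dual_tens X Y (dX : two_sided_dual X) (dY : two_sided_dual Y) :
    two_sided_dual (X ⊗ Y) :=
  @TwoSidedDual (X ⊗ Y) (dob dY ⊗ dob dX)
    (asc X Y (dob dY ⊗ dob dX)
      ∘ (idm X ⊠ (asc' Y (dob dY) (dob dX) ∘ (coevL dY ⊠ idm (dob dX)) ∘ lu' (dob dX)))
      ∘ coevL dX)
    (evL dY
      ∘ (idm (dob dY) ⊠ (lu Y ∘ (evL dX ⊠ idm Y) ∘ asc (dob dX) X Y))
      ∘ asc' (dob dY) (dob dX) (X ⊗ Y))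
    (asc (dob dY) (dob dX) (X ⊗ Y)
      ∘ (idm (dob dY) ⊠ (asc' (dob dX) X Y ∘ (coevR dX ⊠ idm Y) ∘ lu' Y))
      ∘ coevR dY)
    (evR dX
      ∘ (idm X ⊠ (lu (dob dX) ∘ (evR dY ⊠ idm (dob dX)) ∘ asc Y (dob dY) (dob dX)))
      ∘ asc' X Y (dob dY ⊗ dob dX)).

(* The transpose of f with respect to (evL, coevL), resp. (evR, coevR). *)
Definition transposeL X Y (dX : two_sided_dual X) (dY : two_sided_dual Y) (f : hom X Y) :
    hom (dob dY) (dob dX) :=
  lu (dob dX) ∘ ((evL dY ∘ (idm (dob dY) ⊠ f)) ⊠ idm (dob dX)) ∘ asc (dob dY) X (dob dX)
    ∘ (idm (dob dY) ⊠ coevL dX) ∘ ru' (dob dY).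

Definition transposeR X Y (dX : two_sided_dual X) (dY : two_sided_dual Y) (f : hom X Y) :
    hom (dob dY) (dob dX) :=
  ru (dob dX) ∘ (idm (dob dX) ⊠ (evR dY ∘ (f ⊠ idm (dob dY)))) ∘ asc' (dob dX) X (dob dY)
    ∘ (coevR dX ⊠ idm (dob dY)) ∘ lu' (dob dY).

Definition traceL X (d : two_sided_dual X) (s : hom X X) : hom (unit_ob : ob D) unit_ob :=
  evL d ∘ (idm (dob d) ⊠ s) ∘ coevR d.

Definition traceR X (d : two_sided_dual X) (s : hom X X) : hom (unit_ob : ob D) unit_ob :=
  evR d ∘ (s ⊠ idm (dob d)) ∘ coevL d.

(* Left and right duals coincide as monoidal functors, i.e. d is a pivotal
   structure, and left and right traces coincide. The two middle conditions
   compare the isomorphisms (X ⊗ Y)^* = Y^* ⊗ X^* and 1^* = 1 coming from the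
   left and from the right duality. *)
Definition spherical_structure (d : forall X, two_sided_dual X) :=
  [/\ forall X, is_two_sided_dual (d X),
      forall X Y (f : hom X Y), transposeL (d X) (d Y) f = transposeR (d X) (d Y) f,
      forall X Y, transposeL (d (X ⊗ Y)) (dual_tens (d X) (d Y)) (idm (X ⊗ Y))
        = transposeR (d (X ⊗ Y)) (dual_tens (d X) (d Y)) (idm (X ⊗ Y)),
      transposeL (d unit_ob) dual_one (idm unit_ob) = transposeR (d unit_ob) dual_one (idm unit_ob)
    & forall X (s : hom X X), traceL (d X) s = traceR (d X) s].

Definition is_braiding (c : forall X Y, hom (X ⊗ Y) (Y ⊗ X)) :=
  [/\ forall X Y, is_iso (c X Y),
      forall X X' Y Y' (f : hom X X') (g : hom Y Y'),
        (g ⊠ f) ∘ c X Y = c X' Y' ∘ (f ⊠ g),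
      forall X Y Z, c X (Y ⊗ Z)
        = asc Y Z X ∘ (idm Y ⊠ c X Z) ∘ asc' Y X Z ∘ (c X Y ⊠ idm Z) ∘ asc X Y Z
    & forall X Y Z, c (X ⊗ Y) Z
        = asc' Z X Y ∘ (c X Z ⊠ idm Y) ∘ asc X Z Y ∘ (idm X ⊠ c Y Z) ∘ asc' X Y Z].

Definition is_S_matrix (c : forall X Y, hom (X ⊗ Y) (Y ⊗ X))
    (d : forall X, two_sided_dual X) n (S : 'I_n -> ob D) (M : 'M[K]_n) :=
  forall i j, traceL (d (S i ⊗ S j)) (c (S j) (S i) ∘ c (S i) (S j)) = M i j *: idm unit_ob.

Definition modular (c : forall X Y, hom (X ⊗ Y) (Y ⊗ X))
    (d : forall X, two_sided_dual X) :=
  [/\ semisimple D, is_simple (unit_ob : ob D), is_braiding c, spherical_structure d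
    & exists n (S : 'I_n -> ob D) (M : 'M[K]_n),
        [/\ simple_representatives S, is_S_matrix c d S M & M \in unitmx]].

End Duality.

Section Conjugates.
Context {K : numClosedFieldType} (C : star_tcat K).
Implicit Types X Y Z : ob C.

Record conjugate X := Conjugate {
  cjob : ob C;
  cjr : hom unit_ob (cjob ⊗ X);
  cjrb : hom unit_ob (X ⊗ cjob);
  cj_eq1 : zigzag (star cjrb) cjr = idm X;
  cj_eq2 : zigzag (star cjr) cjrb = idm cjob
}.

Definition has_conjugates := forall X, inhabited (conjugate X).

Definition is_standard X (s : conjugate X) := forall t : hom X X,
  star (cjr s) ∘ (idm (cjob s) ⊠ t) ∘ cjr s = star (cjrb s) ∘ (t ⊠ idm (cjob s)) ∘ cjrb s.

Definition standard_conjugate X := {s : conjugate X | is_standard s}.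

Definition standard_dual X (s : standard_conjugate X) : two_sided_dual X :=
  TwoSidedDual (cjrb (sval s)) (star (cjr (sval s))) (cjr (sval s)) (star (cjrb (sval s))).

(* A braided tensor *-category is modular if standard solutions of the conjugate
   equations exist and make it modular; dimensions and traces do not depend on
   the choice of standard solutions. *)
Definition star_modular (c : forall X Y, hom (X ⊗ Y) (Y ⊗ X)) :=
  (forall X, inhabited (standard_conjugate X)) /\
  forall s : (forall X, standard_conjugate X), modular c (fun X => standard_dual (s X)).

End Conjugates.

(* Main.v *)
(* Write Z for the center and D for the unitary center.

   Averaging over the simple objects turns a morphism t : X -> X' of C into a morphism
   E(t) of Z. Applied to the identity, between the half braidings e and (e^-1)^*, this gives
   an invertible h^* h, and transport along its positive square root makes e unitary. Hence
   the full subcategory D of Z is equivalent to Z, and it inherits sums, subobjects and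
   conjugates. By Schur's lemma E makes the matrix coefficients of inequivalent simple
   objects of D orthogonal; since they live in a finite dimensional space, there are
   finitely many of these objects.

   The trace of any standard solution is the explicit trace given by a decomposition into
   simple objects, hence it is cyclic. This gives sphericity and the behaviour of standard
   solutions under tensor products.

   The entry S(A, B) is, up to the nonzero dimension of B, the scalar by which the partial
   trace over A of the monodromy acts on B. So let a combination, over the simple A with
   coefficients z_A, of these partial traces vanish on every simple B of D; then it vanishes
   on every object of Z. On the objects induced from C, sums over i of S_i V S_i^* whose half
   braiding is built from bases of Hom(S_i, Y S_j), this relation unbends into a linear
   relation between matrix coefficients of the half braidings of the A, and orthogonality
   with positivity of E(w^* w) gives z_A = 0. *)

Require Import Defs.
From HB Require Import structures.
From mathcomp Require Import all_boot all_order all_algebra.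
From mathcomp Require Import boolp reals complex.
Import Defs.
Set Implicit Arguments.
Unset Strict Implicit.
Unset Printing Implicit Defensive.
Import Order.TTheory GRing.Theory Num.Theory.
Local Open Scope ring_scope.

Notation "f ▷ l" := (tensm f (idm l)) (at level 30, right associativity).
Notation "X ◁ u" := (tensm (idm X) u) (at level 30, right associativity).

(** Strictness is an equality of objects, so every associativity constraint is a cast, and casts
    would swamp the diagrams. Identities are therefore proved for morphisms acting on the left end
    of a right-nested product with an arbitrary tail [l], where the casts cancel, and are read back
    at the unit tail. The only analytic input is that [star f ∘ f = 0] forces [f = 0]. Orthogonal
    sums turn a sum of squares into a single square, minimal polynomials replace spectral theory,
    and an average of a square is nondegenerate because its half loops are injective. Invertibility
    of a half braiding is never checked by hand: duality supplies it from the other axioms. Bases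
    are replaced by frames, that is, resolutions of the identity; they need not be linearly
    independent, so a vanishing combination of frame vectors is used by pairing it with a covector
    and not by comparing coefficients. *)

Section LinearMaps.
Context {K : fieldType} {U V : lmodType K} (f : U -> V).
Hypothesis hf : linear f.

Let pf := GRing.isLinear.Build K U V _ f hf.
Let F : {linear U -> V} := HB.pack f pf.

Lemma linear_sumE n (x : 'I_n -> U) : f (\sum_i x i) = \sum_i f (x i).
Proof. exact: (linear_sum F). Qed.
Lemma linear_0E : f 0 = 0. Proof. exact: (linear0 F). Qed.
Lemma linear_ZE a x : f (a *: x) = a *: f x. Proof. exact: (linearZ_LR F). Qed.
Lemma linear_DE x y : f (x + y) = f x + f y. Proof. exact: (linearD F). Qed.
Lemma linear_BE x y : f (x - y) = f x - f y. Proof. exact: (linearB F). Qed.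
Lemma linear_NE x : f (- x) = - f x. Proof. exact: (linearN F). Qed.
End LinearMaps.

(** * Linearity of composition and of the tensor product *)

Section LinCat.
Context {K : fieldType} {C : lincat K}.
Implicit Types X Y Z : ob C.

Section Comp.
Variables (X Y Z : ob C).
Implicit Types (f : hom X Y) (g : hom Y Z).
Lemma comp0l f : (0 : hom Y Z) ∘ f = 0. Proof. exact: linear_0E (comp_linear_l f). Qed.
Lemma comp0r g : g ∘ (0 : hom X Y) = 0. Proof. exact: linear_0E (comp_linear_r g). Qed.
Lemma compZl f a g : (a *: g) ∘ f = a *: (g ∘ f). Proof. exact: linear_ZE (comp_linear_l f) a g. Qed.
Lemma compZr f a g : g ∘ (a *: f) = a *: (g ∘ f). Proof. exact: linear_ZE (comp_linear_r g) a f. Qed.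
Lemma compDl f g h : (g + h) ∘ f = g ∘ f + h ∘ f. Proof. exact: linear_DE (comp_linear_l f) g h. Qed.
Lemma compDr g f h : g ∘ (f + h) = g ∘ f + g ∘ h. Proof. exact: linear_DE (comp_linear_r g) f h. Qed.
Lemma compBl f g h : (g - h) ∘ f = g ∘ f - h ∘ f. Proof. exact: linear_BE (comp_linear_l f) g h. Qed.
Lemma compBr g f h : g ∘ (f - h) = g ∘ f - g ∘ h. Proof. exact: linear_BE (comp_linear_r g) f h. Qed.
Lemma compNl f g : (- g) ∘ f = - (g ∘ f). Proof. exact: linear_NE (comp_linear_l f) g. Qed.
Lemma comp_suml f n (g : 'I_n -> hom Y Z) : (\sum_i g i) ∘ f = \sum_i g i ∘ f.
Proof. exact: linear_sumE (comp_linear_l f) n g. Qed.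
Lemma comp_sumr g n (f : 'I_n -> hom X Y) : g ∘ (\sum_i f i) = \sum_i g ∘ f i.
Proof. exact: linear_sumE (comp_linear_r g) n f. Qed.
End Comp.

(** Composites are kept right-nested, so a rule for [g ∘ f] has to be applied with a further factor
    [h] behind it. *)
Lemma reassoc W X Y Z (g : hom Y Z) (f : hom X Y) (k : hom X Z) (h : hom W X) :
  g ∘ f = k -> g ∘ (f ∘ h) = k ∘ h.
Proof. by move=> <-; rewrite compA. Qed.

Lemma comp1K W X Y (g : hom Y X) (f : hom X Y) (h : hom W X) :
  g ∘ f = idm X -> g ∘ (f ∘ h) = h.
Proof. by move=> e; rewrite compA e comp1f. Qed.

Lemma scale_idm_inj X (a b : K) : idm X <> 0 -> a *: idm X = b *: idm X -> a = b.
Proof.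
move=> X0 e; apply/eqP; rewrite -subr_eq0; apply/negPn/negP => ab.
apply: X0; have : (a - b) *: idm X = 0 by rewrite scalerBl e subrr.
by move/(congr1 (fun f => (a - b)^-1 *: f)); rewrite scalerA mulVf // scale1r scaler0.
Qed.

End LinCat.

Section TensorLinear.
Context {K : fieldType} {C : tcat K}.
Variables (X X' Y Y' : ob C).
Implicit Types (f : hom X X') (g : hom Y Y').
Lemma tens0l g : (0 : hom X X') ⊠ g = 0. Proof. exact: linear_0E (tensm_linear_l g). Qed.
Lemma tens0r f : f ⊠ (0 : hom Y Y') = 0. Proof. exact: linear_0E (tensm_linear_r f). Qed.
Lemma tensZl f a g : (a *: f) ⊠ g = a *: (f ⊠ g). Proof. exact: linear_ZE (tensm_linear_l g) a f. Qed.
Lemma tensZr f a g : f ⊠ (a *: g) = a *: (f ⊠ g). Proof. exact: linear_ZE (tensm_linear_r f) a g. Qed.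
Lemma tens_suml g n (f : 'I_n -> hom X X') : (\sum_i f i) ⊠ g = \sum_i f i ⊠ g.
Proof. exact: linear_sumE (tensm_linear_l g) n f. Qed.
Lemma tens_sumr f n (g : 'I_n -> hom Y Y') : f ⊠ (\sum_i g i) = \sum_i f ⊠ g i.
Proof. exact: linear_sumE (tensm_linear_r f) n g. Qed.
End TensorLinear.

(** * Calculus of morphisms acting on the left end of a right-nested product *)

Section Tail.
Context {K : fieldType} {C : tcat K}.
Implicit Types X Y Z W l m : ob C.

Lemma exch X Y l m (f : hom X Y) (u : hom l m) : f ▷ m ∘ X ◁ u = Y ◁ u ∘ f ▷ l.
Proof. by rewrite -!tensm_comp !comp1f !compf1. Qed.

Lemma ascK X Y l : asc X Y l ∘ asc' X Y l = idm _. Proof. exact: eqhK. Qed.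
Lemma asc'K X Y l : asc' X Y l ∘ asc X Y l = idm _. Proof. exact: eqhK. Qed.
Lemma luK l : lu l ∘ lu' l = idm _. Proof. exact: eqhK. Qed.
Lemma lu'K l : lu' l ∘ lu l = idm _. Proof. exact: eqhK. Qed.
Lemma ru'K l : ru' l ∘ ru l = idm _. Proof. exact: eqhK. Qed.

Lemma lu_nat l m (u : hom l m) : lu m ∘ unit_ob ◁ u = u ∘ lu l. Proof. exact: tens1m. Qed.
Lemma lu'_nat l m (u : hom l m) : lu' m ∘ u = unit_ob ◁ u ∘ lu' l.
Proof.
by rewrite -[LHS]compf1 -(luK l) -compA (compA u) -lu_nat !compA lu'K comp1f.
Qed.

(* The action aPQ f l of a morphism f from a product of P objects to a product of Q objects
   on the left end of a right-nested product with tail l. In terms of these actions the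
   associativity constraints disappear from most computations. They are locked, so that
   rewriting with associativity of the composition does not look inside them. *)
Fact tail_key : unit. Proof. exact: tt. Qed.
Definition a22 X Y Z W (f : hom (X ⊗ Y) (Z ⊗ W)) l : hom (X ⊗ (Y ⊗ l)) (Z ⊗ (W ⊗ l)) :=
  locked_with tail_key (asc' Z W l ∘ (f ▷ l ∘ asc X Y l)).
Definition a12 X Z W (f : hom X (Z ⊗ W)) l : hom (X ⊗ l) (Z ⊗ (W ⊗ l)) :=
  locked_with tail_key (asc' Z W l ∘ f ▷ l).
Definition a21 X Y Z (f : hom (X ⊗ Y) Z) l : hom (X ⊗ (Y ⊗ l)) (Z ⊗ l) :=
  locked_with tail_key (f ▷ l ∘ asc X Y l).
Definition a02 Z W (f : hom unit_ob (Z ⊗ W)) l : hom l (Z ⊗ (W ⊗ l)) :=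
  locked_with tail_key (a12 f l ∘ lu' l).
Definition a20 X Y (f : hom (X ⊗ Y) unit_ob) l : hom (X ⊗ (Y ⊗ l)) l :=
  locked_with tail_key (lu l ∘ a21 f l).
Lemma a22E X Y Z W (f : hom (X ⊗ Y) (Z ⊗ W)) l : a22 f l = asc' Z W l ∘ (f ▷ l ∘ asc X Y l).
Proof. by rewrite /a22 locked_withE. Qed.
Lemma a12E X Z W (f : hom X (Z ⊗ W)) l : a12 f l = asc' Z W l ∘ f ▷ l.
Proof. by rewrite /a12 locked_withE. Qed.
Lemma a21E X Y Z (f : hom (X ⊗ Y) Z) l : a21 f l = f ▷ l ∘ asc X Y l.
Proof. by rewrite /a21 locked_withE. Qed.
Lemma a02E Z W (f : hom unit_ob (Z ⊗ W)) l : a02 f l = a12 f l ∘ lu' l.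
Proof. by rewrite /a02 locked_withE. Qed.
Lemma a20E X Y (f : hom (X ⊗ Y) unit_ob) l : a20 f l = lu l ∘ a21 f l.
Proof. by rewrite /a20 locked_withE. Qed.

Lemma asc_tail X Y l m (u : hom l m) : asc X Y m ∘ X ◁ Y ◁ u = (X ⊗ Y) ◁ u ∘ asc X Y l.
Proof. by rewrite asc_nat tensm1. Qed.
Lemma asc'_tail X Y l m (u : hom l m) : asc' X Y m ∘ (X ⊗ Y) ◁ u = X ◁ Y ◁ u ∘ asc' X Y l.
Proof. by rewrite -asc'_nat tensm1. Qed.

Lemma a22_tail X Y Z W (f : hom (X ⊗ Y) (Z ⊗ W)) l m (u : hom l m) :
  a22 f m ∘ X ◁ Y ◁ u = Z ◁ W ◁ u ∘ a22 f l.
Proof. by rewrite ?a22E -!compA asc_tail (reassoc _ (exch f u)) -compA (reassoc _ (asc'_tail _ _ u)) -!compA. Qed.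
Lemma a12_tail X Z W (f : hom X (Z ⊗ W)) l m (u : hom l m) :
  a12 f m ∘ X ◁ u = Z ◁ W ◁ u ∘ a12 f l.
Proof. by rewrite ?a12E -!compA exch (reassoc _ (asc'_tail _ _ u)) -!compA. Qed.
Lemma a21_tail X Y Z (f : hom (X ⊗ Y) Z) l m (u : hom l m) :
  a21 f m ∘ X ◁ Y ◁ u = Z ◁ u ∘ a21 f l.
Proof. by rewrite ?a21E -!compA asc_tail (reassoc _ (exch f u)) -compA. Qed.
Lemma a02_tail Z W (f : hom unit_ob (Z ⊗ W)) l m (u : hom l m) :
  a02 f m ∘ u = Z ◁ W ◁ u ∘ a02 f l.
Proof. by rewrite !a02E !a12E -!compA lu'_nat (reassoc _ (exch f u)) -compA (reassoc _ (asc'_tail _ _ u)) -!compA. Qed.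
Lemma a20_tail X Y (f : hom (X ⊗ Y) unit_ob) l m (u : hom l m) :
  a20 f m ∘ X ◁ Y ◁ u = u ∘ a20 f l.
Proof. by rewrite !a20E !a21E -!compA asc_tail (reassoc _ (exch f u)) -compA (reassoc _ (lu_nat u)) -!compA. Qed.

(* u l is u unit_ob ⊠ idm l, up to equalities of objects. Such families are the images of
   morphisms, which untail recovers. *)
Definition tailmod (F G : ob C -> ob C) (u : forall l, hom (F l) (G l)) :=
  forall l m, heq (u (l ⊗ m)) (u l ▷ m).

Lemma heq_cong (F G : ob C -> ob C) (u : forall l, hom (F l) (G l)) l m :
  l = m -> heq (u l) (u m).
Proof. by move=> ->; exact: heq_refl. Qed.

Lemma tailmod_comp (F G H : ob C -> ob C) (u : forall l, hom (F l) (G l))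
    (v : forall l, hom (G l) (H l)) :
  tailmod u -> tailmod v -> tailmod (fun l => v l ∘ u l).
Proof. by move=> hu hv l m; rewrite tens_compl; apply: heq_comp. Qed.

Lemma tailmod_whisk X (F G : ob C -> ob C) (u : forall l, hom (F l) (G l)) :
  tailmod u -> tailmod (fun l => X ◁ u l).
Proof.
move=> hu l m; apply: heq_trans (heq_tensA _ _ _).
by apply: heq_tens => //; exact: heq_refl.
Qed.

Lemma heq_add (X Y X' Y' : ob C) (f g : hom X Y) (f' g' : hom X' Y') :
  heq f f' -> heq g g' -> heq (f + g) (f' + g').
Proof.
move=> [p [q e]] h; exists p, q; move/(heqP _ _ p q): h => e'.
by rewrite compDr compDl e e'.
Qed.

Lemma heq_zero (X Y X' Y' : ob C) : X = X' -> Y = Y' -> heq (0 : hom X Y) (0 : hom X' Y').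
Proof. by move=> -> ->; exact: heq_refl. Qed.

Lemma tailmod_sum n (F G : ob C -> ob C) (u : 'I_n -> forall l, hom (F l) (G l)) :
  (forall l m, F (l ⊗ m) = F l ⊗ m) -> (forall l m, G (l ⊗ m) = G l ⊗ m) ->
  (forall i, tailmod (u i)) -> tailmod (fun l => \sum_i u i l).
Proof.
move=> hF hG hu l m; rewrite tens_suml.
elim/big_ind2 : _ => [|x1 x2 y1 y2|i _]; [exact: heq_zero|exact: heq_add|exact: hu].
Qed.

Lemma tailmod_asc X Y : tailmod (asc X Y).
Proof.
by move=> l m; rewrite /asc eqh_tensl; apply: heq_eqh2; rewrite !tensA.
Qed.
Lemma tailmod_asc' X Y : tailmod (asc' X Y).
Proof. by move=> l m; rewrite /asc' eqh_tensl; apply: heq_eqh2; rewrite !tensA. Qed.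
Lemma tailmod_lu : tailmod (@lu K C).
Proof. by move=> l m; rewrite /lu eqh_tensl; apply: heq_eqh2; rewrite !tensA. Qed.
Lemma tailmod_lu' : tailmod (@lu' K C).
Proof. by move=> l m; rewrite /lu' eqh_tensl; apply: heq_eqh2. Qed.
Lemma tailmod_rwh X Y (f : hom X Y) : tailmod (fun l => f ▷ l).
Proof. by move=> l m; rewrite -tensm1; exact: heq_tensA. Qed.

Lemma tailmod_at (F G t : ob C -> ob C) (u : forall l, hom (F l) (G l)) :
  tailmod u -> (forall l m, t (l ⊗ m) = t l ⊗ m) -> tailmod (fun l => u (t l)).
Proof. by move=> hu ht l m; apply: heq_trans (hu _ _); apply: heq_cong; exact: ht. Qed.

Lemma tailmod_ext (F G : ob C -> ob C) (u v : forall l, hom (F l) (G l)) :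
  (forall l, u l = v l) -> tailmod v -> tailmod u.
Proof. by move=> e hv l m; rewrite !e; exact: hv. Qed.
Lemma tailmod_a22 X Y Z W (f : hom (X ⊗ Y) (Z ⊗ W)) : tailmod (a22 f).
Proof.
apply: tailmod_ext (a22E f) _; apply: tailmod_comp (@tailmod_asc' _ _).
by apply: tailmod_comp (@tailmod_asc _ _) (@tailmod_rwh _ _ _).
Qed.
Lemma tailmod_a12 X Z W (f : hom X (Z ⊗ W)) : tailmod (a12 f).
Proof.
by apply: tailmod_ext (a12E f) _; exact: tailmod_comp (@tailmod_rwh _ _ _) (@tailmod_asc' _ _).
Qed.
Lemma tailmod_a21 X Y Z (f : hom (X ⊗ Y) Z) : tailmod (a21 f).
Proof.
by apply: tailmod_ext (a21E f) _; exact: tailmod_comp (@tailmod_asc _ _) (@tailmod_rwh _ _ _).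
Qed.
Lemma tailmod_a02 Z W (f : hom unit_ob (Z ⊗ W)) : tailmod (a02 f).
Proof. by apply: tailmod_ext (a02E f) _; exact: tailmod_comp tailmod_lu' (@tailmod_a12 _ _ _ _). Qed.
Lemma tailmod_a20 X Y (f : hom (X ⊗ Y) unit_ob) : tailmod (a20 f).
Proof. by apply: tailmod_ext (a20E f) _; exact: tailmod_comp (@tailmod_a21 _ _ _ _) tailmod_lu. Qed.

Definition untail (F G : ob C -> ob C) X Y (p : X = F unit_ob) (q : Y = G unit_ob)
    (u : forall l, hom (F l) (G l)) : hom X Y :=
  locked_with tail_key (eqh (esym q) ∘ (u unit_ob ∘ eqh p)).

(** At the unit tail, [tailmod] describes [u (unit_ob ⊗ l)], and [unit_ob ⊗ l] equals [l]: one value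
    of the family determines it at every tail. *)
Lemma untailE (F G : ob C -> ob C) X Y (p : X = F unit_ob) (q : Y = G unit_ob)
    (u : forall l, hom (F l) (G l)) : tailmod u -> forall l, heq (untail p q u ▷ l) (u l).
Proof.
move=> hu l; apply: heq_trans (heq_trans (heq_sym (hu unit_ob l)) _).
  rewrite /untail locked_withE !tens_compl !eqh_tensl.
  by apply: heq_trans (heq_castl _ _) _; exact: heq_castr.
by apply: heq_cong; exact: tens1o.
Qed.

Definition m11 X Y (u : forall l, hom (X ⊗ l) (Y ⊗ l)) : hom X Y :=
  untail (F := tens X) (G := tens Y) (esym (tenso1 X)) (esym (tenso1 Y)) u.
Lemma m11E X Y (u : forall l, hom (X ⊗ l) (Y ⊗ l)) l : tailmod u -> m11 u ▷ l = u l.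
Proof. by move=> hu; apply: heq_eq; exact: untailE hu l. Qed.

Definition m22 X Y Z W (u : forall l, hom (X ⊗ (Y ⊗ l)) (Z ⊗ (W ⊗ l))) : hom (X ⊗ Y) (Z ⊗ W) :=
  untail (F := fun l => X ⊗ (Y ⊗ l)) (G := fun l => Z ⊗ (W ⊗ l))
    (f_equal (tens X) (esym (tenso1 Y))) (f_equal (tens Z) (esym (tenso1 W))) u.
Lemma m22E X Y Z W (u : forall l, hom (X ⊗ (Y ⊗ l)) (Z ⊗ (W ⊗ l))) l :
  tailmod u -> a22 (m22 u) l = u l.
Proof.
move=> hu; apply: heq_eq; apply: (@heq_trans _ _ _ _ _ _ _ _ _ (m22 u ▷ l)); last exact: untailE.
rewrite a22E.
by apply: heq_trans (heq_castl _ _) _; exact: heq_castr.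
Qed.

Definition m12 X Z W (u : forall l, hom (X ⊗ l) (Z ⊗ (W ⊗ l))) : hom X (Z ⊗ W) :=
  untail (F := fun l => X ⊗ l) (G := fun l => Z ⊗ (W ⊗ l))
    (esym (tenso1 X)) (f_equal (tens Z) (esym (tenso1 W))) u.
Lemma m12E X Z W (u : forall l, hom (X ⊗ l) (Z ⊗ (W ⊗ l))) l :
  tailmod u -> a12 (m12 u) l = u l.
Proof.
move=> hu; apply: heq_eq; apply: (@heq_trans _ _ _ _ _ _ _ _ _ (m12 u ▷ l)); last exact: untailE.
rewrite a12E.
exact: heq_castl.
Qed.

Definition m21 X Z W (u : forall l, hom (Z ⊗ (W ⊗ l)) (X ⊗ l)) : hom (Z ⊗ W) X :=
  untail (F := fun l => Z ⊗ (W ⊗ l)) (G := fun l => X ⊗ l)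
    (f_equal (tens Z) (esym (tenso1 W))) (esym (tenso1 X)) u.
Lemma m21E X Z W (u : forall l, hom (Z ⊗ (W ⊗ l)) (X ⊗ l)) l :
  tailmod u -> a21 (m21 u) l = u l.
Proof.
move=> hu; apply: heq_eq; apply: (@heq_trans _ _ _ _ _ _ _ _ _ (m21 u ▷ l)); last exact: untailE.
rewrite a21E.
exact: heq_castr.
Qed.

(** Tensoring with the unit is a cast, so an identity of actions at the unit tail already returns an
    identity of morphisms. *)
Lemma rwh_inj X Y (f g : hom X Y) : f ▷ unit_ob = g ▷ unit_ob -> f = g.
Proof.
move=> e; apply: heq_eq; apply: heq_trans (heq_sym (heq_tensm1r f)) _.
by rewrite e; exact: heq_tensm1r.
Qed.

Lemma eqh_mono X Y Z (p : Y = Z) (f g : hom X Y) : eqh p ∘ f = eqh p ∘ g -> f = g.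
Proof. by case: _ / p => /=; rewrite !comp1f. Qed.
Lemma eqh_epi X Y Z (p : X = Y) (f g : hom Y Z) : f ∘ eqh p = g ∘ eqh p -> f = g.
Proof. by case: _ / p f g => f g /=; rewrite !compf1. Qed.

Lemma a22_inj X Y Z W (f g : hom (X ⊗ Y) (Z ⊗ W)) :
  a22 f unit_ob = a22 g unit_ob -> f = g.
Proof. by rewrite ?a22E ?a20E ?a02E ?a12E ?a21E -?compA => /eqh_mono /eqh_epi /rwh_inj. Qed.
Lemma a02_inj Z W (f g : hom unit_ob (Z ⊗ W)) : a02 f unit_ob = a02 g unit_ob -> f = g.
Proof. by rewrite ?a22E ?a20E ?a02E ?a12E ?a21E -?compA => /eqh_mono /eqh_epi /rwh_inj. Qed.

End Tail.

Section TailAction.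
Context {K : fieldType} {C : tcat K}.
Implicit Types X Y Z W l m : ob C.

Lemma a22_comp X Y X' Y' X'' Y'' (g : hom (X' ⊗ Y') (X'' ⊗ Y'')) (f : hom (X ⊗ Y) (X' ⊗ Y')) l :
  a22 g l ∘ a22 f l = a22 (g ∘ f) l.
Proof. by rewrite ?a22E tens_compl -?compA (comp1K _ (ascK _ _ _)). Qed.
Lemma a22_id X Y l : a22 (idm (X ⊗ Y)) l = idm _.
Proof. by rewrite ?a22E tensm1 comp1f asc'K. Qed.
Lemma a22_tens X X' Y Y' (f : hom X X') (g : hom Y Y') l : a22 (f ⊠ g) l = f ⊠ (g ▷ l).
Proof. by rewrite ?a22E -asc_nat compA asc'K comp1f. Qed.
Lemma a22_12 X X' Y' X'' Y'' (g : hom (X' ⊗ Y') (X'' ⊗ Y'')) (f : hom X (X' ⊗ Y')) l :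
  a22 g l ∘ a12 f l = a12 (g ∘ f) l.
Proof. by rewrite ?a22E ?a12E tens_compl -?compA (comp1K _ (ascK _ _ _)). Qed.
Lemma a21_22 X Y X' Y' Z (g : hom (X' ⊗ Y') Z) (f : hom (X ⊗ Y) (X' ⊗ Y')) l :
  a21 g l ∘ a22 f l = a21 (g ∘ f) l.
Proof. by rewrite ?a22E ?a21E tens_compl -?compA (comp1K _ (ascK _ _ _)). Qed.
Lemma a21_12 X X' Y' Z (g : hom (X' ⊗ Y') Z) (f : hom X (X' ⊗ Y')) l :
  a21 g l ∘ a12 f l = (g ∘ f) ▷ l.
Proof. by rewrite ?a12E ?a21E tens_compl -?compA (comp1K _ (ascK _ _ _)). Qed.
Lemma a12_21 X Y Z X' Y' (g : hom Z (X' ⊗ Y')) (f : hom (X ⊗ Y) Z) l :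
  a12 g l ∘ a21 f l = a22 (g ∘ f) l.
Proof. by rewrite ?a12E ?a21E ?a22E tens_compl -?compA. Qed.
Lemma a12_11 X Y Z X' (g : hom X (Y ⊗ Z)) (f : hom X' X) l :
  a12 g l ∘ f ▷ l = a12 (g ∘ f) l.
Proof. by rewrite ?a12E tens_compl -?compA. Qed.
Lemma a21_11 X Y Z Z' (g : hom Z Z') (f : hom (X ⊗ Y) Z) l :
  g ▷ l ∘ a21 f l = a21 (g ∘ f) l.
Proof. by rewrite ?a21E tens_compl -?compA. Qed.
Lemma a22_02 X Y Z W (g : hom (X ⊗ Y) (Z ⊗ W)) (f : hom unit_ob (X ⊗ Y)) l :
  a22 g l ∘ a02 f l = a02 (g ∘ f) l.
Proof. by rewrite ?a22E !a02E !a12E tens_compl -?compA (comp1K _ (ascK _ _ _)). Qed.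
Lemma a20_22 X Y Z W (g : hom (Z ⊗ W) unit_ob) (f : hom (X ⊗ Y) (Z ⊗ W)) l :
  a20 g l ∘ a22 f l = a20 (g ∘ f) l.
Proof. by rewrite ?a22E !a20E !a21E tens_compl -?compA (comp1K _ (ascK _ _ _)). Qed.
Lemma a20_02 X Y (g : hom (X ⊗ Y) unit_ob) (f : hom unit_ob (X ⊗ Y)) l :
  a20 g l ∘ a02 f l = lu l ∘ ((g ∘ f) ▷ l ∘ lu' l).
Proof. by rewrite !a20E !a21E !a02E !a12E tens_compl -?compA (comp1K _ (ascK _ _ _)). Qed.

Lemma a12_linear X Y Z l : linear (fun f : hom X (Y ⊗ Z) => a12 f l).
Proof. by move=> a f g; rewrite ?a12E tens_lin_l comp_lin_r. Qed.
Lemma a21_linear X Y Z l : linear (fun f : hom (Y ⊗ Z) X => a21 f l).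
Proof. by move=> a f g; rewrite ?a21E tens_lin_l comp_lin_l. Qed.
Lemma a22_linear X Y Z W l : linear (fun f : hom (X ⊗ Y) (Z ⊗ W) => a22 f l).
Proof. by move=> a f g; rewrite ?a22E tens_lin_l comp_lin_l comp_lin_r. Qed.

Lemma heq_rwh X Y l m (f : hom X Y) : heq ((f ▷ l) ▷ m) (f ▷ (l ⊗ m)).
Proof. by apply: heq_trans (heq_tensA' _ _ _) _; rewrite tensm1; exact: heq_refl. Qed.

(** Once the casts are collected, both sides consist of the same whiskered [coev] and [ev]. Zigzags
    and left transposes are instances. *)
Lemma bend_right_tail X Y Z (ev : hom (Z ⊗ Y) unit_ob) (coev : hom unit_ob (Y ⊗ X)) l :
  (lu X ∘ (ev ⊠ idm X) ∘ asc Z Y X ∘ (idm Z ⊠ coev) ∘ ru' Z) ▷ l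
    = a20 ev (X ⊗ l) ∘ Z ◁ (a02 coev l).
Proof.
rewrite !tens_compl -?compA !a20E !a21E !a02E !a12E !tens_compr -?compA.
rewrite /lu /asc /ru' /asc' /lu' !eqh_tensl !eqh_tensr !eqh_compA.
apply/heq_eq/heq_cl/heq_mid; last exact: heq_rwh.
by apply: heq_cr; exact: heq_tensA'.
Qed.

Lemma bend_left_tail X Y Z (ev : hom (Y ⊗ Z) unit_ob) (coev : hom unit_ob (X ⊗ Y)) l :
  (ru X ∘ (idm X ⊠ ev) ∘ asc' X Y Z ∘ (coev ⊠ idm Z) ∘ lu' Z) ▷ l
    = X ◁ (a20 ev l) ∘ a02 coev (Z ⊗ l).
Proof.
rewrite !tens_compl -?compA !a20E !a21E !a02E !a12E !tens_compr -?compA.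
rewrite /ru /asc /lu' /asc' /lu !eqh_tensl !eqh_tensr !eqh_compA.
apply/heq_eq/heq_cl/heq_mid; last exact: heq_tensA'.
by apply: heq_cr; exact: heq_rwh.
Qed.

Lemma zigzag_tail X Y (ev : hom (X ⊗ Y) unit_ob) (coev : hom unit_ob (Y ⊗ X)) l :
  zigzag ev coev ▷ l = a20 ev (X ⊗ l) ∘ X ◁ (a02 coev l).
Proof. exact: bend_right_tail. Qed.

Lemma zagzig_tail X Y (ev : hom (Y ⊗ X) unit_ob) (coev : hom unit_ob (X ⊗ Y)) l :
  zagzig ev coev ▷ l = X ◁ (a20 ev l) ∘ a02 coev (X ⊗ l).
Proof. exact: bend_left_tail. Qed.

End TailAction.

(** * Half braidings in terms of actions *)

Section LaxHalfBraiding.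
Context {K : fieldType} {C : tcat K}.
Implicit Types X Y Z W l m : ob C.

(* The axioms of a half braiding in terms of actions, except for invertibility, which
   follows from duality (lax_iso). *)
Definition lax_hb X (e : forall Y, hom (X ⊗ Y) (Y ⊗ X)) :=
  [/\ forall Y Z (f : hom Y Z) l, f ▷ (X ⊗ l) ∘ a22 (e Y) l = a22 (e Z) l ∘ X ◁ (f ▷ l),
      forall Y Z l, a22 (e (Y ⊗ Z)) l ∘ X ◁ asc Y Z l
        = asc Y Z (X ⊗ l) ∘ (Y ◁ a22 (e Z) l ∘ a22 (e Y) (Z ⊗ l))
    & forall l, a22 (e unit_ob) l ∘ X ◁ lu' l = lu' (X ⊗ l)].

Lemma hex_tail X (e : forall Y, hom (X ⊗ Y) (Y ⊗ X)) Y Z l :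
  a22 (asc Y Z X ∘ (idm Y ⊠ e Z) ∘ asc' Y X Z ∘ (e Y ⊠ idm Z) ∘ asc X Y Z) l ∘ X ◁ asc Y Z l
    = asc Y Z (X ⊗ l) ∘ (Y ◁ a22 (e Z) l ∘ a22 (e Y) (Z ⊗ l)).
Proof.
rewrite ?a22E !tens_compl -?compA !tens_compr -?compA.
rewrite /asc /asc' !eqh_tensl !eqh_tensr !eqh_comp !eqh_compA.
apply/heq_eq/heq_cl/heq_mid; last exact: heq_tensA'.
by apply: heq_cr; exact: heq_rwh.
Qed.

Lemma one_tail X l : a22 (lu' X ∘ ru X) l ∘ X ◁ lu' l = lu' (X ⊗ l).
Proof.
rewrite ?a22E !tens_compl /lu' /ru /asc /asc' !eqh_tensl !eqh_tensr !eqh_comp.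
exact: eqh_irr.
Qed.

Lemma hb_lax X (e : half_braiding X) : lax_hb e.
Proof.
split=> [Y Z f l|Y Z l|l]; last by rewrite hb_one one_tail.
  by rewrite -[idm (X ⊗ l)]tensm1 -!a22_tens !a22_comp hb_nat.
by rewrite hb_tens hex_tail.
Qed.

Section LaxToHalfBraiding.
Variables (X : ob C) (e : forall Y, hom (X ⊗ Y) (Y ⊗ X)).
Hypotheses (he : lax_hb e) (ie : forall Y, is_iso (e Y)).

Lemma lax_hb_nat Y Z (f : hom Y Z) : (f ⊠ idm X) ∘ e Y = e Z ∘ (idm X ⊠ f).
Proof.
by case: he => h _ _; apply: a22_inj; rewrite -!a22_comp !a22_tens tensm1 h.
Qed.
Lemma lax_hb_tens Y Z :
  e (Y ⊗ Z) = asc Y Z X ∘ (idm Y ⊠ e Z) ∘ asc' Y X Z ∘ (e Y ⊠ idm Z) ∘ asc X Y Z.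
Proof.
case: he => _ h _; apply: a22_inj; have := h Y Z unit_ob; rewrite -hex_tail.
by rewrite /asc eqh_tensr => /eqh_epi.
Qed.
Lemma lax_hb_one : e unit_ob = lu' X ∘ ru X.
Proof.
case: he => _ _ h; apply: a22_inj; have := h unit_ob; rewrite -one_tail.
by rewrite /lu' eqh_tensr => /eqh_epi.
Qed.
Definition mk_hb : half_braiding X := HalfBraiding ie lax_hb_nat lax_hb_tens lax_hb_one.
End LaxToHalfBraiding.

Section LaxTheory.
Variables (X : ob C) (e : forall Y, hom (X ⊗ Y) (Y ⊗ X)).
Hypothesis he : lax_hb e.

Local Notation b Y l := (a22 (e Y) l).

Lemma lax_nat Y Z (f : hom Y Z) l : f ▷ (X ⊗ l) ∘ b Y l = b Z l ∘ X ◁ (f ▷ l).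
Proof. by case: he. Qed.
Lemma lax_hex Y Z l : b (Y ⊗ Z) l ∘ X ◁ asc Y Z l = asc Y Z (X ⊗ l) ∘ (Y ◁ b Z l ∘ b Y (Z ⊗ l)).
Proof. by case: he. Qed.
Lemma lax_one l : b unit_ob l ∘ X ◁ lu' l = lu' (X ⊗ l).
Proof. by case: he. Qed.

(** Naturality at [f], with the half braiding at [Y ⊗ Z] split by the hexagon: the strand X slides
    past a trivalent vertex. *)
Lemma lax_nat12 W Y Z (f : hom W (Y ⊗ Z)) l :
  Y ◁ b Z l ∘ (b Y (Z ⊗ l) ∘ X ◁ a12 f l) = a12 f (X ⊗ l) ∘ b W l.
Proof.
have hex : Y ◁ b Z l ∘ b Y (Z ⊗ l) = asc' Y Z (X ⊗ l) ∘ (b (Y ⊗ Z) l ∘ X ◁ asc Y Z l).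
  by rewrite lax_hex (comp1K _ (asc'K _ _ _)).
rewrite compA hex !a12E -[RHS]compA lax_nat -!compA -tens_compr.
by rewrite (comp1K _ (ascK _ _ _)).
Qed.

Lemma lax_nat21 W Y Z (f : hom (Y ⊗ Z) W) l :
  b W l ∘ X ◁ a21 f l = a21 f (X ⊗ l) ∘ (Y ◁ b Z l ∘ b Y (Z ⊗ l)).
Proof.
by rewrite !a21E tens_compr compA -lax_nat -?compA -lax_hex.
Qed.

(** The half braiding at the unit is trivial, so X passes freely through a cup; [lax_nat20] is the
    same for a cap. *)
Lemma lax_nat02 Y Z (f : hom unit_ob (Y ⊗ Z)) l :
  Y ◁ b Z l ∘ (b Y (Z ⊗ l) ∘ X ◁ a02 f l) = a02 f (X ⊗ l).
Proof.
rewrite !a02E tens_compr (compA (b Y _)) (compA (Y ◁ b Z l)) lax_nat12.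
by rewrite -compA lax_one.
Qed.

Lemma lax_nat20 Y Z (f : hom (Y ⊗ Z) unit_ob) l :
  X ◁ a20 f l = a20 f (X ⊗ l) ∘ (Y ◁ b Z l ∘ b Y (Z ⊗ l)).
Proof.
rewrite !a20E -compA -lax_nat21.
have -> : lu (X ⊗ l) ∘ (b unit_ob l ∘ X ◁ a21 f l) = X ◁ lu l ∘ X ◁ a21 f l.
  rewrite compA; congr (_ ∘ _); rewrite -[LHS]compf1 -tensm1 -(lu'K l) tens_compr.
  by rewrite -compA (reassoc _ (lax_one l)) compA luK comp1f.
by rewrite tens_compr.
Qed.

End LaxTheory.
End LaxHalfBraiding.
Ltac tailmod_tac :=
  repeat first
    [ exact: tailmod_a22 | exact: tailmod_a12 | exact: tailmod_a21 | exact: tailmod_a02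
    | exact: tailmod_a20 | exact: tailmod_rwh
    | match goal with
      | |- tailmod (fun l => @compm _ _ _ _ _ (@?v l) (@?u l)) =>
          refine (tailmod_comp (u := u) (v := v) _ _)
      | |- tailmod (fun l => tensm (idm _) (@?u l)) => refine (tailmod_whisk _ (u := u) _)
      | |- tailmod (fun l => a22 ?f (@?t l)) =>
          refine (tailmod_at (t := t) (tailmod_a22 f) _); by (move=> ? ?; rewrite /= ?tensA)
      | |- tailmod (fun l => a12 ?f (@?t l)) =>
          refine (tailmod_at (t := t) (tailmod_a12 f) _); by (move=> ? ?; rewrite /= ?tensA)
      | |- tailmod (fun l => a21 ?f (@?t l)) =>
          refine (tailmod_at (t := t) (tailmod_a21 f) _); by (move=> ? ?; rewrite /= ?tensA)
      | |- tailmod (fun l => a20 ?f (@?t l)) =>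
          refine (tailmod_at (t := t) (tailmod_a20 f) _); by (move=> ? ?; rewrite /= ?tensA)
      | |- tailmod (fun l => a02 ?f (@?t l)) =>
          refine (tailmod_at (t := t) (tailmod_a02 f) _); by (move=> ? ?; rewrite /= ?tensA)
      | |- tailmod (fun l => ?f ▷ (@?t l)) =>
          refine (tailmod_at (t := t) (tailmod_rwh f) _); by (move=> ? ?; rewrite /= ?tensA)
      end ].

(** * Duals and dual half braidings *)

Section Duals.
Context {K : fieldType} {C : tcat K}.
Implicit Types X Y Z W l m : ob C.

Definition dual_pair X Y (ev : hom (Y ⊗ X) unit_ob) (coev : hom unit_ob (X ⊗ Y)) :=
  zagzig ev coev = idm X /\ zigzag ev coev = idm Y.

Section Pair.
Variables (X Y : ob C) (ev : hom (Y ⊗ X) unit_ob) (coev : hom unit_ob (X ⊗ Y)).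
Hypothesis dp : dual_pair ev coev.
Lemma dual_pairX l : X ◁ (a20 ev l) ∘ a02 coev (X ⊗ l) = idm _.
Proof. by case: dp => h _; rewrite -zagzig_tail h tensm1. Qed.
Lemma dual_pairY l : a20 ev (Y ⊗ l) ∘ Y ◁ (a02 coev l) = idm _.
Proof. by case: dp => _ h; rewrite -zigzag_tail h tensm1. Qed.
End Pair.

(** The inverse at [Y] is the half braiding at the dual [Y'], rotated by [coev] and [ev]: sliding X
    through the cup or the cap removes both braidings. *)
Lemma lax_iso X (e : forall Y, hom (X ⊗ Y) (Y ⊗ X)) (he : lax_hb e) Y Y'
    (ev : hom (Y ⊗ Y') unit_ob) (coev : hom unit_ob (Y' ⊗ Y)) :
  dual_pair ev coev -> is_iso (e Y).
Proof.
move=> dp.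
pose u l := a20 ev (X ⊗ (Y ⊗ l)) ∘ (Y ◁ a22 (e Y') (Y ⊗ l) ∘ Y ◁ X ◁ a02 coev l).
have uE l : a22 (m22 u) l = u l by apply: m22E; rewrite /u; tailmod_tac.
exists (m22 u); apply: a22_inj; rewrite -a22_comp a22_id uE /u -?compA.
  rewrite -a22_tail (compA (Y ◁ a22 _ _)) (compA (a20 _ _)) -(lax_nat20 he) -tens_compr.
  by rewrite (dual_pairY dp) tensm1.
rewrite (reassoc _ (esym (a20_tail ev (a22 (e Y) unit_ob)))) -compA -!tens_compr.
by rewrite (lax_nat02 he) (dual_pairY dp).
Qed.

Section DualHB.
Variables (X Y : ob C) (ev : hom (Y ⊗ X) unit_ob) (coev : hom unit_ob (X ⊗ Y)).
Hypothesis dp : dual_pair ev coev.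
Variables (e : forall Z, hom (X ⊗ Z) (Z ⊗ X)) (i : forall Z, hom (Z ⊗ X) (X ⊗ Z)).
Hypotheses (he : lax_hb e) (ie : forall Z, i Z ∘ e Z = idm _) (ei : forall Z, e Z ∘ i Z = idm _).

Lemma lax_invL Z l : a22 (i Z) l ∘ a22 (e Z) l = idm _.
Proof. by rewrite a22_comp ie a22_id. Qed.
Lemma lax_invR Z l : a22 (e Z) l ∘ a22 (i Z) l = idm _.
Proof. by rewrite a22_comp ei a22_id. Qed.

(** The inverse half braiding of X, rotated onto the dual Y. This choice makes [ev] and [coev]
    morphisms of the center. *)
Definition dual_tail Z l :=
  a20 ev (Z ⊗ (Y ⊗ l)) ∘ (Y ◁ a22 (i Z) (Y ⊗ l) ∘ Y ◁ Z ◁ a02 coev l).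
Definition dual_hb Z : hom (Y ⊗ Z) (Z ⊗ Y) := m22 (dual_tail Z).

Lemma dual_hbE Z l : a22 (dual_hb Z) l = dual_tail Z l.
Proof. by apply: m22E; rewrite /dual_tail; tailmod_tac. Qed.

Lemma inv_nat W Z (f : hom W Z) l : X ◁ (f ▷ l) ∘ a22 (i W) l = a22 (i Z) l ∘ f ▷ (X ⊗ l).
Proof.
rewrite -[LHS]comp1f -(lax_invL Z l) -compA (reassoc _ (esym (lax_nat he f l))) -?compA.
by rewrite lax_invR compf1.
Qed.

Lemma inv_hex Z W l : X ◁ asc Z W l ∘ (a22 (i Z) (W ⊗ l) ∘ Z ◁ a22 (i W) l)
  = a22 (i (Z ⊗ W)) l ∘ asc Z W (X ⊗ l).
Proof.
rewrite -[LHS]comp1f -(lax_invL (Z ⊗ W) l) -?compA (reassoc _ (lax_hex he Z W l)) -?compA.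
by rewrite (comp1K _ (lax_invR _ _)) -tens_compr lax_invR tensm1 compf1.
Qed.

Lemma dual_ev_morphism Z l :
  Z ◁ a20 ev l ∘ a22 (dual_hb Z) (X ⊗ l) = a20 ev (Z ⊗ l) ∘ Y ◁ a22 (i Z) l.
Proof.
rewrite dual_hbE /dual_tail (reassoc _ (esym (a20_tail ev (Z ◁ a20 ev l)))) -?compA.
rewrite -!tens_compr (reassoc _ (esym (a22_tail (i Z) (a20 ev l)))) -compA -tens_compr.
by rewrite (dual_pairX dp) tensm1 compf1.
Qed.

Lemma dual_coev_morphism Z l :
  X ◁ a22 (dual_hb Z) l ∘ a02 coev (Z ⊗ l) = a22 (i Z) (Y ⊗ l) ∘ Z ◁ a02 coev l.
Proof.
rewrite dual_hbE /dual_tail -tens_compr tens_compr -?compA.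
by rewrite -a02_tail (comp1K _ (dual_pairX dp _)).
Qed.

Lemma dual_lax : lax_hb dual_hb.
Proof.
split=> [Z W f l|Z W l|l].
- rewrite !dual_hbE /dual_tail (reassoc _ (esym (a20_tail ev (f ▷ (Y ⊗ l))))) -?compA.
  rewrite -!tens_compr (reassoc _ (inv_nat f (Y ⊗ l))) -?compA; congr (_ ∘ _ ◁ (_ ∘ _)).
  exact: exch.
- rewrite dual_hbE /dual_tail -?compA -!tens_compr -asc_tail.
  rewrite (reassoc _ (esym (inv_hex Z W (Y ⊗ l)))) -?compA.
  rewrite tens_compr (reassoc _ (a20_tail ev (asc Z W (Y ⊗ l)))) -compA; congr (_ ∘ _).
  rewrite -!tens_compr dual_hbE /dual_tail.
  rewrite [in RHS]tens_compr -compA -!tens_compr -a22_tail (reassoc _ (dual_ev_morphism _ _)).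
  by rewrite -compA -!tens_compr.
rewrite dual_hbE /dual_tail.
have inv_one m : a22 (i unit_ob) m ∘ lu' (X ⊗ m) = X ◁ lu' m.
  by rewrite -(lax_one he) compA lax_invL comp1f.
rewrite -?compA -!tens_compr -lu'_nat (reassoc _ (inv_one (Y ⊗ l))) tens_compr.
by rewrite (reassoc _ (a20_tail ev (lu' (Y ⊗ l)))) -compA (dual_pairY dp) compf1.
Qed.

End DualHB.
End Duals.

(** * Functional calculus in a tensor *-category *)

Section LinearDependence.
Context {K : fieldType} {V : lmodType K}.

Lemma linear_dependence n (b : 'I_n -> V) m (x : 'I_m -> V) :
  (forall v, exists c : 'I_n -> K, v = \sum_i c i *: b i) -> (n < m)%N ->
  exists c : 'I_m -> K, (exists i, c i != 0) /\ \sum_i c i *: x i = 0.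
Proof.
move=> span ltnm; have /choice[A AE] : forall i, exists c : 'I_n -> K, x i = \sum_j c j *: b j.
  by move=> i; exact: span.
pose M : 'M[K]_(m, n) := \matrix_(i, j) A i j.
have kn0 : kermx M != 0.
  by rewrite kermx_eq0 /row_free neq_ltn (leq_ltn_trans (rank_leq_col M) ltnm).
have /rowV0Pn[u uM un0] := kn0.
exists (fun i => u 0 i); split.
  by have /rV0Pn[i ui] := un0; exists i.
have uM0 : u *m M = 0 by exact/sub_kermxP.
transitivity (\sum_j (u *m M) 0 j *: b j); last first.
  by rewrite uM0; apply: big1 => j _; rewrite mxE scale0r.
under eq_bigr => i _ do rewrite AE scaler_sumr.
rewrite exchange_big; apply: eq_bigr => j _ /=.
by rewrite mxE scaler_suml; apply: eq_bigr => i _; rewrite mxE scalerA.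
Qed.

End LinearDependence.

Section StarLinear.
Context {K : numClosedFieldType} {C : star_tcat K}.
Implicit Types X Y Z : ob C.

Lemma starD X Y (f g : hom X Y) : star (f + g) = star f + star g.
Proof. by rewrite -[f]scale1r star_antilinear conjC1 !scale1r. Qed.
Lemma star0 X Y : star (0 : hom X Y) = 0.
Proof. by apply: (@addrI _ (star (0 : hom X Y))); rewrite -starD !addr0. Qed.
Lemma starZ X Y a (f : hom X Y) : star (a *: f) = a^* *: star f.
Proof. by rewrite -[a *: f]addr0 star_antilinear star0 addr0. Qed.
Lemma starN X Y (f : hom X Y) : star (- f) = - star f.
Proof. by rewrite -scaleN1r starZ rmorphN rmorph1 scaleN1r. Qed.
Lemma starB X Y (f g : hom X Y) : star (f - g) = star f - star g.
Proof. by rewrite starD starN. Qed.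
Lemma star_sum X Y n (f : 'I_n -> hom X Y) : star (\sum_i f i) = \sum_i star (f i).
Proof. by elim/big_rec2: _ => [|i x y _ <-]; rewrite ?star0 // starD. Qed.

Lemma star_eq0 X Y (f : hom X Y) : star f = 0 -> f = 0.
Proof. by move=> e; rewrite -[f]starK e star0. Qed.

Lemma scale_eq0 (V : lmodType K) (a : K) (v : V) : a *: v = 0 -> v <> 0 -> a = 0.
Proof. by move=> /eqP; rewrite scaler_eq0 => /orP[/eqP//|/eqP]. Qed.

Hypothesis ho : has_orthogonal_sums C.

(** Positivity concerns a single [star f ∘ f]. Collecting the [f i] into one column with values in
    an orthogonal sum makes their sum of squares a square, and the [w i] read the entries back. *)
Lemma sum_of_squares n (Y : 'I_n -> ob C) X (f : forall i, hom X (Y i)) :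
  exists P (g : hom X P) (w : forall i, hom P (Y i)),
    star g ∘ g = \sum_i star (f i) ∘ f i /\ forall i, w i ∘ g = f i.
Proof.
have [P [v [v1 v0 vs]]] := ho Y.
have wg i : star (v i) ∘ (\sum_i v i ∘ f i) = f i.
  rewrite comp_sumr (bigD1 i) //= compA v1 comp1f big1 ?addr0 // => j ji.
  by rewrite compA v0 ?comp0l // eq_sym.
exists P, (\sum_i v i ∘ f i), (fun i => star (v i)); split=> //.
rewrite star_sum comp_suml; apply: eq_bigr => i _.
by rewrite star_comp -compA wg.
Qed.

Lemma sum_of_squares_eq0 n (Y : 'I_n -> ob C) X (f : forall i, hom X (Y i)) :
  \sum_i star (f i) ∘ f i = 0 -> forall i, f i = 0.
Proof.
have [P [g [w [<- wg]]]] := sum_of_squares f.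
by move=> /star_positive g0 i; rewrite -wg g0 comp0r.
Qed.

Lemma two_squares_eq0 X Y Z (f : hom X Y) (g : hom X Z) :
  star f ∘ f + star g ∘ g = 0 -> f = 0 /\ g = 0.
Proof.
pose T (b : bool) := if b then Y else Z.
pose F b : hom X (T b) := if b return hom X (T b) then f else g.
have := @sum_of_squares_eq0 2 (fun i => T (i == 0)) X (fun i => F (i == 0)).
rewrite !big_ord_recl big_ord0 addr0 /= => h /h {}h.
by split; [exact: (h ord0)|exact: (h ord_max)].
Qed.

(** Taking adjoints shows that [a] is real. Were it negative, the squares of [sqrtC (- a) *: c] and
    of [g] would add up to zero. *)
Lemma quotient_ge0 X Y Z a (c : hom X Y) (g : hom X Z) :
  a *: (star c ∘ c) = star g ∘ g -> c <> 0 -> 0 <= a.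
Proof.
move=> e c0; have cc : star c ∘ c <> 0 by move/star_positive.
have ar : a \is Num.real.
  rewrite CrealE; apply/eqP; apply/eqP; rewrite -subr_eq0; apply/eqP.
  apply: scale_eq0 cc; rewrite scalerBl e.
  by have /(congr1 star) := e; rewrite starZ !star_comp !starK => ->; rewrite subrr.
case/real_ge0P: ar => // a0.
have s0 : 0 <= sqrtC (- a) by rewrite sqrtC_ge0 oppr_ge0 ltW.
have [s _] : sqrtC (- a) *: c = 0 /\ g = 0.
  apply: two_squares_eq0; rewrite starZ compZl compZr scalerA geC0_conj //.
  by rewrite -expr2 sqrtCK -e scaleNr addNr.
have /eqP : sqrtC (- a) = 0 by exact: scale_eq0 s c0.
by rewrite sqrtC_eq0 oppr_eq0 => /eqP a00; rewrite a00 ltxx in a0.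
Qed.

Lemma quotient_gt0 X Y Z a (c : hom X Y) (g : hom X Z) :
  a *: (star c ∘ c) = star g ∘ g -> c <> 0 -> g <> 0 -> 0 < a.
Proof.
move=> e c0 g0; rewrite lt_neqAle eq_sym (quotient_ge0 e c0) andbT; apply/eqP => a0.
by apply: g0; apply: star_positive; rewrite -e a0 scale0r.
Qed.

End StarLinear.

Section PolynomialCalculus.
Context {K : fieldType} {C : lincat K} {X : ob C} (a : hom X X).
Implicit Types p q : {poly K}.

Definition pow_hom i : hom X X := iter i (fun f => a ∘ f) (idm X).
Definition peval p : hom X X := \sum_(i < size p) p`_i *: pow_hom i.

Lemma peval_wide n p : (size p <= n)%N -> peval p = \sum_(i < n) p`_i *: pow_hom i.
Proof.
move=> le; rewrite /peval (big_ord_widen n (fun i => p`_i *: pow_hom i) le) [RHS](bigID (fun i : 'I_n => (i < size p)%N)) /=.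
rewrite [X in _ = _ + X]big1 ?addr0 // => i; rewrite -leqNgt => le'.
by rewrite nth_default // scale0r.
Qed.

Lemma peval_linear : linear peval.
Proof.
move=> c p q; pose n := maxn (size (c *: p + q)) (maxn (size p) (size q)).
rewrite !(@peval_wide n) /n ?leq_max ?leqnn ?orbT // scaler_sumr -big_split.
by apply: eq_bigr => i _; rewrite /= coefD coefZ scalerDl scalerA.
Qed.

Lemma pevalD p q : peval (p + q) = peval p + peval q.
Proof. exact: linear_DE peval_linear p q. Qed.
Lemma pevalB p q : peval (p - q) = peval p - peval q.
Proof. exact: linear_BE peval_linear p q. Qed.
Lemma pevalZ c p : peval (c *: p) = c *: peval p.
Proof. exact: linear_ZE peval_linear c p. Qed.
Lemma peval0 : peval 0 = 0. Proof. exact: linear_0E peval_linear. Qed.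
Lemma pevalC c : peval c%:P = c *: idm X.
Proof. by rewrite (@peval_wide 1) ?size_polyC ?leq_b1 // big_ord1 coefC. Qed.

Lemma pevalXM p : peval ('X * p) = a ∘ peval p.
Proof.
have le : (size ('X * p)%R <= (size p).+1)%N.
  by rewrite (leq_trans (size_polyMleq _ _)) // size_polyX.
rewrite (peval_wide le) big_ord_recl coefXM /= scale0r add0r /peval comp_sumr.
by apply: eq_bigr => i _; rewrite coefXM /= compZr.
Qed.
Lemma pevalX : peval 'X = a.
Proof. by rewrite -['X]mulr1 pevalXM -[1]/(1%:P) pevalC scale1r compf1. Qed.
Lemma pevalM p q : peval (p * q) = peval p ∘ peval q.
Proof.
elim/poly_ind: p => [|p c IH]; first by rewrite mul0r peval0 comp0l.
rewrite mulrDl -['X]mul1r mulrA mulr1 (mulrC p) -mulrA pevalD pevalXM IH mul_polyC pevalZ.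
by rewrite pevalD pevalXM pevalC compDl compZl comp1f compA.
Qed.

End PolynomialCalculus.

Section Spectrum.
Context {K : numClosedFieldType} {C : star_tcat K}.
Implicit Types X Y Z : ob C.
Hypothesis ho : has_orthogonal_sums C.

Lemma annihilating_poly X (a : hom X X) : exists2 p : {poly K}, p != 0 & peval a p = 0.
Proof.
have [n [b span]] := hom_findim X X.
have [c [[i ci] e]] := linear_dependence (fun i : 'I_n.+1 => pow_hom a i) span (leqnn _).
exists (\poly_(i < n.+1) c (inord i)).
  apply/eqP => /(congr1 (fun p : {poly K} => p`_i)).
  by rewrite coef_poly coef0 ltn_ord inord_val => /eqP; exact/negP.
rewrite (@peval_wide _ _ _ a n.+1) ?size_poly // -[RHS]e; apply: eq_bigr => j _.
by rewrite coef_poly ltn_ord inord_val.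
Qed.

(* The minimal polynomial of a selfadjoint morphism has simple real roots. *)
Lemma spectrum X (a : hom X X) : star a = a ->
  exists s : seq K,
    [/\ uniq s, forall z, z \in s -> z^* = z,
        forall z, z \in s -> exists2 c : hom X X, c <> 0 & a ∘ c = z *: c
      & forall q, (forall z, z \in s -> q.[z] = 0) -> peval a q = 0].
Proof.
move=> sa.
pose P n := `[< exists p : {poly K}, [/\ p != 0, size p = n & peval a p = 0] >].
have exP : exists n, P n.
  by have [p p0 e] := annihilating_poly a; exists (size p); apply/asboolP; exists p.
case: (ex_minnP exP) => n /asboolP[p [p0 sp e]] minn.
have [r pE] := closed_field_poly_normal p.
pose pr (r : seq K) : {poly K} := \prod_(z <- r) ('X - z%:P).
have prE t z : z \in t -> pr t = ('X - z%:P) * pr (rem z t).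
  by move=> zt; rewrite /pr (perm_big _ (perm_to_rem zt)) big_cons.
have pr_mon t : pr t != 0 by rewrite monic_neq0 // monic_prod_XsubC.
have er : peval a (pr r) = 0.
  have := e; rewrite pE pevalZ => /scale_eq0 h; apply: contrapT => nz.
  by move/h: nz => /eqP; rewrite lead_coef_eq0 (negPf p0).
have sr : n = (size r).+1.
  by rewrite -sp pE size_scale ?lead_coef_eq0 // size_prod_XsubC.
have lin z : peval a ('X - z%:P) = a - z *: idm X by rewrite pevalB pevalX pevalC.
(* Minimality of the degree: with the root [z] removed, the polynomial no longer annihilates [a],
   and its value is an eigenvector for [z]. *)
have cn0 z : z \in r -> peval a (pr (rem z r)) <> 0.
  move=> zr h; have : P (size r).
    apply/asboolP; exists (pr (rem z r)); split=> //.
    by rewrite size_prod_XsubC size_rem // prednK //; case: (r) zr.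
  by move/minn; rewrite sr ltnn.
have ac z : z \in r -> a ∘ peval a (pr (rem z r)) = z *: peval a (pr (rem z r)).
  move=> zr; apply/eqP; rewrite -subr_eq0 -[z *: _](comp1f (_ *: _)) compZr -compZl -compBl.
  by rewrite -lin -pevalM -prE // er.
have zreal z : z \in r -> z^* = z.
  move=> zr; set c := peval a (pr (rem z r)).
  apply/eqP; rewrite -subr_eq0; apply/eqP/(@scale_eq0 _ _ _ (star c ∘ c)).
    rewrite scalerBl -[in X in _ - X]compZr -ac // -[X in X - _]compZl -starZ -ac //.
    by rewrite star_comp sa compA subrr.
  by move/star_positive; exact: cn0.
(* A repeated root would give an eigenvector [c] of the form [(a - z) d]. As [a - z] is selfadjoint
   and kills [c], this forces [star c ∘ c = 0]. *)
have ur : uniq r.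
  apply: count_mem_uniq => z; case: (boolP (z \in r)) => [zr|/count_memPn //].
  rewrite (permP (perm_to_rem zr)) /= eqxx /=.
  case: (boolP (z \in rem z r)) => [zr'|/count_memPn -> //].
  case: (cn0 z zr); apply: star_positive; rewrite {1}(prE _ _ zr') pevalM star_comp -compA.
  suff -> : star (peval a ('X - z%:P)) ∘ peval a (pr (rem z r)) = 0 by rewrite comp0r.
  by rewrite lin starB starZ star_idm sa zreal // -lin -pevalM -prE.
exists r; split=> // [z zr|q q0].
  by exists (peval a (pr (rem z r))); [exact: cn0|exact: ac].
have /divpK <- : pr r %| q.
  apply: uniq_roots_dvdp; first by apply/allP => z /q0 qz; apply/rootP.
  by rewrite uniq_rootsE.
by rewrite pevalM er comp0r.
Qed.

Lemma interpolation (s : seq K) (f : K -> K) :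
  uniq s -> exists q : {poly K}, forall z, z \in s -> q.[z] = f z.
Proof.
elim: s => [_|x s IH /= /andP[xs us]]; first by exists 0.
have [q qE] := IH us; pose p : {poly K} := \prod_(z <- s) ('X - z%:P).
have px : p.[x] != 0 by rewrite -/(root p x) root_prod_XsubC.
exists (q + ((f x - q.[x]) / p.[x]) *: p) => z; rewrite inE hornerD hornerZ.
case/orP => [/eqP ->|zs]; first by rewrite divfK // addrC subrK.
by have /rootP -> : root p z; [rewrite root_prod_XsubC|rewrite mulr0 addr0 qE].
Qed.

Lemma peval_conj X (a : hom X X) (p : {poly K}) : star a = a ->
  star (peval a p) = peval a (map_poly Num.conj p).
Proof.
move=> sa; rewrite !(@peval_wide _ _ _ a (size p)) ?size_poly // star_sum.
apply: eq_bigr => i _; rewrite starZ coef_map; congr (_ *: _).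
elim: (nat_of_ord i) => [|n IH]; first exact: star_idm.
rewrite /= star_comp IH sa; elim: (n) => [|m IHm] /=; first by rewrite comp1f compf1.
by rewrite -compA IHm.
Qed.

Definition is_sqrt X (a h : hom X X) := [/\ star h = h, h ∘ h = a & is_iso h].

(** Injectivity of [g] leaves only positive eigenvalues of [star g ∘ g]. Polynomials interpolating
    the square root and its inverse on the spectrum then give [h] and its inverse. *)
Lemma square_root X Z (g : hom X Z) :
  (forall Y (c : hom Y X), g ∘ c = 0 -> c = 0) -> exists h, is_sqrt (star g ∘ g) h.
Proof.
move=> ginj; set a := star g ∘ g.
have sa : star a = a by rewrite /a star_comp starK.
have [s [us sreal eig s0]] := spectrum sa.
have spos z : z \in s -> 0 < z.
  move=> /eig[c c0 ac]; apply: (quotient_gt0 ho (c := c) (g := g ∘ c)) => //.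
    by rewrite star_comp -compA (compA (star g)) -/a ac compZr.
  by move/ginj.
have [q qE] := interpolation sqrtC us; have [q' qE'] := interpolation (fun z => (sqrtC z)^-1) us.
have agree p p' : (forall z, z \in s -> p.[z] = p'.[z]) -> peval a p = peval a p'.
  move=> h; apply/eqP; rewrite -subr_eq0 -pevalB; apply/eqP/s0 => z zs.
  by rewrite hornerD hornerN h // subrr.
have sqn0 z : z \in s -> sqrtC z != 0 by move=> /spos z0; rewrite sqrtC_eq0 gt_eqF.
exists (peval a q); split.
- rewrite peval_conj //; apply: agree => z zs.
  rewrite -{1}(sreal z zs) horner_map /= qE // geC0_conj // sqrtC_ge0 ltW // spos //.
- rewrite -pevalM -[RHS](pevalX a); apply: agree => z zs.
  by rewrite hornerM hornerX qE // -expr2 sqrtCK.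
have one p p' : (forall z, z \in s -> p.[z] * p'.[z] = 1) -> peval a p ∘ peval a p' = idm X.
  move=> h; rewrite -pevalM -[RHS]scale1r -(pevalC a); apply: agree => z zs.
  by rewrite hornerM hornerC h.
by exists (peval a q'); apply: one => z zs; rewrite qE // qE' // ?mulfV ?mulVf ?sqn0.
Qed.

Definition isometric X Y (u : hom X Y) := star u ∘ u = idm X.

(** Polar decomposition: [u] is [v] times the inverse square root of [star v ∘ v], hence an isometry
    with the range of [v]. *)
Lemma isometric_range X Y (v : hom Y X) (w : hom X Y) :
  w ∘ v = idm Y -> exists u : hom Y X, isometric u /\ u ∘ star u ∘ v = v /\ exists k, u = v ∘ k.
Proof.
move=> wv; have vinj Z (c : hom Z Y) : v ∘ c = 0 -> c = 0.
  by move=> e; rewrite -[c]comp1f -wv -compA e comp0r.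
have [h [sh hh [k kh hk]]] := square_root vinj.
have sk : star k = k.
  by rewrite -[LHS]compf1 -hk compA -{1}sh -star_comp hk star_idm comp1f.
exists (v ∘ k); split; first last.
  split; last by exists k.
  rewrite star_comp sk -!compA -hh.
  by rewrite (compA k h) kh comp1f kh compf1.
by rewrite /isometric star_comp sk -compA (compA (star v)) -hh -compA hk compf1.
Qed.

(** The inclusion of an arbitrary splitting is replaced by an isometry [u] with the same range; then
    [u ∘ star u] and [p] are selfadjoint projections with one range, so they agree. *)
Lemma projection_split X (p : hom X X) : idempotents_split C -> p ∘ p = p -> star p = p ->
  exists Y (u : hom Y X), isometric u /\ u ∘ star u = p.
Proof.
move=> hs pp sp; have [Y [v [w [wv vw]]]] := hs _ _ pp.
have [u [iu [uv [k uE]]]] := isometric_range wv.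
exists Y, u; split=> //.
have e1 : u ∘ star u ∘ p = p by rewrite -vw compA uv.
have pu : p ∘ u = u by rewrite -vw uE -!compA (compA w) wv comp1f.
by have /(congr1 star) := e1; rewrite !star_comp starK sp compA pu.
Qed.

Lemma peval_eigen X Y (a : hom X X) (c : hom Y X) z (q : {poly K}) :
  a ∘ c = z *: c -> peval a q ∘ c = q.[z] *: c.
Proof.
move=> ac; elim/poly_ind: q => [|q x IH].
  by rewrite (peval0 a) comp0l horner0 scale0r.
rewrite mulrC (pevalD a) (pevalXM a) (pevalC a) compDl -compA IH compZr ac compZl comp1f.
by rewrite scalerA -scalerDl hornerD hornerC mulrC hornerMX.
Qed.

(** Some selfadjoint endomorphism [a] is not scalar, since otherwise the real and imaginary parts of
    every endomorphism would be. The indicator function of one eigenvalue, evaluated at [a], is the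
    projection. *)
Lemma nontrivial_projection X : idm X <> 0 -> ~ is_simple X ->
  exists p : hom X X, [/\ p ∘ p = p, star p = p, p <> 0 & p <> idm X].
Proof.
move=> X0 nX.
have [a [sa na]] : exists a : hom X X, star a = a /\ ~ exists z : K, a = z *: idm X.
  apply: contrapT => h; apply: nX; split=> // f.
  have sc (a : hom X X) : star a = a -> exists z : K, a = z *: idm X.
    by move=> sa; apply: contrapT => na; apply: h; exists a.
  have [z1 e1] := sc (f + star f) ltac:(by rewrite starD starK addrC).
  have [z2 e2] := sc ('i *: (f - star f))
    ltac:(by rewrite starZ starB starK conjCi scaleNr -scalerN opprB).
  have e3 : f - star f = (- 'i * z2) *: idm X.
    by rewrite -scalerA -e2 scalerA mulNr -expr2 sqrCi opprK scale1r.
  (* [f] is half the sum of [f + star f] and [f - star f], whose scalars are [z1] and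
     [- 'i * z2]. *)
  exists ((z1 - 'i * z2) / 2); apply/(scalerI (a := 2)); first by rewrite pnatr_eq0.
  rewrite scalerA [2 * _]mulrC divfK ?pnatr_eq0 // [RHS]scalerDl -e1 -mulNr -e3.
  by rewrite addrCA addrK -mulr2n scaler_nat.
have [s [us sreal eig s0]] := spectrum sa.
case: s us sreal eig s0 => [|z s] us sreal eig s0.
  by case: X0; rewrite -[idm X]scale1r -(pevalC a); exact: s0.
have [q qE] := interpolation (fun x => (x == z)%:R) us.
have agree p p' : (forall x, x \in z :: s -> p.[x] = p'.[x]) -> peval a p = peval a p'.
  move=> h; apply/eqP; rewrite -subr_eq0 -pevalB; apply/eqP/s0 => x xs.
  by rewrite hornerD hornerN h // subrr.
exists (peval a q); split.
- rewrite -pevalM; apply: agree => x xs.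
  by rewrite hornerM qE //; case: eqP => _; rewrite ?mulr1 ?mulr0.
- rewrite peval_conj //; apply: agree => x xs.
  by rewrite -{1}(sreal x xs) horner_map /= qE // conjC_nat.
- have [c c0 ac] := eig z (mem_head _ _) => q0; apply: c0.
  by have := peval_eigen q ac; rewrite q0 comp0l qE ?mem_head // eqxx scale1r.
move=> q1; apply: na; exists z.
suff : a ∘ peval a q = z *: peval a q by rewrite q1 compf1.
rewrite -pevalXM -pevalZ; apply: agree => x xs; rewrite hornerM hornerX hornerZ qE //.
by case: eqP => [->|_] //; rewrite !mulr0.
Qed.

Section Decomposition.
Hypothesis hs : idempotents_split C.

Let orthogonal_family X m (p : 'I_m -> hom X X) :=
  [/\ forall i, p i <> 0, forall i, star (p i) = p i
    & forall i j, p i ∘ p j = if i == j then p i else 0].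

Let add_projection X m (p : 'I_m -> hom X X) (q : hom X X) :
  orthogonal_family p -> q <> 0 -> star q = q -> q ∘ q = q -> (forall i, q ∘ p i = 0) ->
  exists p' : 'I_m.+1 -> hom X X, orthogonal_family p'.
Proof.
move=> [p0 sp pp] q0 sq qq qp.
have pq i : p i ∘ q = 0 by apply: star_eq0; rewrite star_comp sp sq qp.
exists (fun i => if unlift ord0 i is Some j then p j else q); split=> [i|i|i j].
- by case: (unlift _ _).
- by case: (unlift _ _).
by case: (unliftP ord0 i) => [i' ->|->]; case: (unliftP ord0 j) => [j' ->|->].
Qed.

(** Orthogonal nonzero projections are linearly independent, so a largest family of them exists.
    Maximality forces its sum to be the identity and the range of each member to be simple. *)
Lemma decomposition X : exists m (Y : 'I_m -> ob C) (u : forall i, hom (Y i) X),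
  [/\ forall i, is_simple (Y i), forall i, isometric (u i),
      forall i j, i != j -> star (u i) ∘ u j = 0
    & \sum_i u i ∘ star (u i) = idm X].
Proof.
pose Q m := `[< exists p : 'I_m -> hom X X, orthogonal_family p >].
have Q0 : exists m, Q m by exists 0%N; apply/asboolP; exists (fun=> 0); split; case.
have [n [b span]] := hom_findim X X.
have Qn m : Q m -> (m <= n)%N.
  move=> /asboolP[p [p0 sp pp]]; rewrite leqNgt; apply/negP => nm.
  have [c [[i ci] e]] := linear_dependence p span nm.
  have /(congr1 (fun f => f ∘ p i)) := e; rewrite comp0l comp_suml (bigD1 i) //= big1.
    by rewrite addr0 compZl pp eqxx => /scale_eq0 /(_ (p0 i)) /eqP; exact/negP.
  by move=> j ji; rewrite compZl pp (negPf ji) scaler0.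
case: (ex_maxnP Q0 Qn) => m /asboolP[p [p0 sp pp]] mmax.
have nomore p' (q : hom X X) : @orthogonal_family X m p' -> star q = q -> q ∘ q = q ->
    (forall i, q ∘ p' i = 0) -> q = 0.
  move=> op sq qq qp; apply: contrapT => q0.
  have /asboolP/mmax := add_projection op q0 sq qq qp; by rewrite ltnn.
have sum1 : \sum_i p i = idm X.
  apply/esym/eqP; rewrite -subr_eq0; apply/eqP.
  have qp i : (idm X - \sum_i p i) ∘ p i = 0.
    rewrite compBl comp1f comp_suml (bigD1 i) //= pp eqxx big1 ?addr0 ?subrr //.
    by move=> j ji; rewrite pp (negPf ji).
  apply: (nomore p) => //.
    by rewrite starB star_idm star_sum; congr (_ - _); apply: eq_bigr.
  have q0 : (idm X - \sum_i p i) ∘ \sum_i p i = 0.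
    by rewrite comp_sumr big1 // => i _; exact: qp.
  by rewrite [LHS]compBr q0 subr0 compf1.
have /choice[u uP] : forall i, exists u : {Y : ob C & hom Y X},
    isometric (projT2 u) /\ projT2 u ∘ star (projT2 u) = p i.
  move=> i; have pi : p i ∘ p i = p i by rewrite pp eqxx.
  have [Y [u [iu up]]] := projection_split hs pi (sp i).
  by exists (existT (fun Y => hom Y X) Y u).
pose v i := projT2 (u i).
have iv i : isometric (v i) by case: (uP i).
have vp i : v i ∘ star (v i) = p i by case: (uP i).
have svp i : star (v i) = star (v i) ∘ p i by rewrite -vp compA iv comp1f.
have vvp i : p i ∘ v i = v i by rewrite -vp -compA iv compf1.
exists m, (fun i => projT1 (u i)), v; split=> // [i|i j ij|]; last first.
- by rewrite -sum1; apply: eq_bigr => i _.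
- by rewrite svp -[v j]vvp -compA (compA (p i)) pp (negPf ij) comp0l comp0r.
apply: contrapT => nY.
have Y0 : idm (projT1 (u i)) <> 0.
  by move=> e; apply: (p0 i); rewrite -vp -[v i]compf1 e comp0r comp0l.
have [e [ee se e0 e1]] := nontrivial_projection Y0 nY.
have cc f g : (v i ∘ f ∘ star (v i)) ∘ (v i ∘ g ∘ star (v i)) = v i ∘ (f ∘ g) ∘ star (v i).
  by rewrite -!compA (comp1K _ (iv i)).
have vi0 f : v i ∘ f ∘ star (v i) = 0 -> f = 0.
  move=> /(congr1 (fun g => star (v i) ∘ g ∘ v i)).
  by rewrite comp0r comp0l -!compA iv compf1 (comp1K _ (iv i)).
have vpj f j : j != i -> (v i ∘ f ∘ star (v i)) ∘ p j = 0.
  by move=> ji; rewrite svp -!compA pp eq_sym (negPf ji) !comp0r.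
have pjv f j : j != i -> star f = f -> p j ∘ (v i ∘ f ∘ star (v i)) = 0.
  by move=> ji sf; apply: star_eq0; rewrite !star_comp starK sf sp compA vpj.
(* A nontrivial projection [e] on the range of [p i] would cut [p i] in two: [p'] keeps one half in
   place of [p i], and the other half [q] enlarges the family. *)
pose p' j := if j == i then v i ∘ e ∘ star (v i) else p j.
pose q := v i ∘ (idm _ - e) ∘ star (v i).
have s1e : star (idm _ - e) = idm _ - e by rewrite starB star_idm se.
have op : @orthogonal_family X m p'.
  split=> [j|j|j k]; rewrite /p'.
  - by case: eqP => // _ /vi0.
  - by case: eqP => // _; rewrite !star_comp starK se compA.
  case: (j =P i) => [->|/eqP ji]; case: (k =P i) => [->|/eqP ki].
  - by rewrite eqxx cc ee.
  - by rewrite vpj // eq_sym (negPf ki).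
  - by rewrite pjv // (negPf ji).
  by rewrite pp.
have : q = 0.
  apply: (nomore p') => // [||j].
  - by rewrite /q !star_comp starK s1e compA.
  - by rewrite /q cc compBl !compBr ?comp1f ?compf1 ee subrr subr0.
  rewrite /p'; case: eqP => [_|/eqP ji]; last exact: vpj.
  by rewrite /q cc compBl comp1f ee subrr comp0r comp0l.
by move=> /vi0 /eqP; rewrite subr_eq0 eq_sym => /eqP.
Qed.

End Decomposition.

End Spectrum.

(** * Simple objects, coefficients and frames *)

Section SimpleObjects.
Context {K : fieldType} {C : lincat K}.
Implicit Types X Y Z S T : ob C.

(** The value 0 is a default for endomorphisms that are not scalar, which do not occur on a simple
    object. Being total, [coef] can be summed and rewritten without side conditions. *)
Definition coef X (f : hom X X) : K :=
  if pselect (exists a, f = a *: idm X) is left h then sval (cid h) else 0.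

Lemma coef_idm X (f : hom X X) : is_simple X -> f = coef f *: idm X.
Proof.
move=> [_ h]; rewrite /coef; case: pselect => [h'|[]]; last exact: h.
exact: svalP (cid h').
Qed.

Lemma coef_eq X (f : hom X X) a : is_simple X -> f = a *: idm X -> coef f = a.
Proof. by move=> sX e; apply: (scale_idm_inj (proj1 sX)); rewrite -coef_idm. Qed.

Lemma coef_linear X : is_simple X -> linear (@coef X : _ -> K^o).
Proof.
move=> sX a f g; apply: coef_eq => //.
by rewrite {1}(coef_idm f sX) {1}(coef_idm g sX) scalerA -scalerDl.
Qed.

Lemma coef_zero X : is_simple X -> coef (0 : hom X X) = 0.
Proof. by move=> sX; apply: coef_eq; rewrite ?scale0r. Qed.

(** Each side is the scalar by which [f ∘ g ∘ f] is a multiple of [f]; if [f] is zero, both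
    vanish. *)
Lemma coef_comm X Y (f : hom X Y) (g : hom Y X) : is_simple X -> is_simple Y ->
  coef (g ∘ f) = coef (f ∘ g).
Proof.
move=> sX sY; case: (pselect (f = 0)) => [->|f0].
  by rewrite comp0l comp0r !coef_zero.
have e1 : coef (g ∘ f) *: f = f ∘ (g ∘ f) by rewrite {2}(coef_idm (g ∘ f) sX) compZr compf1.
have e2 : coef (f ∘ g) *: f = (f ∘ g) ∘ f by rewrite {2}(coef_idm (f ∘ g) sY) compZl comp1f.
apply/eqP; rewrite -subr_eq0; apply/negPn/negP => ne; apply: f0.
by apply: (scalerI ne); rewrite scaler0 scalerBl e1 e2 compA subrr.
Qed.

Definition disjoint_simples n (T : 'I_n -> ob C) :=
  (forall i, is_simple (T i)) /\ forall i j, i != j -> forall f : hom (T i) (T j), f = 0.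

(** One size [m] serves all [i], since vectors may be zero. Only the resolution of the identity is
    asked, not linear independence. *)
Definition dual_frame n (T : 'I_n -> ob C) X m (x : forall i, 'I_m -> hom (T i) X)
    (y : forall i, 'I_m -> hom X (T i)) := \sum_i \sum_k x i k ∘ y i k = idm X.

Section Expansion.
Variables (n : nat) (T : 'I_n -> ob C) (X : ob C) (m : nat).
Variables (x : forall i, 'I_m -> hom (T i) X) (y : forall i, 'I_m -> hom X (T i)).
Hypotheses (dT : disjoint_simples T) (xy : dual_frame x y).

Lemma expand_from i (f : hom (T i) X) : f = \sum_k coef (y i k ∘ f) *: x i k.
Proof.
case: dT => sT hT; rewrite -[LHS]comp1f -xy comp_suml (bigD1 i) //= [X in _ + X]big1 ?addr0.
  rewrite comp_suml; apply: eq_bigr => k _.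
  by rewrite -compA {1}(coef_idm (y i k ∘ f) (sT i)) compZr compf1.
move=> j ji; rewrite comp_suml big1 // => k _.
by rewrite -compA (hT i j _ (y j k ∘ f)) ?comp0r // eq_sym.
Qed.

Lemma expand_to i (f : hom X (T i)) : f = \sum_k coef (f ∘ x i k) *: y i k.
Proof.
case: dT => sT hT; rewrite -[LHS]compf1 -xy comp_sumr (bigD1 i) //= [X in _ + X]big1 ?addr0.
  rewrite comp_sumr; apply: eq_bigr => k _.
  by rewrite compA {1}(coef_idm (f ∘ x i k) (sT i)) compZl comp1f.
move=> j ji; rewrite comp_sumr big1 // => k _.
by rewrite compA (hT j i _ (f ∘ x j k)) ?comp0l.
Qed.
End Expansion.

End SimpleObjects.

Section StarSimple.
Context {K : numClosedFieldType} {C : star_tcat K}.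
Implicit Types X Y Z S T : ob C.

(** By positivity [star f ∘ f] is a nonzero scalar, so a multiple of [star f] is a left inverse;
    [coef_comm] gives the same scalar on the other side. *)
Lemma schur S T (f : hom S T) : is_simple S -> is_simple T -> f <> 0 -> is_iso f.
Proof.
move=> sS sT f0; have ff : coef (star f ∘ f) != 0.
  apply/eqP => e; apply: f0; apply: star_positive.
  by rewrite (coef_idm (star f ∘ f) sS) e scale0r.
exists ((coef (star f ∘ f))^-1 *: star f).
  by rewrite compZl {2}(coef_idm (star f ∘ f) sS) scalerA mulVf // scale1r.
by rewrite compZr {1}(coef_idm (f ∘ star f) sT) -(coef_comm f (star f)) // scalerA mulVf // scale1r.
Qed.

Hypothesis ho : has_orthogonal_sums C.

Lemma coef_sq_gt0 S Y (f : hom S Y) : is_simple S -> f <> 0 -> 0 < coef (star f ∘ f).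
Proof.
move=> sS; apply: (quotient_gt0 ho (c := idm S) (g := f)) (proj1 sS).
by rewrite star_idm comp1f -coef_idm.
Qed.

Lemma simple_unitary S T : is_simple S -> is_simple T -> isomorphic S T ->
  exists u : hom S T, unitary u.
Proof.
move=> sS sT [f [g gf fg]].
have f0 : f <> 0 by move=> f0; apply: (proj1 sS); rewrite -gf f0 comp0r.
have pos := coef_sq_gt0 sS f0; set a := coef _ in pos.
have s0 : sqrtC a != 0 by rewrite sqrtC_eq0 gt_eqF.
have sr : ((sqrtC a)^-1)^* = (sqrtC a)^-1 by rewrite geC0_conj // invr_ge0 sqrtC_ge0 ltW.
have key : ((sqrtC a)^-1)^* * (sqrtC a)^-1 * a = 1.
  by rewrite sr -[X in _ * X]sqrtCK expr2 mulrA mulfVK // mulVf.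
exists ((sqrtC a)^-1 *: f); split; rewrite starZ compZl compZr scalerA.
  by rewrite {1}(coef_idm (star f ∘ f) sS) -/a scalerA key scale1r.
by rewrite {1}(coef_idm (f ∘ star f) sT) -(coef_comm f (star f)) // -/a scalerA [_^-1 * _]mulrC key scale1r.
Qed.

Lemma reps_disjoint n (S : 'I_n -> ob C) : simple_representatives S -> disjoint_simples S.
Proof.
move=> [sS iS _]; split=> // i j ij f; apply: contrapT => f0.
by move: ij; rewrite (iS i j) ?eqxx //; exists f; exact: schur.
Qed.

Section Representatives.
Hypothesis hs : idempotents_split C.
Variables (n : nat) (S : 'I_n -> ob C).
Hypothesis rS : simple_representatives S.

Lemma decomposition_reps X : exists m (c : 'I_m -> 'I_n) (u : forall k, hom (S (c k)) X),
  [/\ forall k, isometric (u k), forall k l, k != l -> star (u k) ∘ u l = 0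
    & \sum_k u k ∘ star (u k) = idm X].
Proof.
have [m [Y [u [sY iu ou su]]]] := decomposition ho hs X; have [sS _ cS] := rS.
have /choice[c cP] : forall k, exists i, exists t : hom (S i) (Y k), unitary t.
  move=> k; have [i [f [g gf fg]]] := cS _ (sY k); exists i.
  by apply: simple_unitary => //; exists g; exists f.
pose t k := sval (cid (cP k)); have tP k : unitary (t k) := svalP (cid (cP k)).
exists m, c, (fun k => u k ∘ t k); split.
- by move=> k; rewrite /isometric star_comp -compA (comp1K _ (iu k)); case: (tP k).
- by move=> k l kl; rewrite star_comp -compA (compA (star (u k))) ou // comp0l comp0r.
rewrite -su; apply: eq_bigr => k _.
by rewrite star_comp -compA (compA (t k)) (proj2 (tP k)) comp1f.
Qed.

Lemma frame_exists X : exists m (x : forall i, 'I_m -> hom (S i) X),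
  dual_frame x (fun i k => star (x i k)).
Proof.
have [m [c [u [_ _ su]]]] := decomposition_reps X.
(* The summand [k] of the decomposition is filed under its own type [c k]; in every other block its
   vector is 0. *)
exists m, (fun i k => if i =P c k is ReflectT e then u k ∘ eqh (f_equal S e) else 0).
rewrite /dual_frame exchange_big -su; apply: eq_bigr => k _.
rewrite (bigD1 (c k)) //= big1 ?addr0 => [|i ick].
  by case: eqP => // e; rewrite eqh1 compf1.
by case: eqP ick => [e|_ _] //; rewrite comp0l.
Qed.

End Representatives.
End StarSimple.

(** * Mates under duality *)

Section Mates.
Context {K : fieldType} {C : tcat K}.
Implicit Types X Y Z W l m : ob C.

Section Mate.
Variables (X X' : ob C) (ev : hom (X' ⊗ X) unit_ob) (coev : hom unit_ob (X ⊗ X')).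
Variables (Y Y' : ob C) (ev' : hom (Y' ⊗ Y) unit_ob) (coev' : hom unit_ob (Y ⊗ Y')).
Hypotheses (dX : dual_pair ev coev) (dY : dual_pair ev' coev').

Definition mate (f : hom X Y) : hom Y' X' :=
  m11 (fun l => a20 ev' (X' ⊗ l) ∘ (Y' ◁ f ▷ (X' ⊗ l) ∘ Y' ◁ a02 coev l)).
Definition comate (g : hom Y' X') : hom X Y :=
  m11 (fun l => Y ◁ a20 ev l ∘ (Y ◁ g ▷ (X ⊗ l) ∘ a02 coev' (X ⊗ l))).

Lemma mateE f l : mate f ▷ l = a20 ev' (X' ⊗ l) ∘ (Y' ◁ f ▷ (X' ⊗ l) ∘ Y' ◁ a02 coev l).
Proof. by apply: m11E; tailmod_tac. Qed.
Lemma comateE g l :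
  comate g ▷ l = Y ◁ a20 ev l ∘ (Y ◁ g ▷ (X ⊗ l) ∘ a02 coev' (X ⊗ l)).
Proof. by apply: m11E; tailmod_tac. Qed.

Lemma mate_ev f l : a20 ev l ∘ mate f ▷ (X ⊗ l) = a20 ev' l ∘ Y' ◁ f ▷ l.
Proof.
rewrite mateE (reassoc _ (esym (a20_tail ev' (a20 ev l)))) -!compA -!tens_compr.
by rewrite (reassoc _ (esym (exch f (a20 ev l)))) -compA (dual_pairX dX) compf1.
Qed.

Lemma mate_coev f l : Y ◁ mate f ▷ l ∘ a02 coev' l = f ▷ (X' ⊗ l) ∘ a02 coev l.
Proof.
by rewrite mateE -tens_compr tens_compr -compA -a02_tail (comp1K _ (dual_pairX dY _)).
Qed.

Lemma mateK f : comate (mate f) = f.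
Proof.
apply: rwh_inj; rewrite comateE mate_coev (reassoc _ (esym (exch f _))) -compA.
by rewrite (dual_pairX dX) compf1.
Qed.

Lemma comate_coev g l : comate g ▷ (X' ⊗ l) ∘ a02 coev l = Y ◁ g ▷ l ∘ a02 coev' l.
Proof.
rewrite comateE -!compA a02_tail (compA (Y ◁ g ▷ _)) -tens_compr exch tens_compr.
by rewrite -compA (comp1K _ _) // -tens_compr (dual_pairY dX) tensm1.
Qed.

Lemma comateK g : mate (comate g) = g.
Proof.
apply: rwh_inj; rewrite mateE -tens_compr comate_coev tens_compr.
by rewrite (reassoc _ (a20_tail ev' (g ▷ _))) -compA (dual_pairY dY) compf1.
Qed.

Lemma mate_linear : linear mate.
Proof.
move=> a f g; apply: rwh_inj; rewrite tens_lin_l !mateE tens_lin_l tens_lin_r.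
by rewrite comp_lin_l comp_lin_r.
Qed.

Lemma mate_inj f g : mate f = mate g -> f = g.
Proof. by move=> e; rewrite -[f]mateK e mateK. Qed.

End Mate.

Section MateComp.
Variables (X X' : ob C) (ev : hom (X' ⊗ X) unit_ob) (coev : hom unit_ob (X ⊗ X')).
Variables (Y Y' : ob C) (ev' : hom (Y' ⊗ Y) unit_ob) (coev' : hom unit_ob (Y ⊗ Y')).
Variables (Z Z' : ob C) (ev'' : hom (Z' ⊗ Z) unit_ob) (coev'' : hom unit_ob (Z ⊗ Z')).
Hypothesis dY : dual_pair ev' coev'.

Lemma mate_comp (g : hom Y Z) (f : hom X Y) :
  mate coev ev'' (g ∘ f) = mate coev ev' f ∘ mate coev' ev'' g.
Proof.
apply: rwh_inj; rewrite !tens_compl [LHS]mateE -tens_compr tens_compl -compA -(mate_coev _ dY).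
rewrite (reassoc _ (exch g _)) -compA !tens_compr.
rewrite (reassoc _ (a20_tail ev'' (mate coev ev' f ▷ unit_ob))) -compA; congr (_ ∘ _).
by rewrite mateE -tens_compr.
Qed.

End MateComp.

Lemma mate_id X X' (ev : hom (X' ⊗ X) unit_ob) (coev : hom unit_ob (X ⊗ X')) :
  dual_pair ev coev -> mate coev ev (idm X) = idm X'.
Proof.
by move=> dX; apply: rwh_inj; rewrite mateE !tensm1 comp1f (dual_pairY dX).
Qed.

(** Transposition is linear and contravariant, so it carries a resolution of the identity of [W] to
    one of [W']. This provides frames along the conjugates [T' i] without locating these among the
    representatives. *)
Lemma mate_dual_frame n (T T' : 'I_n -> ob C) (evT : forall i, hom (T' i ⊗ T i) unit_ob)
    (coevT : forall i, hom unit_ob (T i ⊗ T' i)) W W' (ev : hom (W' ⊗ W) unit_ob)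
    (coev : hom unit_ob (W ⊗ W')) (m : nat) (x : forall i, 'I_m -> hom (T i) W)
    (y : forall i, 'I_m -> hom W (T i)) :
  (forall i, dual_pair (evT i) (coevT i)) -> dual_pair ev coev -> dual_frame x y ->
  dual_frame (fun i k => mate coev (evT i) (y i k)) (fun i k => mate (coevT i) ev (x i k)).
Proof.
move=> dT dW xy; rewrite /dual_frame -(mate_id dW) -xy.
rewrite (linear_sumE (mate_linear _ _)); apply: eq_bigr => i _.
rewrite (linear_sumE (mate_linear _ _)); apply: eq_bigr => k _.
by rewrite (mate_comp _ _ (dT i)).
Qed.

Lemma mate_disjoint_simples n (T T' : 'I_n -> ob C) (evT : forall i, hom (T' i ⊗ T i) unit_ob)
    (coevT : forall i, hom unit_ob (T i ⊗ T' i)) :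
  (forall i, dual_pair (evT i) (coevT i)) -> disjoint_simples T -> disjoint_simples T'.
Proof.
move=> dT [sT hT]; split=> [i|i j ij f]; last first.
  rewrite -(comateK (dT j) (dT i) f) (hT j i _ (comate _ _ f)) 1?eq_sym //.
  exact: linear_0E (mate_linear _ _).
split=> [e|f].
  apply: (proj1 (sT i)); apply: (mate_inj (dT i) (dT i)).
  by rewrite (mate_id (dT i)) e (linear_0E (mate_linear _ _)).
have [a e] := proj2 (sT i) (comate (evT i) (coevT i) f); exists a.
rewrite -(comateK (dT i) (dT i) f) e (linear_ZE (mate_linear _ _)) (mate_id (dT i)) //.
Qed.

End Mates.

Section StarTail.
Context {K : numClosedFieldType} {C : star_tcat K}.
Implicit Types X Y Z W l m : ob C.

Lemma star_rwh X Y (f : hom X Y) l : star (f ▷ l) = star f ▷ l.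
Proof. by rewrite star_tens star_idm. Qed.
Lemma star_lwh X l m (u : hom l m) : star (X ◁ u) = X ◁ star u.
Proof. by rewrite star_tens star_idm. Qed.
Lemma star_a22 X Y Z W (f : hom (X ⊗ Y) (Z ⊗ W)) l : star (a22 f l) = a22 (star f) l.
Proof. by rewrite !a22E !star_comp star_rwh !star_eqh -!compA /asc /asc'; congr (_ ∘ (_ ∘ _)); exact: eqh_irr. Qed.
Lemma star_a12 X Z W (f : hom X (Z ⊗ W)) l : star (a12 f l) = a21 (star f) l.
Proof. by rewrite a12E a21E !star_comp star_rwh star_eqh /asc; congr (_ ∘ _); exact: eqh_irr. Qed.
Lemma star_a02 Z W (f : hom unit_ob (Z ⊗ W)) l : star (a02 f l) = a20 (star f) l.
Proof. by rewrite a02E a20E star_comp star_a12 star_eqh /lu; congr (_ ∘ _); exact: eqh_irr. Qed.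

Lemma star_zigzag X Y (ev : hom (X ⊗ Y) unit_ob) (coev : hom unit_ob (Y ⊗ X)) :
  star (zigzag ev coev) = zagzig (star coev) (star ev).
Proof.
rewrite /zigzag /zagzig !star_comp !star_tens !star_idm !star_eqh -!compA /ru /asc' /lu'.
by congr (_ ∘ _); exact: eqh_irr.
Qed.
Lemma star_zagzig X Y (ev : hom (Y ⊗ X) unit_ob) (coev : hom unit_ob (X ⊗ Y)) :
  star (zagzig ev coev) = zigzag (star coev) (star ev).
Proof. by rewrite -[ev in LHS]starK -[coev in LHS]starK -star_zigzag starK. Qed.

(** The adjoint of the first conjugate equation is the missing zigzag. *)
Lemma conjugate_dual X (s : conjugate X) : dual_pair (star (cjr s)) (cjrb s).
Proof.
split; last exact: cj_eq2.
by rewrite -[RHS]star_idm -(cj_eq1 s) star_zigzag starK.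
Qed.
Lemma conjugate_dual' X (s : conjugate X) : dual_pair (star (cjrb s)) (cjr s).
Proof.
split; last exact: cj_eq1.
by rewrite -[RHS]star_idm -(cj_eq2 s) star_zigzag starK.
Qed.

Lemma scale_zigzag X Y (ev : hom (X ⊗ Y) unit_ob) (coev : hom unit_ob (Y ⊗ X)) a b :
  zigzag (a *: ev) (b *: coev) = (a * b) *: zigzag ev coev.
Proof.
by rewrite /zigzag tensZl tensZr !(compZl, compZr) scalerA mulrC.
Qed.

Lemma scale_conjugate X (s : conjugate X) (a : K) : a != 0 -> a^* = a ->
  exists s' : conjugate X, [/\ star (cjr s') ∘ cjr s' = a ^+ 2 *: (star (cjr s) ∘ cjr s)
    & star (cjrb s') ∘ cjrb s' = a ^- 2 *: (star (cjrb s) ∘ cjrb s)].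
Proof.
move=> a0 ar; have ar' : (a^-1)^* = a^-1 by rewrite -[in RHS]ar fmorphV.
have e1 : zigzag (star (a^-1 *: cjrb s)) (a *: cjr s) = idm X.
  by rewrite starZ ar' scale_zigzag mulVf // scale1r cj_eq1.
have e2 : zigzag (star (a *: cjr s)) (a^-1 *: cjrb s) = idm (cjob s).
  by rewrite starZ ar scale_zigzag mulfV // scale1r cj_eq2.
exists (Conjugate e1 e2) => /=.
by split; rewrite starZ compZl compZr scalerA ?ar ?ar' -?expr2 ?exprVn.
Qed.

Lemma zigzag_coev0 X Y (ev : hom (X ⊗ Y) unit_ob) : zigzag ev 0 = 0.
Proof. by rewrite /zigzag tens0r comp0r comp0l. Qed.
Lemma zigzag_ev0 X Y (coev : hom unit_ob (Y ⊗ X)) : zigzag (0 : hom (X ⊗ Y) unit_ob) coev = 0.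
Proof. by rewrite /zigzag tens0l comp0r !comp0l. Qed.

Lemma cjr_neq0 X (s : conjugate X) : idm X <> 0 -> cjr s <> 0.
Proof. by move=> X0 r0; apply: X0; rewrite -(cj_eq1 s) r0 zigzag_coev0. Qed.
Lemma cjrb_neq0 X (s : conjugate X) : idm X <> 0 -> cjrb s <> 0.
Proof. by move=> X0 r0; apply: X0; rewrite -(cj_eq1 s) r0 star0 zigzag_ev0. Qed.

Lemma normalised_conjugate X : has_orthogonal_sums C -> is_simple (unit_ob : ob C) ->
  idm X <> 0 -> conjugate X -> exists s : conjugate X, star (cjr s) ∘ cjr s = idm unit_ob.
Proof.
move=> ho s1 X0 s; have d0 := coef_sq_gt0 ho s1 (cjr_neq0 (s := s) X0).
set d := coef _ in d0; have sd0 : sqrtC d != 0 by rewrite sqrtC_eq0 gt_eqF.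
have [||s' [e _]] := scale_conjugate s (a := (sqrtC d)^-1).
- by rewrite invr_eq0.
- by rewrite geC0_conj // invr_ge0 sqrtC_ge0 ltW.
exists s'; rewrite e exprVn sqrtCK (coef_idm (star (cjr s) ∘ cjr s) s1) -/d scalerA mulVf ?scale1r //.
by rewrite gt_eqF.
Qed.

End StarTail.

(** * Averaging over the simple objects *)

Section HalfBraidingInverse.
Context {K : fieldType} {C : tcat K} {X : ob C} (e : half_braiding X).

Definition hbi Y : hom (Y ⊗ X) (X ⊗ Y) := s2val (cid2 (hb_iso e Y)).
Lemma hbiK Y : hbi Y ∘ e Y = idm _. Proof. exact: (s2valP (cid2 (hb_iso e Y))). Qed.
Lemma hbKi Y : e Y ∘ hbi Y = idm _. Proof. exact: (s2valP' (cid2 (hb_iso e Y))). Qed.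
Lemma a22_hbiK Y l : a22 (hbi Y) l ∘ a22 (e Y) l = idm _.
Proof. by rewrite a22_comp hbiK a22_id. Qed.
Lemma a22_hbKi Y l : a22 (e Y) l ∘ a22 (hbi Y) l = idm _.
Proof. by rewrite a22_comp hbKi a22_id. Qed.

Lemma hbi_nat12 W Y Z (f : hom W (Y ⊗ Z)) l :
  Y ◁ a22 (hbi Z) l ∘ a12 f (X ⊗ l)
    = a22 (e Y) (Z ⊗ l) ∘ (X ◁ a12 f l ∘ a22 (hbi W) l).
Proof.
rewrite -[LHS]compf1 -(a22_hbKi W l) -!compA (compA (a12 _ _)) -(lax_nat12 (hb_lax e)) -!compA.
by rewrite (comp1K _ _) // -tens_compr a22_hbiK tensm1.
Qed.
End HalfBraidingInverse.

Section Averaging.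
Context {K : numClosedFieldType} {C : star_tcat K}.
Implicit Types X Y Z W l m : ob C.
Hypotheses (ho : has_orthogonal_sums C) (hs : idempotents_split C) (hc : has_conjugates C).
Variables (n : nat) (S : 'I_n -> ob C).
Hypothesis rS : simple_representatives S.
Variable cS : forall i, conjugate (S i).
Hypothesis nS : forall i, star (cjr (cS i)) ∘ cjr (cS i) = idm unit_ob.

Local Notation Sb i := (cjob (cS i)).
Local Notation cup i l := (a02 (cjr (cS i)) l).
Local Notation cap i l := (a20 (star (cjr (cS i))) l).
Local Notation cupb i l := (a02 (cjrb (cS i)) l).
Local Notation capb i l := (a20 (star (cjrb (cS i))) l).

Lemma cap_cup i l : cap i l ∘ cup i l = idm l.
Proof. by rewrite a20_02 nS tensm1 comp1f luK. Qed.
Lemma zig1 i l : S i ◁ cap i l ∘ cupb i (S i ⊗ l) = idm _.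
Proof. exact: dual_pairX (conjugate_dual _) l. Qed.
Lemma zig2 i l : cap i (Sb i ⊗ l) ∘ Sb i ◁ cupb i l = idm _.
Proof. exact: dual_pairY (conjugate_dual _) l. Qed.
Lemma zig3 i l : Sb i ◁ capb i l ∘ cup i (Sb i ⊗ l) = idm _.
Proof. exact: dual_pairX (conjugate_dual' _) l. Qed.
Lemma zig4 i l : capb i (S i ⊗ l) ∘ S i ◁ cup i l = idm _.
Proof. exact: dual_pairY (conjugate_dual' _) l. Qed.

Lemma simple_reps i : is_simple (S i). Proof. by case: rS. Qed.
Lemma disjoint_reps : disjoint_simples S. Proof. exact: reps_disjoint. Qed.
Lemma disjoint_conj_reps : disjoint_simples (fun i => Sb i).
Proof. exact: (mate_disjoint_simples (fun i => conjugate_dual (cS i)) disjoint_reps). Qed.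

Record frame W := Frame {
  fsz : nat;
  fvec : forall i, 'I_fsz -> hom (S i) W;
  frameP : dual_frame fvec (fun i k => star (fvec i k))
}.
(** The covectors are separate data and not the adjoints of the vectors: these frames arise by
    transposition along arbitrary solutions, which need not commute with the star. *)
Record coframe W := Coframe {
  cfsz : nat;
  cfvec : forall i, 'I_cfsz -> hom (Sb i) W;
  cfcov : forall i, 'I_cfsz -> hom W (Sb i);
  coframeP : dual_frame cfvec cfcov
}.

Lemma frame_inhabited W : exists f : frame W, True.
Proof. by have [m [x xP]] := frame_exists ho hs rS W; exists (Frame xP). Qed.
Lemma coframe_inhabited W : exists f : coframe W, True.
Proof.
case: (hc W) => s; have [f _] := frame_inhabited (cjob s).
by exists (Coframe (mate_dual_frame (fun i => conjugate_dual (cS i)) (conjugate_dual' s) (frameP f))).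
Qed.
Definition fr W : frame W := sval (cid (frame_inhabited W)).
Definition cofr W : coframe W := sval (cid (coframe_inhabited W)).

Section Frobenius.
Variables (Y : ob C) (i k : 'I_n).
Implicit Types (s : hom (S k) (Y ⊗ S i)) (t : hom (Y ⊗ S i) (S k)).
Implicit Types (b : hom (Sb i) (Sb k ⊗ Y)) (d : hom (Sb k ⊗ Y) (Sb i)).

(** Bending the leg [S i] of a vertex [S k -> Y ⊗ S i], or in [bendr] the leg [Sb k] of a vertex
    [Sb i -> Sb k ⊗ Y], gives in both cases a map from [S k ⊗ Sb i] to [Y]. The primed versions
    treat covectors. *)
Definition bendl s l := Y ◁ capb i l ∘ a12 s (Sb i ⊗ l).
Definition bendl' t l := a21 t (Sb i ⊗ l) ∘ Y ◁ cupb i l.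
Definition bendr b l := capb k (Y ⊗ l) ∘ S k ◁ a12 b l.
Definition bendr' d l := S k ◁ a21 d l ∘ cupb k (Y ⊗ l).
Definition unbend b := m12 (fun l => bendr b (S i ⊗ l) ∘ S k ◁ cup i l).
Definition unbend' t := m21 (fun l => cap k (Sb i ⊗ l) ∘ Sb k ◁ bendl' t l).

Lemma unbendE b l : a12 (unbend b) l = bendr b (S i ⊗ l) ∘ S k ◁ cup i l.
Proof. by apply: m12E; rewrite /bendr; tailmod_tac. Qed.
Lemma unbend'E t l : a21 (unbend' t) l = cap k (Sb i ⊗ l) ∘ Sb k ◁ bendl' t l.
Proof. by apply: m21E; rewrite /bendl'; tailmod_tac. Qed.

Lemma bendl_unbend b l : bendl (unbend b) l = bendr b l.
Proof.
rewrite /bendl unbendE /bendr -!compA -tens_compr.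
rewrite (reassoc _ (esym (a20_tail _ (Y ◁ capb i l)))) -compA -tens_compr.
rewrite (compA (Sb k ◁ Y ◁ _)) -a12_tail -compA; congr (_ ∘ _ ◁ _).
by rewrite zig3 compf1.
Qed.

Lemma bendr_unbend' t l : bendr' (unbend' t) l = bendl' t l.
Proof.
by rewrite /bendr' unbend'E tens_compr -compA -a02_tail (comp1K _ (zig1 _ _)).
Qed.

(** Closing the left composite with the cup and cap of [cS k] and the right one with those of [cS i]
    gives one and the same diagram, and [nS] makes each closure equal to its coefficient. Thus
    bending respects the pairing of vectors with covectors. *)
Lemma unbend_coef t b : coef (t ∘ unbend b) = coef (unbend' t ∘ b).
Proof.
have sk := simple_reps k; have si := proj1 disjoint_conj_reps i.
pose L := cap k unit_ob ∘ (Sb k ◁ (t ∘ unbend b) ▷ unit_ob ∘ cup k unit_ob).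
pose L' := cap i unit_ob ∘ ((unbend' t ∘ b) ▷ (S i ⊗ unit_ob) ∘ cup i unit_ob).
have LE : L = coef (t ∘ unbend b) *: idm _.
  rewrite /L {1}(coef_idm (t ∘ unbend b) sk) tensZl tensZr !tensm1 compZl comp1f.
  by rewrite compZr cap_cup.
have L'E : L' = coef (unbend' t ∘ b) *: idm _.
  rewrite /L' {1}(coef_idm (unbend' t ∘ b) si) tensZl !tensm1 compZl comp1f.
  by rewrite compZr cap_cup.
have one : idm (unit_ob : ob C) <> 0.
  move=> e; apply: (proj1 sk); apply: rwh_inj; rewrite tens0l.
  rewrite tensm1 -[LHS](zig4 k unit_ob) -[cup k unit_ob]compf1.
  by rewrite e comp0r tens0r comp0r.
apply: (scale_idm_inj one); rewrite -LE -L'E /L /L'.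
rewrite -a21_12 unbendE /bendr !tens_compr -!compA.
rewrite -(a02_tail (cjr (cS k)) (cup i unit_ob)) (reassoc _ (esym (a02_tail (cjr (cS k)) (a12 b (S i ⊗ unit_ob))))).
rewrite -!compA (comp1K _ (zig3 _ _)).
rewrite -a21_12 unbend'E /bendl' !tens_compr -!compA.
rewrite (reassoc _ (esym (a20_tail (star (cjr (cS k))) (cap i unit_ob)))) -!compA; congr (_ ∘ _).
rewrite [in RHS]compA -[in RHS]tens_compr -(a21_tail t) tens_compr -compA; congr (_ ∘ _).
by rewrite compA -!tens_compr zig1 !tensm1 comp1f.
Qed.

Lemma bendl_linear l : linear (bendl^~ l).
Proof. by move=> a s s'; rewrite /bendl a12_linear comp_lin_r. Qed.
Lemma bendr'_linear l : linear (bendr'^~ l).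
Proof. by move=> a d d'; rewrite /bendr' a21_linear tens_lin_r comp_lin_l. Qed.

(* Bending a strand turns a frame of Y ⊗ S i into a frame of Sb k ⊗ Y. *)
Lemma frobenius (V : lmodType K) l (G : hom (S k ⊗ (Sb i ⊗ l)) (Y ⊗ l) -> hom (Y ⊗ l) (S k ⊗ (Sb i ⊗ l)) -> V) :
  (forall v, linear (G^~ v)) -> (forall u, linear (G u)) ->
  \sum_a G (bendl (fvec (f := fr (Y ⊗ S i)) k a) l) (bendl' (star (fvec (f := fr (Y ⊗ S i)) k a)) l)
  = \sum_b G (bendr (cfvec (c := cofr (Sb k ⊗ Y)) i b) l) (bendr' (cfcov (c := cofr (Sb k ⊗ Y)) i b) l).
Proof.
move=> Gl Gr; set x := fvec (f := _); set y := cfvec (c := _); set y' := cfcov (c := _).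
(* By [unbend_coef] the matrix expanding the bent [y] in the bent [x] also expands the bent
   covectors of [x] in those of [y], so both sides equal one double sum. *)
have ex j : bendr (y i j) l = \sum_a coef (star (x k a) ∘ unbend (y i j)) *: bendl (x k a) l.
  rewrite -bendl_unbend {1}(expand_from disjoint_reps (frameP (fr (Y ⊗ S i))) (unbend (y i j))).
  rewrite (linear_sumE (bendl_linear l)); apply: eq_bigr => a _.
  by rewrite (linear_ZE (bendl_linear l)).
have ey a : bendl' (star (x k a)) l
    = \sum_j coef (unbend' (star (x k a)) ∘ y i j) *: bendr' (y' i j) l.
  rewrite -bendr_unbend' {1}(expand_to disjoint_conj_reps (coframeP (cofr (Sb k ⊗ Y))) (unbend' _)).
  rewrite (linear_sumE (bendr'_linear l)); apply: eq_bigr => j _.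
  by rewrite (linear_ZE (bendr'_linear l)).
transitivity (\sum_a \sum_j coef (star (x k a) ∘ unbend (y i j)) *: G (bendl (x k a) l) (bendr' (y' i j) l)).
  apply: eq_bigr => a _; rewrite ey (linear_sumE (Gr _)); apply: eq_bigr => j _.
  by rewrite (linear_ZE (Gr _)) unbend_coef.
rewrite exchange_big; apply: eq_bigr => j _; rewrite ex (linear_sumE (Gl _)).
by apply: eq_bigr => a _; rewrite (linear_ZE (Gl _)).
Qed.

End Frobenius.

Section Average.
Variables (X X' : ob C) (e : half_braiding X) (e' : half_braiding X').
Implicit Types (t : hom X X').

Definition avg_at i t l : hom (X ⊗ (S i ⊗ l)) (X' ⊗ (S i ⊗ l)) :=
  locked_with tail_key (a22 (hbi e' (S i)) l ∘ (S i ◁ t ▷ l ∘ a22 (e (S i)) l)).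
Lemma avg_atE i t l : avg_at i t l = a22 (hbi e' (S i)) l ∘ (S i ◁ t ▷ l ∘ a22 (e (S i)) l).
Proof. by rewrite /avg_at locked_withE. Qed.
(** A loop coloured [S i] around [t], summed over [i]. The usual weight, the dimension of [S i], is
    hidden: once [star r ∘ r] is normalised to the identity, the solution [rb] that closes the loop
    absorbs it. *)
Definition avg_tail t l : hom (X ⊗ l) (X' ⊗ l) :=
  \sum_i X' ◁ capb i l ∘ (avg_at i t (Sb i ⊗ l) ∘ X ◁ cupb i l).
Definition avg t : hom X X' := m11 (avg_tail t).

Lemma avgE t l : avg t ▷ l = avg_tail t l.
Proof.
apply: m11E; rewrite /avg_tail.
apply: tailmod_sum => [l1 l2|l1 l2|i]; [exact: tensA|exact: tensA|].
apply: (@tailmod_ext _ _ _ _ _ (fun l => X' ◁ capb i l ∘ ((a22 (hbi e' (S i)) (Sb i ⊗ l)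
    ∘ (S i ◁ t ▷ (Sb i ⊗ l) ∘ a22 (e (S i)) (Sb i ⊗ l))) ∘ X ◁ cupb i l))).
  by move=> l'; rewrite avg_atE.
by tailmod_tac.
Qed.

Lemma avg_at_tail i t l m (u : hom l m) :
  avg_at i t m ∘ X ◁ S i ◁ u = X' ◁ S i ◁ u ∘ avg_at i t l.
Proof.
rewrite !avg_atE -!compA a22_tail (reassoc _ (esym (tens_compr _ _ _))).
rewrite exch tens_compr -!compA (reassoc _ (a22_tail (hbi e' (S i)) u)) -!compA //.
Qed.

(** Half braidings are natural, so a vertex [S k -> Y ⊗ S i] can be pulled through the loop: Y is
    braided past the inner strand and the colour of the loop changes from [i] to [k]. *)
Lemma avg_at_12 Y i k (s : hom (S k) (Y ⊗ S i)) t l :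
  Y ◁ avg_at i t l ∘ (a22 (e Y) (S i ⊗ l) ∘ X ◁ a12 s l)
    = a22 (e' Y) (S i ⊗ l) ∘ (X' ◁ a12 s l ∘ avg_at k t l).
Proof.
rewrite !avg_atE !tens_compr -!compA (lax_nat12 (hb_lax e)).
rewrite (reassoc _ (esym (a12_tail s (t ▷ l)))) -!compA.
by rewrite (reassoc _ (hbi_nat12 e' s l)) -!compA.
Qed.

Lemma frame_act Y i l : \sum_k \sum_a a12 (fvec (f := fr (Y ⊗ S i)) k a) l
    ∘ a21 (star (fvec (f := fr (Y ⊗ S i)) k a)) l = idm _.
Proof.
rewrite -a22_id -(frameP (fr (Y ⊗ S i))) (linear_sumE (@a22_linear _ _ _ _ _ _ l)).
apply: eq_bigr => k _; rewrite (linear_sumE (@a22_linear _ _ _ _ _ _ l)).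
by apply: eq_bigr => a _; rewrite a12_21.
Qed.

Lemma coframe_act Y k l : \sum_i \sum_a a12 (cfvec (c := cofr (Sb k ⊗ Y)) i a) l
    ∘ a21 (cfcov (c := cofr (Sb k ⊗ Y)) i a) l = idm _.
Proof.
rewrite -a22_id -(coframeP (cofr (Sb k ⊗ Y))) (linear_sumE (@a22_linear _ _ _ _ _ _ l)).
apply: eq_bigr => i _; rewrite (linear_sumE (@a22_linear _ _ _ _ _ _ l)).
by apply: eq_bigr => a _; rewrite a12_21.
Qed.

(** Y is fused with the loop coloured [S i] into colours [S k], and the vertices are pulled through.
    Then [frobenius] exchanges the frame of [Y ⊗ S i] for one of [Sb k ⊗ Y], which sums to the
    identity and leaves the loops coloured [S k]. *)
Theorem avg_center t Y l :
  Y ◁ avg t ▷ l ∘ a22 (e Y) l = a22 (e' Y) l ∘ avg t ▷ (Y ⊗ l).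
Proof.
pose G k i (u : hom (S k ⊗ (Sb i ⊗ l)) (Y ⊗ l)) (v : hom (Y ⊗ l) (S k ⊗ (Sb i ⊗ l))) :=
  X' ◁ u ∘ (avg_at k t (Sb i ⊗ l) ∘ X ◁ v).
have Gl k i v : linear (fun u => @G k i u v).
  by move=> a u u'; rewrite /G tens_lin_r comp_lin_l.
have Gr k i u : linear (@G k i u).
  by move=> a v v'; rewrite /G tens_lin_r !comp_lin_r.
transitivity (a22 (e' Y) l ∘ \sum_i \sum_k \sum_a
    @G k i (bendl (fvec (f := fr (Y ⊗ S i)) k a) l) (bendl' (star (fvec (f := fr (Y ⊗ S i)) k a)) l)).
  rewrite avgE /avg_tail tens_sumr comp_suml comp_sumr; apply: eq_bigr => i _.
  rewrite !tens_compr -!compA -a22_tail -[a22 (e Y) (S i ⊗ _)]compf1 -(tensm1 X) -(frame_act Y i (Sb i ⊗ l)).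
  rewrite tens_sumr !(comp_suml, comp_sumr); apply: eq_bigr => k _.
  rewrite tens_sumr !(comp_suml, comp_sumr); apply: eq_bigr => a _.
  rewrite tens_compr -!compA (compA (a22 (e Y) _)) (compA (Y ◁ avg_at i t _)) avg_at_12.
  rewrite /G /bendl /bendl' !tens_compr -!compA.
  by rewrite (reassoc _ (esym (a22_tail (e' Y) (capb i l)))) -!compA.
rewrite avgE /avg_tail; congr (_ ∘ _).
transitivity (\sum_k \sum_i \sum_b @G k i (bendr (cfvec (c := cofr (Sb k ⊗ Y)) i b) l)
    (bendr' (cfcov (c := cofr (Sb k ⊗ Y)) i b) l)).
  rewrite exchange_big; apply: eq_bigr => k _; apply: eq_bigr => i _.
  exact: frobenius.
apply: eq_bigr => k _.
rewrite -[cupb k (Y ⊗ l)]comp1f -(tensm1 (S k)) -(coframe_act Y k l).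
rewrite tens_sumr comp_suml tens_sumr !comp_sumr; apply: eq_bigr => i _.
rewrite tens_sumr comp_suml tens_sumr !comp_sumr; apply: eq_bigr => b _.
rewrite /G /bendr /bendr' !tens_compr -!compA.
by rewrite [in RHS](reassoc _ (avg_at_tail _ _ _)) -compA.
Qed.

Lemma avg_morphism t Y : (idm Y ⊠ avg t) ∘ e Y = e' Y ∘ (avg t ⊠ idm Y).
Proof.
apply: a22_inj; rewrite -!a22_comp !a22_tens tensm1; exact: avg_center.
Qed.
End Average.

End Averaging.

(** * Retracts of half braidings, and unitarization *)

Section Retract.
Context {K : fieldType} {C : tcat K}.
Implicit Types X Y Z W l m : ob C.

Definition left_dualizable Y :=
  exists Y' (ev : hom (Y ⊗ Y') unit_ob) (coev : hom unit_ob (Y' ⊗ Y)), dual_pair ev coev.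

(* A retract of a direct sum of objects X i of the center, along endomorphisms c i ∘ a i
   of these objects. *)
Variables (n : nat) (X : 'I_n -> ob C) (e : forall i, half_braiding (X i)) (X' : ob C).
Variables (a : forall i, hom (X i) X') (c : forall i, hom X' (X i)).
Hypothesis ac : \sum_i a i ∘ c i = idm X'.
Hypothesis ca : forall i j, i != j -> c j ∘ a i = 0.
Hypothesis cac : forall i Z,
  (idm Z ⊠ (c i ∘ a i)) ∘ e i Z = e i Z ∘ ((c i ∘ a i) ⊠ idm Z).

(** One formula serves three purposes: direct sums, where [c i ∘ a i] is the identity; splitting of
    an idempotent, with one summand; and transport along an isomorphism, again with one summand. *)
Definition retract_br Z : hom (X' ⊗ Z) (Z ⊗ X') :=
  \sum_i (idm Z ⊠ a i) ∘ (e i Z ∘ (c i ⊠ idm Z)).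

Lemma retract_absorbl i : c i ∘ a i ∘ c i = c i.
Proof.
rewrite -[RHS]compf1 -ac comp_sumr (bigD1 i) //= big1 ?addr0 ?compA // => j ji.
by rewrite compA ca ?comp0l.
Qed.
Lemma retract_absorbr i : a i ∘ (c i ∘ a i) = a i.
Proof.
rewrite -[RHS]comp1f -ac comp_suml (bigD1 i) //= big1 ?addr0 ?compA // => j ji.
by rewrite -compA ca ?comp0r // eq_sym.
Qed.

Lemma retract_in i Z : (idm Z ⊠ a i) ∘ e i Z = retract_br Z ∘ (a i ⊠ idm Z).
Proof.
rewrite /retract_br comp_suml (bigD1 i) //= big1 ?addr0 => [|j ji].
  by rewrite -!compA -tens_compl -cac compA -tens_compr retract_absorbr.
by rewrite -!compA -tens_compl ca 1?eq_sym // tens0l !comp0r.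
Qed.

Lemma retract_out i Z : (idm Z ⊠ c i) ∘ retract_br Z = e i Z ∘ (c i ⊠ idm Z).
Proof.
rewrite /retract_br comp_sumr (bigD1 i) //= big1 ?addr0 => [|j ji].
  by rewrite compA -tens_compr compA cac -compA -tens_compl retract_absorbl.
by rewrite compA -tens_compr ca // tens0r comp0l.
Qed.

Lemma retract_a22 Z l :
  a22 (retract_br Z) l = \sum_i Z ◁ a i ▷ l ∘ (a22 (e i Z) l ∘ c i ▷ (Z ⊗ l)).
Proof.
rewrite (linear_sumE (@a22_linear _ _ _ _ _ _ l)); apply: eq_bigr => i _.
by rewrite -[idm (Z ⊗ l)]tensm1 -!a22_tens !a22_comp.
Qed.

Lemma retract_outE i Z l :
  Z ◁ c i ▷ l ∘ a22 (retract_br Z) l = a22 (e i Z) l ∘ c i ▷ (Z ⊗ l).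
Proof. by rewrite -[idm (Z ⊗ l)]tensm1 -!a22_tens !a22_comp retract_out. Qed.

Lemma retract_lax : lax_hb retract_br.
Proof.
split=> [Y Z f l|Y Z l|l].
- rewrite !retract_a22 comp_sumr comp_suml; apply: eq_bigr => i _.
  rewrite (reassoc _ (exch f (a i ▷ l))) -!compA exch.
  by rewrite (reassoc _ (lax_nat (hb_lax (e i)) f l)) -!compA.
- rewrite [a22 (retract_br (_ ⊗ _)) l]retract_a22 [a22 (retract_br Z) l]retract_a22.
  rewrite tens_sumr !comp_suml comp_sumr; apply: eq_bigr => i _.
  rewrite !tens_compr -!compA retract_outE exch.
  rewrite (reassoc _ (lax_hex (hb_lax (e i)) Y Z l)) -!compA.
  by rewrite (reassoc _ (asc_tail Y Z (a i ▷ l))) -!compA.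
have -> : lu' (X' ⊗ l) = \sum_i lu' (X' ⊗ l) ∘ (a i ∘ c i) ▷ l.
  by rewrite -comp_sumr -tens_suml ac tensm1 compf1.
rewrite retract_a22 comp_suml.
apply: eq_bigr => i _; rewrite -!compA exch (reassoc _ (lax_one (hb_lax (e i)) l)).
by rewrite compA -lu'_nat -compA tens_compl.
Qed.

Hypothesis dC : forall Y, left_dualizable Y.

Lemma retract_iso Z : is_iso (retract_br Z).
Proof. by have [Y' [ev [coev dp]]] := dC Z; exact: lax_iso retract_lax _ _ _ _ dp. Qed.

Definition retract_hb : half_braiding X' := mk_hb retract_lax retract_iso.

End Retract.

Section UnitaryRetract.
Context {K : numClosedFieldType} {C : star_tcat K}.
Implicit Types X Y Z W l m : ob C.

Lemma conjugates_dualizable : has_conjugates C -> forall Y : ob C, left_dualizable Y.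
Proof.
move=> hc Y; case: (hc Y) => s.
by exists (cjob s), (star (cjrb s)), (cjr s); exact: conjugate_dual'.
Qed.

Lemma unitary_hbi X (e : half_braiding X) Y : unitary (e Y) -> hbi e Y = star (e Y).
Proof.
move=> [e1 e2]; rewrite -[LHS]comp1f -e1 -compA hbKi compf1 //.
Qed.

Lemma retract_unitary n (X : 'I_n -> ob C) (e : forall i, half_braiding (X i)) X'
    (a : forall i, hom (X i) X') :
  \sum_i a i ∘ star (a i) = idm X' ->
  (forall i j, i != j -> star (a j) ∘ a i = 0) ->
  (forall i Z, (idm Z ⊠ (star (a i) ∘ a i)) ∘ e i Z = e i Z ∘ ((star (a i) ∘ a i) ⊠ idm Z)) ->
  (forall i Z, unitary (e i Z)) ->
  forall Z, unitary (retract_br e a (fun i => star (a i)) Z).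
Proof.
move=> ac ca cac ue Z; set u := retract_br _ _ _ Z.
have su : star u = \sum_i (a i ⊠ idm Z) ∘ (star (e i Z) ∘ (idm Z ⊠ star (a i))).
  rewrite /u /retract_br star_sum; apply: eq_bigr => i _.
  by rewrite !star_comp !star_tens !star_idm starK -compA.
split; rewrite su.
  rewrite comp_suml -(tensm1 X') -ac tens_suml; apply: eq_bigr => i _.
  rewrite -!compA /u (retract_out ac ca cac) (compA (star _)) (proj1 (ue i Z)) comp1f.
  by rewrite -tens_compl.
rewrite comp_sumr -(tensm1 Z) -ac tens_sumr; apply: eq_bigr => i _.
rewrite compA /u -(retract_in ac ca cac) -compA (compA (e i Z)) (proj2 (ue i Z)) comp1f.
by rewrite -tens_compr.
Qed.

(* The half braiding (e^-1)^* *)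
Section StarHB.
Variables (X : ob C) (e : half_braiding X).

(** Naturality, hexagon and unit law of the inverse of [e] point the wrong way for a half braiding;
    adjoints reverse them. *)
Lemma star_hb_lax : lax_hb (fun Y => star (hbi e Y)).
Proof.
have ie := hbiK e; have ei := hbKi e.
split=> [Y Z f l|Y Z l|l]; rewrite -!star_a22.
- apply: (can_inj (@starK _ _ _ _)); rewrite !star_comp !starK !star_lwh !star_rwh.
  exact/esym/(inv_nat (hb_lax e) ie ei).
- apply: (can_inj (@starK _ _ _ _)); rewrite !star_comp !starK !star_lwh starK.
  have st V W m : star (asc V W m) = asc' V W m by rewrite /asc star_eqh.
  rewrite !st -[a22 (hbi e (Y ⊗ Z)) l]compf1 -(ascK Y Z (X ⊗ l)) (compA (a22 _ l)).
  rewrite -(inv_hex (hb_lax e) ie ei) -!compA (comp1K _ _) //.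
  by rewrite -tens_compr asc'K tensm1.
apply: (can_inj (@starK _ _ _ _)); rewrite !star_comp starK star_lwh /lu' !star_eqh.
have h := lax_one (hb_lax e) l.
have : lu (X ⊗ l) ∘ a22 (e unit_ob) l = X ◁ lu l.
  by rewrite -[LHS]compf1 -tensm1 -(lu'K l) tens_compr compA -(compA (lu _)) h luK comp1f.
move=> /(congr1 (fun f => f ∘ a22 (hbi e unit_ob) l)); rewrite -compA a22_hbKi compf1.
by rewrite /lu => h'; rewrite (eqh_irr (esym (esym _)) (tens1o l)) -h'; exact: eqh_irr.
Qed.

Lemma star_hb_iso Y : is_iso (star (hbi e Y)).
Proof.
by exists (star (e Y)); rewrite -star_comp ?hbiK ?hbKi star_idm.
Qed.

Definition star_hb : half_braiding X := mk_hb star_hb_lax star_hb_iso.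

Lemma hbi_star_hb Y : hbi star_hb Y = star (e Y).
Proof.
have h : star (e Y) ∘ star (hbi e Y) = idm _ by rewrite -star_comp hbiK star_idm.
by rewrite -[LHS]comp1f -h -compA (hbKi star_hb) compf1.
Qed.
End StarHB.
End UnitaryRetract.

Section Unitarization.
Context {K : numClosedFieldType} {C : star_tcat K}.
Implicit Types X Y Z W l m : ob C.
Hypotheses (ho : has_orthogonal_sums C) (hs : idempotents_split C) (hc : has_conjugates C).
Hypothesis s1 : is_simple (unit_ob : ob C).
Variables (n : nat) (S : 'I_n -> ob C).
Hypothesis rS : simple_representatives S.
Variable cS : forall i, conjugate (S i).
Hypothesis nS : forall i, star (cjr (cS i)) ∘ cjr (cS i) = idm unit_ob.

Lemma some_simple : exists i : 'I_n, True.
Proof. by have [_ _ /(_ _ s1) [i _]] := rS; exists i. Qed.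

Lemma cupb_mono X i W l (c : hom W (X ⊗ l)) : X ◁ a02 (cjrb (cS i)) l ∘ c = 0 -> c = 0.
Proof.
move=> e; have d0 := coef_sq_gt0 ho s1 (cjrb_neq0 (s := cS i) (proj1 (simple_reps rS i))).
apply: (scalerI (lt0r_neq0 d0)); rewrite scaler0.
have := congr1 (fun f => X ◁ a20 (star (cjrb (cS i))) l ∘ f) e; rewrite comp0r compA.
rewrite -tens_compr a20_02.
rewrite {1}(coef_idm (star (cjrb (cS i)) ∘ cjrb (cS i)) s1) tensZl tensm1 compZl comp1f.
by rewrite compZr luK tensZr tensm1 compZl comp1f.
Qed.

(* The half-strands of the average of a morphism of the form star w ∘ w. *)
Definition half_avg X (e : half_braiding X) Y (w : hom X Y) i :
    hom X (S i ⊗ (Y ⊗ (cjob (cS i) ⊗ unit_ob))) :=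
  S i ◁ w ▷ _ ∘ (a22 (e (S i)) _ ∘ (X ◁ a02 (cjrb (cS i)) unit_ob ∘ ru' X)).

(** The hypothesis on [e'] makes the second half of each loop the adjoint of the first, so every
    summand of the average is a square. *)
Lemma avg_square X (e e' : half_braiding X) Y (w : hom X Y) :
  (forall Z, hbi e' Z = star (e Z)) ->
  avg cS e e' (star w ∘ w) = \sum_i star (half_avg e w i) ∘ half_avg e w i.
Proof.
move=> he'; have -> : avg cS e e' (star w ∘ w)
    = ru X ∘ (avg cS e e' (star w ∘ w) ▷ unit_ob ∘ ru' X).
  by rewrite compA /ru tensm1r -compA eqhK compf1.
rewrite avgE /avg_tail comp_suml comp_sumr; apply: eq_bigr => i _.
have sr : star (ru' X) = ru X by rewrite /ru' star_eqh; exact: eqh_irr.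
rewrite !avg_atE he' /half_avg !star_comp !star_lwh star_rwh star_a02 star_a22 sr.
by rewrite tens_compl tens_compr -!compA.
Qed.

(** Vanishing at the unit tail spreads to all tails. At the tail [S i ⊗ unit_ob] the cup can be
    straightened and the half braiding inverted, which leaves [S i ◁ w]; the normalised cap then
    recovers [w]. *)
Lemma half_avg_mono X (e : half_braiding X) Y (w : hom X Y) i :
  half_avg e w i = 0 -> w = 0.
Proof.
pose f l := S i ◁ w ▷ (cjob (cS i) ⊗ l) ∘ (a22 (e (S i)) (cjob (cS i) ⊗ l)
  ∘ X ◁ a02 (cjrb (cS i)) l).
move=> e0; have f0 : f unit_ob = 0.
  have -> : f unit_ob = half_avg e w i ∘ ru X by rewrite /half_avg -!compA ru'K compf1.
  by rewrite e0 comp0l.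
have tf : tailmod f by rewrite /f; tailmod_tac.
have fl l : f l = 0.
  have : heq (f (unit_ob ⊗ l)) (f l) by apply: heq_cong; exact: tens1o.
  move=> /heq_sym /heq_trans /(_ (tf _ _)); rewrite f0 tens0l.
  case=> p [q]; rewrite comp0l => e1; apply: (eqh_mono (p := q)).
  by rewrite e1 comp0r.
apply: rwh_inj; rewrite tens0l -[LHS]compf1 -(cap_cup nS i (X ⊗ unit_ob)) (compA (w ▷ _)).
rewrite -(a20_tail (star (cjr (cS i))) (w ▷ unit_ob)) -compA.
suff -> : S i ◁ w ▷ unit_ob = 0 by rewrite tens0r comp0l comp0r.
rewrite -[LHS]compf1 -(a22_hbKi e (S i) unit_ob) compA.
suff -> : S i ◁ w ▷ unit_ob ∘ a22 (e (S i)) unit_ob = 0 by rewrite comp0l.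
rewrite -[LHS]compf1 -(tensm1 X) -(zig1 cS i unit_ob) tens_compr !compA -(compA _ (a22 _ _)).
rewrite a22_tail compA -tens_compr exch tens_compr -!compA.
by have := fl (S i ⊗ unit_ob); rewrite /f => ->; rewrite comp0r.
Qed.

Lemma unitarize X (e : half_braiding X) : exists (e' : half_braiding X) (h : hom X X),
  [/\ is_iso h, forall Z, unitary (e' Z) & forall Z, (idm Z ⊠ h) ∘ e Z = e' Z ∘ (h ⊠ idm Z)].
Proof.
pose k := avg cS e (star_hb e) (star (idm X) ∘ idm X).
have kE : k = \sum_i star (half_avg e (idm X) i) ∘ half_avg e (idm X) i.
  by apply: avg_square => Z; exact: hbi_star_hb.
have [P [g [w [gg wg]]]] := sum_of_squares ho (half_avg e (idm X)).
(* A single half loop is already injective: the half braiding is invertible, and the cup has a left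
   inverse up to its nonzero norm. *)
have gmono Y (c : hom Y X) : g ∘ c = 0 -> c = 0.
  have [i _] := some_simple => gc.
  have : half_avg e (idm X) i ∘ c = 0 by rewrite -wg -compA gc comp0r.
  rewrite /half_avg tensm1 tensm1 comp1f -!compA.
  move=> /(congr1 (fun f => a22 (hbi e (S i)) _ ∘ f)); rewrite comp0r (comp1K _ (a22_hbiK _ _ _)).
  move=> /cupb_mono e0; apply: (eqh_mono (p := esym (tenso1 X))).
  by rewrite -/(ru' X) e0 comp0r.
have [h [sh hh ih]] := square_root ho gmono; rewrite gg -kE in hh.
have [h' hh' h'h] := ih.
have sh' : star h' = h'.
  by rewrite -[LHS]compf1 -h'h compA -{1}sh -star_comp h'h star_idm comp1f.
have kc Z : (idm Z ⊠ k) ∘ e Z = star (hbi e Z) ∘ (k ⊠ idm Z).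
  exact: (avg_morphism ho hs hc rS nS).
(* Conjugation of [e] by [h], obtained as a retract with one summand along an isomorphism. *)
pose a (i : 'I_1) := h; pose c (i : 'I_1) := h'.
have ac : \sum_i a i ∘ c i = idm X by rewrite big_ord1.
have ca (i j : 'I_1) : i != j -> c j ∘ a i = 0 by rewrite !ord1.
have cac (i : 'I_1) Z : (idm Z ⊠ (c i ∘ a i)) ∘ e Z = e Z ∘ ((c i ∘ a i) ⊠ idm Z).
  by rewrite /c /a hh' !tensm1 comp1f compf1.
pose e' := retract_hb ac ca cac (conjugates_dualizable hc).
have e'E Z : e' Z = (idm Z ⊠ h) ∘ (e Z ∘ (h' ⊠ idm Z)) by rewrite /= /retract_br big_ord1.
exists e', h; split=> // Z.
  have e1 : star (e' Z) ∘ e' Z = idm _.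
    rewrite e'E !star_comp !star_tens !star_idm sh sh' -!compA.
    rewrite (compA (idm Z ⊠ h)) -tens_compr hh (compA _ (e Z)) kc -!compA.
    rewrite (compA (star (e Z))) -star_comp hbiK star_idm comp1f -!tens_compl.
    by rewrite -hh -!compA h'h compf1 hh' tensm1.
  split=> //; rewrite -[LHS]compf1 -(hbKi e' Z) -compA (compA (star _)) e1 comp1f //.
by rewrite e'E -!compA -tens_compl hh' tensm1 compf1.
Qed.
End Unitarization.

(** * The equivalence of the two centers *)

Section FullEquivalence.
Context {K : fieldType} {E : tcat K} (P : ob E -> Prop).
Hypotheses (P1 : P unit_ob) (PM : forall X Y, P X -> P Y -> P (X ⊗ Y)).
Hypothesis ess : forall X : ob E, exists Y : {Y : ob E | P Y}, isomorphic X (sval Y).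

Local Notation D := (full_tcat P1 PM).

Let r X : {Y : ob E | P Y} := sval (cid (ess X)).
Let fex X : exists f : hom X (sval (r X)), is_iso f := svalP (cid (ess X)).
Let f X : hom X (sval (r X)) := sval (cid (fex X)).
Let g X : hom (sval (r X)) X := s2val (cid2 (svalP (cid (fex X)))).
Let gf X : g X ∘ f X = idm X := s2valP (cid2 (svalP (cid (fex X)))).
Let fg X : f X ∘ g X = idm _ := s2valP' (cid2 (svalP (cid (fex X)))).

Lemma asc_full (X Y Z : ob D) : asc X Y Z = asc (sval X) (sval Y) (sval Z) :> hom (_ : ob E) _.
Proof. by rewrite /asc eqh_full; exact: eqh_irr. Qed.
Lemma asc'_full (X Y Z : ob D) : asc' X Y Z = asc' (sval X) (sval Y) (sval Z) :> hom (_ : ob E) _.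
Proof. by rewrite /asc' eqh_full; exact: eqh_irr. Qed.
Lemma lu_full (X : ob D) : lu X = lu (sval X) :> hom (_ : ob E) _.
Proof. by rewrite /lu eqh_full; exact: eqh_irr. Qed.
Lemma lu'_full (X : ob D) : lu' X = lu' (sval X) :> hom (_ : ob E) _.
Proof. by rewrite /lu' eqh_full; exact: eqh_irr. Qed.
Lemma ru_full (X : ob D) : ru X = ru (sval X) :> hom (_ : ob E) _.
Proof. by rewrite /ru eqh_full; exact: eqh_irr. Qed.
Lemma ru'_full (X : ob D) : ru' X = ru' (sval X) :> hom (_ : ob E) _.
Proof. by rewrite /ru' eqh_full; exact: eqh_irr. Qed.

Lemma zigzag_full (A B : ob D) (ev : hom (A ⊗ B) unit_ob) (coev : hom unit_ob (B ⊗ A)) :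
  zigzag ev coev = zigzag (ev : hom (sval A ⊗ sval B) unit_ob) coev :> hom (_ : ob E) _.
Proof. by rewrite /zigzag lu_full asc_full ru'_full. Qed.
Lemma zagzig_full (A B : ob D) (ev : hom (B ⊗ A) unit_ob) (coev : hom unit_ob (A ⊗ B)) :
  zagzig ev coev = zagzig (ev : hom (sval B ⊗ sval A) unit_ob) coev :> hom (_ : ob E) _.
Proof. by rewrite /zagzig ru_full asc'_full lu'_full. Qed.

Definition full_inclusion : monoidal_functor D E.
Proof.
apply: (@MonoidalFunctor K D E (fun X => sval X) (fun X Y t => t) _ _ _
  (idm unit_ob) (fun X Y => idm (sval X ⊗ sval Y))).
- by [].
- by [].
- by [].
- exact: iso_idm.
- by move=> X Y; exact: iso_idm.
- by move=> *; rewrite comp1f compf1.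
- by move=> X Y Z; rewrite asc_full tensm1 tensm1 !compf1 !comp1f.
- by move=> X; rewrite lu_full tensm1 !compf1.
- by move=> X; rewrite ru_full tensm1 !compf1.
Defined.

(** Each object is replaced by a chosen isomorphic one satisfying [P], and all structure is
    conjugated by the isomorphisms [f]; their inverses [g] serve later as the monoidal natural
    isomorphisms. *)
Definition full_retraction : monoidal_functor E D.
Proof.
apply: (@MonoidalFunctor K E D r (fun X Y t => f Y ∘ (t ∘ g X)) _ _ _
  (f unit_ob) (fun X Y => f (X ⊗ Y) ∘ (g X ⊠ g Y))).
- by move=> X Y a t s; rewrite comp_lin_l comp_lin_r.
- by move=> X; rewrite comp1f; exact: fg.
- by move=> X Y Z t s; rewrite /= -!compA (comp1K _ (gf _)).
- by exists (g unit_ob); [exact: gf|exact: fg].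
- move=> X Y; have [s s1 s2] : @is_iso _ E _ _ (f (X ⊗ Y) ∘ (g X ⊠ g Y)).
    apply: iso_comp; first by exists (g (X ⊗ Y)); [exact: gf|exact: fg].
    by apply: iso_tens; [exists (f X)|exists (f Y)]; rewrite ?fg ?gf.
  by exists s.
- move=> X X' Y Y' t s; rewrite /= -!compA (comp1K _ (gf _)) -!tensm_comp.
  by rewrite !(compA (g _)) !gf !comp1f.
- move=> X Y Z; rewrite asc_full /= -!compA (comp1K _ (gf _)) -[idm _ in LHS]/(idm (sval (r X))).
  rewrite -tensm_comp compf1 (comp1K _ (gf _)) asc_nat.
  by rewrite (compA (g _ ⊠ g _)) -tensm_comp compf1 (comp1K _ (gf _)).
- move=> X; rewrite lu_full /= -!compA (comp1K _ (gf _)) -tensm_comp gf compf1.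
  by rewrite /lu tens1m compA fg comp1f.
- move=> X; rewrite ru_full /= -!compA (comp1K _ (gf _)) -tensm_comp gf compf1.
  by rewrite /ru tensm1r compA fg comp1f.
Defined.

Lemma full_monoidally_equivalent : monoidally_equivalent D E.
Proof.
exists full_inclusion, full_retraction; split.
  exists (fun X : ob D => g (sval X)); split=> [X|X Y t|X Y|] /=.
  - by exists (f (sval X)); [exact: fg|exact: gf].
  - by rewrite (comp1K _ (gf _)).
  - by rewrite comp1f fg comp1f (comp1K _ (gf _)).
  - by rewrite comp1f fg comp1f gf.
exists (fun X : ob E => g X); split=> [X|X Y t|X Y|] /=.
- by exists (f X); [exact: fg|exact: gf].
- by rewrite (comp1K _ (gf _)).
- by rewrite compf1 (comp1K _ (gf _)).
- by rewrite compf1 gf.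
Qed.

Lemma full_split : idempotents_split E -> idempotents_split D.
Proof.
move=> hE A p pp; have [B [v [w [wv vw]]]] := hE (sval A) p pp.
exists (r B), (v ∘ g B), (f B ∘ w); split.
  by rewrite /= -compA (comp1K _ wv) fg.
by rewrite /= -vw -compA (comp1K _ (gf B)).
Qed.

End FullEquivalence.

Section CenterIso.
Context {K : fieldType} {C : tcat K}.
Implicit Types A B : ob (center_tcat C).

Lemma center_is_iso A B (t : hom A B) : is_iso (cval t) -> is_iso t.
Proof.
move=> [s st ts].
have cs Z : (idm Z ⊠ s) ∘ cbr B Z = cbr A Z ∘ (s ⊠ idm Z).
  rewrite -[LHS]compf1 -(tensm1 (cob B)) -ts tens_compl -compA (compA (cbr B Z)) -cmorP.
  by rewrite !compA -tens_compr st tensm1 comp1f.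
by exists (cmor cs : hom B A); exact: cval_inj.
Qed.

Lemma asc_center A B D : cval (asc A B D) = asc (cob A) (cob B) (cob D).
Proof. by rewrite /asc cval_eqh; exact: eqh_irr. Qed.
Lemma asc'_center A B D : cval (asc' A B D) = asc' (cob A) (cob B) (cob D).
Proof. by rewrite /asc' cval_eqh; exact: eqh_irr. Qed.
Lemma lu_center A : cval (lu A) = lu (cob A).
Proof. by rewrite /lu cval_eqh; exact: eqh_irr. Qed.
Lemma lu'_center A : cval (lu' A) = lu' (cob A).
Proof. by rewrite /lu' cval_eqh; exact: eqh_irr. Qed.
Lemma ru_center A : cval (ru A) = ru (cob A).
Proof. by rewrite /ru cval_eqh; exact: eqh_irr. Qed.
Lemma ru'_center A : cval (ru' A) = ru' (cob A).
Proof. by rewrite /ru' cval_eqh; exact: eqh_irr. Qed.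

Lemma zigzag_center A B (ev : hom (A ⊗ B) unit_ob) (coev : hom unit_ob (B ⊗ A)) :
  cval (zigzag ev coev) = zigzag (cval ev : hom (cob A ⊗ cob B) unit_ob) (cval coev).
Proof. by rewrite /zigzag -lu_center -asc_center -ru'_center. Qed.
Lemma zagzig_center A B (ev : hom (B ⊗ A) unit_ob) (coev : hom unit_ob (A ⊗ B)) :
  cval (zagzig ev coev) = zagzig (cval ev : hom (cob B ⊗ cob A) unit_ob) (cval coev).
Proof. by rewrite /zagzig -ru_center -asc'_center -lu'_center. Qed.

End CenterIso.

(** * The unitary double as a tensor *-category *)

Section CenterTails.
Context {K : fieldType} {C : tcat K}.
Implicit Types (A B : center_ob C) (X Y Z W : ob C).

Lemma center_tens_tail A B Z l :
  a22 (cbr (center_tens A B) Z) l ∘ asc (cob A) (cob B) (Z ⊗ l)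
    = Z ◁ asc (cob A) (cob B) l ∘ (a22 (cbr A Z) (cob B ⊗ l) ∘ cob A ◁ a22 (cbr B Z) l).
Proof.
rewrite /= /center_tens_e !a22E !tens_compl !tens_compr -!compA.
rewrite /asc /asc' !eqh_tensl !eqh_tensr !eqh_comp !eqh_compA.
apply/heq_eq/heq_cl/heq_mid; last exact: heq_rwh.
by apply: heq_cr; exact: heq_tensA'.
Qed.

Lemma center_one_tail Z l : a22 (center_one_e (C := C) Z) l ∘ lu' (Z ⊗ l) = Z ◁ lu' l.
Proof.
rewrite a22E /center_one_e !tens_compl /ru' /lu /lu' /asc /asc'.
by rewrite !eqh_tensl !eqh_tensr !eqh_comp; exact: eqh_irr.
Qed.

(** By [center_tens_tail] the half braiding of a product is two successive braidings, so the
    condition for a morphism of the center becomes sliding the strand Z through the cap. *)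
Lemma ev_center A B (ev : hom (cob A ⊗ cob B) unit_ob) :
  (forall Z l, Z ◁ a20 ev l ∘ (a22 (cbr A Z) (cob B ⊗ l) ∘ cob A ◁ a22 (cbr B Z) l)
    = a20 ev (Z ⊗ l)) ->
  forall Z, (idm Z ⊠ ev) ∘ cbr (center_tens A B) Z = cbr (center_one C) Z ∘ (ev ⊠ idm Z).
Proof.
move=> h Z; apply: a22_inj; rewrite -(a22_comp (idm Z ⊠ ev)) -(a22_comp (cbr (center_one C) Z)).
rewrite (a22_tens (idm Z) ev) (a22_tens ev (idm Z)) (tensm1 Z unit_ob).
have lm m (f g : hom m (Z ⊗ (unit_ob ⊗ unit_ob))) :
  Z ◁ lu unit_ob ∘ f = Z ◁ lu unit_ob ∘ g -> f = g by rewrite /lu eqh_tensr => /eqh_mono.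
apply: lm; apply: (eqh_epi (p := tensA (cob A) (cob B) (Z ⊗ unit_ob))).
rewrite -!/(asc _ _ _) -!compA center_tens_tail.
rewrite (compA (Z ◁ ev ▷ _)) -tens_compr -a21E (compA (Z ◁ lu _)) -tens_compr -a20E h.
rewrite a20E a21E (compA (Z ◁ lu _)); congr (_ ∘ _).
rewrite -[RHS]compf1 -(lu'K (Z ⊗ unit_ob)) -!compA (compA (a22 _ _)) center_one_tail.
by rewrite compA -tens_compr luK tensm1 comp1f.
Qed.

Lemma coev_center A B (coev : hom unit_ob (cob A ⊗ cob B)) :
  (forall Z l, a22 (cbr A Z) (cob B ⊗ l) ∘ (cob A ◁ a22 (cbr B Z) l ∘ a02 coev (Z ⊗ l))
    = Z ◁ a02 coev l) ->
  forall Z, (idm Z ⊠ coev) ∘ cbr (center_one C) Z = cbr (center_tens A B) Z ∘ (coev ⊠ idm Z).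
Proof.
move=> h Z; apply: a22_inj; rewrite -(a22_comp (idm Z ⊠ coev)) -(a22_comp (cbr (center_tens A B) Z)).
rewrite (a22_tens (idm Z) coev) (a22_tens coev (idm Z)) (tensm1 Z unit_ob).
have lm m (f g : hom m (Z ⊗ ((cob A ⊗ cob B) ⊗ unit_ob))) :
  Z ◁ asc' (cob A) (cob B) unit_ob ∘ f = Z ◁ asc' (cob A) (cob B) unit_ob ∘ g -> f = g.
  by rewrite /asc' eqh_tensr => /eqh_mono.
apply: lm; apply: (eqh_epi (p := esym (tens1o (Z ⊗ unit_ob)))).
rewrite -!/(lu' _) -!compA center_one_tail -[in RHS](comp1K (coev ▷ _ ∘ _) (ascK (cob A) (cob B) (Z ⊗ unit_ob))).
rewrite (compA (a22 _ _)) center_tens_tail -!compA (compA (asc' _ _ _)) -a12E -a02E h.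
by rewrite -!tens_compr (comp1K _ (asc'K _ _ _)) compA -a12E -a02E.
Qed.

End CenterTails.

Section DualTransport.
Context {K : fieldType} {C : tcat K}.
Implicit Types X Y Z : ob C.

Lemma a20_pre X X' Y (ev : hom (X' ⊗ Y) unit_ob) (g : hom X X') l :
  a20 (ev ∘ (g ⊠ idm Y)) l = a20 ev l ∘ g ▷ (Y ⊗ l).
Proof. by rewrite -a20_22 a22_tens tensm1. Qed.
Lemma a02_post X Y Y' (coev : hom unit_ob (X ⊗ Y)) (f : hom Y Y') l :
  a02 ((idm X ⊠ f) ∘ coev) l = X ◁ f ▷ l ∘ a02 coev l.
Proof. by rewrite -a22_02 a22_tens. Qed.

Lemma dual_pair_transport X Y Y' (ev : hom (Y ⊗ X) unit_ob) (coev : hom unit_ob (X ⊗ Y))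
    (f : hom Y Y') (g : hom Y' Y) : g ∘ f = idm Y -> f ∘ g = idm Y' ->
  dual_pair ev coev -> dual_pair (ev ∘ (g ⊠ idm X)) ((idm X ⊠ f) ∘ coev).
Proof.
move=> gf fg dp; split; apply: rwh_inj.
  rewrite zagzig_tail a20_pre a02_post tens_compr -compA (compA (X ◁ g ▷ _)) -tens_compr.
  by rewrite -tens_compl gf !tensm1 comp1f (dual_pairX dp).
rewrite zigzag_tail a20_pre a02_post -compA exch tens_compr -!compA.
rewrite (reassoc _ (a20_tail ev (f ▷ _))) -compA (comp1K _ (dual_pairY dp _)).
by rewrite -tens_compl fg.
Qed.
End DualTransport.

Section UnitaryDouble.
Context {K : numClosedFieldType} {C : star_tcat K}.
Hypotheses (ho : has_orthogonal_sums C) (hs : idempotents_split C) (hc : has_conjugates C).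
Hypothesis s1 : is_simple (unit_ob : ob C).
Variables (n : nat) (S : 'I_n -> ob C).
Hypothesis rS : simple_representatives S.
Variable cS : forall i, conjugate (S i).
Hypothesis nS : forall i, star (cjr (cS i)) ∘ cjr (cS i) = idm unit_ob.

Local Notation Z := (center_tcat C).
Local Notation D := (unitary_double C).

Lemma cval_sum (A B : center_ob C) m (f : 'I_m -> center_hom A B) :
  cval (\sum_i f i) = \sum_i cval (f i).
Proof. exact: (linear_sumE (@cval_linear _ _ A B)). Qed.

Lemma unitary_representative (A : ob Z) :
  exists B : {B : ob Z | unitary_hb B}, isomorphic A (sval B).
Proof.
have [e' [h [ih ue hm]]] := unitarize ho hs hc s1 rS nS (cbr A).
have uB : unitary_hb (CenterOb e' : ob Z) by [].
exists (exist (fun B => unitary_hb B) (CenterOb e' : ob Z) uB).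
exists (cmor (B := CenterOb e') hm : @hom _ Z A (CenterOb e')).
exact: center_is_iso.
Qed.

Lemma double_equivalent : monoidally_equivalent D Z.
Proof. exact: (full_monoidally_equivalent (E := Z) _ _ unitary_representative). Qed.

Lemma double_simple_unit : is_simple (unit_ob : ob D).
Proof.
have [one0 sc] := s1; split=> [e|f].
  by apply: one0; exact: (congr1 (@cval _ _ _ _) e).
by have [a e] := sc (cval f); exists a; apply: cval_inj.
Qed.

Lemma double_orthogonal_sums : has_orthogonal_sums D.
Proof.
move=> m A; have [X [v [v1 v0 vs]]] := ho (fun i => cob (sval (A i))).
have ca i j : i != j -> star (v j) ∘ v i = 0 by move=> ij; apply: v0; rewrite eq_sym.
have cac i Y : (idm Y ⊠ (star (v i) ∘ v i)) ∘ cbr (sval (A i)) Y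
    = cbr (sval (A i)) Y ∘ ((star (v i) ∘ v i) ⊠ idm Y).
  by rewrite v1 !tensm1 comp1f compf1.
pose e := retract_hb (a := v) (c := fun i => star (v i)) vs ca cac (conjugates_dualizable hc).
have ue Y : unitary (e Y).
  by apply: retract_unitary => // i W; exact: (svalP (A i)).
pose B : ob D := exist (fun B => unitary_hb B) (CenterOb e : ob Z) ue.
have vm i Y : (idm Y ⊠ v i) ∘ cbr (sval (A i)) Y = e Y ∘ (v i ⊠ idm Y).
  exact: (retract_in vs ca cac).
exists B, (fun i => cmor (A := sval (A i)) (B := sval B) (vm i)); split.
- by move=> i; apply: cval_inj; exact: v1.
- by move=> i j ij; apply: cval_inj; exact: v0.
by apply: cval_inj; rewrite cval_sum; exact: vs.
Qed.

Lemma center_split : idempotents_split Z.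
Proof.
move=> A p /(congr1 (@cval _ _ _ _)) /= pp; have [Y [v [w [wv vw]]]] := hs pp.
pose a (i : 'I_1) := w; pose c (i : 'I_1) := v.
have ac : \sum_i a i ∘ c i = idm Y by rewrite big_ord1.
have ca (i j : 'I_1) : i != j -> c j ∘ a i = 0 by rewrite !ord1.
have cac (i : 'I_1) W : (idm W ⊠ (c i ∘ a i)) ∘ cbr A W = cbr A W ∘ ((c i ∘ a i) ⊠ idm W).
  by rewrite /c /a vw cmorP.
pose e := retract_hb ac ca cac (conjugates_dualizable hc).
have wm W : (idm W ⊠ w) ∘ cbr A W = e W ∘ (w ⊠ idm W) := retract_in ac ca cac ord0 W.
have vm W : (idm W ⊠ v) ∘ e W = cbr A W ∘ (v ⊠ idm W) := retract_out ac ca cac ord0 W.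
exists (CenterOb e), (cmor (A := CenterOb e) vm), (cmor (B := CenterOb e) wm).
by split; apply: cval_inj.
Qed.

Lemma double_split : idempotents_split D.
Proof.
exact: (@full_split _ Z _ (@unitary_hb_one K C) (@unitary_hb_tens K C)
  unitary_representative (@center_split)).
Qed.

Lemma zigzag_double (A B : ob D) (ev : hom (A ⊗ B) unit_ob) (coev : hom unit_ob (B ⊗ A)) :
  zigzag ev coev = zigzag (ev : @hom _ Z (sval A ⊗ sval B) unit_ob) coev
    :> @hom _ Z (sval A) (sval A).
Proof. exact: (zigzag_full (E := Z) ev coev). Qed.
Lemma zagzig_double (A B : ob D) (ev : hom (B ⊗ A) unit_ob) (coev : hom unit_ob (A ⊗ B)) :
  zagzig ev coev = zagzig (ev : @hom _ Z (sval B ⊗ sval A) unit_ob) coev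
    :> @hom _ Z (sval A) (sval A).
Proof. exact: (zagzig_full (E := Z) ev coev). Qed.

Lemma dual_pair_conjugate (A B : ob D) (ev : hom (B ⊗ A) unit_ob) (coev : hom unit_ob (A ⊗ B)) :
  dual_pair ev coev -> conjugate A.
Proof.
move=> [e1 e2].
have e1' : zigzag (star coev) (star ev) = idm A by rewrite -star_zagzig e1 star_idm.
have e2' : zigzag (star (star ev)) coev = idm B by rewrite starK.
exact: (Conjugate e1' e2').
Qed.

(** With the half braiding [dual_hb], the conjugate in C becomes a dual in the center. In
    [double_conjugates] it is moved to a unitary representative, where adjoints turn the duality
    into a conjugate. *)
Lemma center_dual (A : center_ob C) : exists (B : ob Z) (ev : hom (B ⊗ (A : ob Z)) unit_ob)
  (coev : hom unit_ob ((A : ob Z) ⊗ B)), dual_pair ev coev.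
Proof.
case: (hc (cob A)) => s; have dp := conjugate_dual s.
have he := hb_lax (cbr A); have ie := hbiK (cbr A); have ei := hbKi (cbr A).
pose i W := hbi (cbr A) W.
have lx : lax_hb (dual_hb (star (cjr s)) (cjrb s) i) := dual_lax dp he ie ei.
have iso W : is_iso (dual_hb (star (cjr s)) (cjrb s) i W).
  have [W' [ev [coev dW]]] := conjugates_dualizable hc W; exact: lax_iso lx _ _ _ _ dW.
pose B := CenterOb (mk_hb lx iso).
have evm : forall W, (idm W ⊠ star (cjr s)) ∘ cbr (center_tens B A) W
    = cbr (center_one C) W ∘ (star (cjr s) ⊠ idm W).
  apply: (@ev_center _ _ B A) => W l; rewrite compA /= (dual_ev_morphism dp).
  by rewrite -compA -tens_compr /i a22_hbiK tensm1 compf1.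
have coevm : forall W, (idm W ⊠ cjrb s) ∘ cbr (center_one C) W
    = cbr (center_tens A B) W ∘ (cjrb s ⊠ idm W).
  apply: (@coev_center _ _ A B) => W l; rewrite /= (dual_coev_morphism dp).
  by rewrite compA /i a22_hbKi comp1f.
exists B, (cmor (A := center_tens B A) (B := center_one C) evm),
  (cmor (A := center_one C) (B := center_tens A B) coevm).
by split; apply: cval_inj; rewrite ?zigzag_center ?zagzig_center; case: dp.
Qed.

Lemma double_conjugates : has_conjugates D.
Proof.
move=> A; have [B [ev [coev dp]]] := center_dual (sval A).
have [B' [f [g gf fg]]] := unitary_representative B.
have [e1 e2] := dual_pair_transport gf fg dp.
constructor; apply: (@dual_pair_conjugate A B' (ev ∘ (g ⊠ idm (sval A : ob Z)))
  ((idm (sval A : ob Z) ⊠ f) ∘ coev)).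
by split; rewrite ?zigzag_double ?zagzig_double.
Qed.

End UnitaryDouble.

(** * Orthogonality of matrix coefficients of half braidings *)

Section MatrixCoefficients.
Context {K : numClosedFieldType} {C : star_tcat K}.
Implicit Types X Y Z W T l : ob C.
Hypotheses (ho : has_orthogonal_sums C) (hs : idempotents_split C) (hc : has_conjugates C).
Hypothesis s1 : is_simple (unit_ob : ob C).
Variables (n : nat) (S : 'I_n -> ob C).
Hypothesis rS : simple_representatives S.
Variable cS : forall i, conjugate (S i).
Hypothesis nS : forall i, star (cjr (cS i)) ∘ cjr (cS i) = idm unit_ob.

Local Notation D := (unitary_double C).
Local Notation "'e[' A ]" := (cbr (sval A)) (at level 0).

Definition matcoef X (e : half_braiding X) T T' (p : hom T X) (q : hom X T') V :
    hom (T ⊗ V) (V ⊗ T') := (idm V ⊠ q) ∘ (e V ∘ (p ⊠ idm V)).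

Lemma matcoef_nat X (e : half_braiding X) T T' (p : hom T X) (q : hom X T') V W (f : hom V W) :
  matcoef e p q W ∘ (idm T ⊠ f) = (f ⊠ idm T') ∘ matcoef e p q V.
Proof.
rewrite /matcoef -!compA exch (reassoc _ (esym (hb_nat e f))) -!compA.
by rewrite (reassoc _ (esym (exch f q))) -!compA.
Qed.

(** The average of [u ∘ q], precomposed with [p], depends on [e] only through its matrix
    coefficients. Here they are replaced by an arbitrary family [xi], so that linear relations
    between coefficients can be inserted. *)
Definition pair_avg T T' X' (e' : half_braiding X') (u : hom T' X')
    (xi : forall i, hom (T ⊗ S i) (S i ⊗ T')) : hom (T ⊗ unit_ob) (X' ⊗ unit_ob) :=
  \sum_i X' ◁ a20 (star (cjrb (cS i))) unit_ob ∘ (a22 (hbi e' (S i)) _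
    ∘ (S i ◁ u ▷ _ ∘ (a22 (xi i) _ ∘ T ◁ a02 (cjrb (cS i)) unit_ob))).

Lemma pair_avg_matcoef T T' X X' (e : half_braiding X) (e' : half_braiding X')
    (p : hom T X) (q : hom X T') (u : hom T' X') :
  pair_avg e' u (fun i => matcoef e p q (S i)) = (avg cS e e' (u ∘ q) ∘ p) ▷ unit_ob.
Proof.
rewrite tens_compl avgE /avg_tail comp_suml; apply: eq_bigr => i _.
rewrite avg_atE tens_compl tens_compr -!compA -exch; congr (_ ∘ (_ ∘ (_ ∘ _))).
by rewrite /matcoef -!a22_comp !a22_tens tensm1 -!compA.
Qed.

Lemma pair_avg_sum T T' X' (e' : half_braiding X') (u : hom T' X') m
    (xi : 'I_m -> forall i, hom (T ⊗ S i) (S i ⊗ T')) (c : 'I_m -> K) :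
  pair_avg e' u (fun i => \sum_j c j *: xi j i) = \sum_j c j *: pair_avg e' u (xi j).
Proof.
rewrite /pair_avg; under [RHS]eq_bigr => j _ do rewrite scaler_sumr.
rewrite exchange_big; apply: eq_bigr => i _ /=.
rewrite (linear_sumE (@a22_linear _ _ _ _ _ _ _)) comp_suml !comp_sumr; apply: eq_bigr => j _.
by rewrite (linear_ZE (@a22_linear _ _ _ _ _ _ _)) compZl !compZr.
Qed.

Lemma pair_avg0 T T' X' (e' : half_braiding X') (u : hom T' X')
    (xi : forall i, hom (T ⊗ S i) (S i ⊗ T')) : (forall i, xi i = 0) -> pair_avg e' u xi = 0.
Proof.
move=> xi0; rewrite /pair_avg big1 // => i _.
by rewrite xi0 (linear_0E (@a22_linear _ _ _ _ _ _ _)) comp0l !comp0r.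
Qed.

Definition avg_hom (A B : ob D) (t : hom (cob (sval A)) (cob (sval B))) : @hom _ D A B :=
  cmor (avg_morphism ho hs hc rS nS e[A] e[B] t).

Lemma avg_orthogonal (A B : ob D) t : is_simple A -> is_simple B -> ~ isomorphic A B ->
  avg cS e[A] e[B] t = 0.
Proof.
move=> sA sB nAB; suff : avg_hom t = 0 by move/(congr1 (@cval _ _ _ _)).
apply: contrapT => t0; apply: nAB; exists (avg_hom t); exact: schur.
Qed.

Lemma avg_scalar (A : ob D) t : is_simple A ->
  exists a, avg cS e[A] e[A] t = a *: idm (cob (sval A)).
Proof.
by move=> [_ /(_ (avg_hom t)) [a /(congr1 (@cval _ _ _ _)) e]]; exists a.
Qed.

Lemma simple_cob_neq0 (A : ob D) : is_simple A -> idm (cob (sval A)) <> 0.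
Proof. by move=> [A0 _] e; apply: A0; apply: cval_inj. Qed.

Lemma avg_positive (A : ob D) T (w : hom (cob (sval A)) T) : is_simple A -> w <> 0 ->
  exists2 a, 0 < a & avg cS e[A] e[A] (star w ∘ w) = a *: idm (cob (sval A)).
Proof.
move=> sA w0; have [a aE] := avg_scalar (star w ∘ w) sA; exists a => //.
have he V : hbi e[A] V = star (e[A] V) by apply: unitary_hbi; exact: (svalP A).
move: (aE); rewrite (avg_square cS w he).
have [P [g [v [<- vg]]]] := sum_of_squares ho (half_avg cS e[A] w) => gg.
apply: (quotient_gt0 ho (c := idm (cob (sval A))) (g := g)).
- by rewrite star_idm comp1f gg.
- exact: simple_cob_neq0.
have [i _] := some_simple s1 rS => g0; apply: w0.
by apply: (half_avg_mono nS (e := e[A]) (i := i)); rewrite -vg g0 comp0r.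
Qed.

(** Pair the relation with [A k] and [star (w k)]: Schur's lemma kills the terms of the other
    objects, and the remaining average of [star (w k) ∘ w k] is a positive scalar. *)
Lemma matcoef_independent m (A : 'I_m -> ob D) T (w : forall j, hom (cob (sval (A j))) T)
    (c : 'I_m -> K) :
  (forall j, is_simple (A j)) -> (forall j k, isomorphic (A j) (A k) -> j = k) ->
  (forall j, w j <> 0) ->
  (forall i, \sum_j c j *: matcoef e[A j] (star (w j)) (w j) (S i) = 0) ->
  forall j, c j = 0.
Proof.
move=> sA iA w0 c0 k; have [a a0 aE] := avg_positive (sA k) (w0 k).
have := pair_avg0 e[A k] (star (w k)) c0; rewrite pair_avg_sum (bigD1 k) //= big1 ?addr0.
  rewrite pair_avg_matcoef aE compZl comp1f tensZl scalerA => /eqP.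
  rewrite scaler_eq0 mulf_eq0 (gt_eqF a0) orbF => /orP[/eqP //|/eqP e].
  by case: (w0 k); apply: star_eq0; apply: rwh_inj; rewrite e tens0l.
move=> j jk; rewrite pair_avg_matcoef avg_orthogonal // ?comp0l ?tens0l ?scaler0 //.
by move=> /iA jk'; rewrite jk' eqxx in jk.
Qed.

Lemma generator : exists G (v : forall i, hom (S i) G), (forall i, isometric (v i)) /\
  forall X, idm X <> 0 -> exists w : hom X G, w <> 0.
Proof.
have [G [v [v1 _ _]]] := ho S; exists G, v; split=> // X X0.
have [m [c [u [_ _ su]]]] := decomposition_reps ho hs rS X.
apply: contrapT => h; apply: X0; rewrite -su big1 // => k _.
suff -> : star (u k) = 0 by rewrite comp0r.
apply: contrapT => uk0; apply: h; exists (v (c k) ∘ star (u k)) => e; apply: uk0.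
by rewrite -[LHS]comp1f -(v1 (c k)) -compA e comp0r.
Qed.

(** Every simple object has a nonzero map to the generator [G], and the resulting coefficients at
    [V = G] lie in the endomorphisms of [G ⊗ G]. By naturality a relation at [G] restricts to its
    summands [S i], so a spanning set bounds the number of objects. *)
Lemma double_bounded_simples : exists N, forall m (A : 'I_m -> ob D),
  (forall j, is_simple (A j)) -> (forall j k, isomorphic (A j) (A k) -> j = k) -> (m <= N)%N.
Proof.
have [G [v [v1 hG]]] := generator; have [N [b span]] := hom_findim (G ⊗ G) (G ⊗ G).
exists N => m A sA iA; rewrite leqNgt; apply/negP => ltNm.
pose w j := sval (cid (hG _ (simple_cob_neq0 (sA j)))).
have w0 j : w j <> 0 := svalP (cid (hG _ (simple_cob_neq0 (sA j)))).
have [c [[j cj] c0]] := linear_dependence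
  (fun j => matcoef e[A j] (star (w j)) (w j) G) span ltNm.
have := matcoef_independent (c := c) sA iA w0 => /(_ _ j) h.
move: cj; rewrite h ?eqxx // => i.
have /(congr1 (fun f => (star (v i) ⊠ idm G) ∘ (f ∘ (idm G ⊠ v i)))) := c0.
rewrite comp0l comp0r comp_suml comp_sumr => e; rewrite -[RHS]e; apply: eq_bigr => k _.
rewrite compZl compZr; congr (_ *: _).
by rewrite matcoef_nat compA -tens_compl (v1 i) tensm1 comp1f.
Qed.

Lemma double_finite : finitely_many_simples D.
Proof.
pose Q m := `[< exists A : 'I_m -> ob D,
  (forall j, is_simple (A j)) /\ (forall j k, isomorphic (A j) (A k) -> j = k) >].
have Q0 : exists m, Q m.
  have [A _] : exists A : 'I_0 -> ob D, True by exists (fun=> unit_ob).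
  by exists 0%N; apply/asboolP; exists A; split; case.
have [N NP] := double_bounded_simples.
have Qb m : Q m -> (m <= N)%N by move=> /asboolP[A [sA iA]]; exact: NP sA iA.
case: (ex_maxnP Q0 Qb) => m /asboolP[A [sA iA]] mmax.
exists m, A; split=> // X sX; apply: contrapT => nX.
have : Q m.+1; last by move=> /mmax; rewrite ltnn.
have isoC (X1 X2 : ob D) : isomorphic X1 X2 -> isomorphic X2 X1.
  by move=> [f [g gf fg]]; exists g, f.
apply/asboolP; exists (fun i => if unlift ord0 i is Some j then A j else X); split.
  by move=> i; case: (unlift _ _).
move=> i j; case: (unliftP ord0 i) => [i' ->|->]; case: (unliftP ord0 j) => [j' ->|->] //.
- by move=> /iA ->.
- by move=> e; case: nX; exists i'; exact: isoC.
by move=> e; case: nX; exists j'.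
Qed.

End MatrixCoefficients.

(** * Standard solutions of the conjugate equations *)

Section Trace.
Context {K : numClosedFieldType} {C : star_tcat K}.
Implicit Types X Y Z l : ob C.

Definition trl X (s : conjugate X) (t : hom X X) : hom (unit_ob : ob C) unit_ob :=
  star (cjr s) ∘ (idm (cjob s) ⊠ t) ∘ cjr s.
Definition trr X (s : conjugate X) (t : hom X X) : hom (unit_ob : ob C) unit_ob :=
  star (cjrb s) ∘ (t ⊠ idm (cjob s)) ∘ cjrb s.

Lemma trl_tail X (s : conjugate X) t l :
  a20 (star (cjr s)) l ∘ (cjob s ◁ t ▷ l ∘ a02 (cjr s) l) = lu l ∘ (trl s t ▷ l ∘ lu' l).
Proof. by rewrite -a22_tens a22_02 a20_02 /trl -(compA (star _)). Qed.
Lemma trr_tail X (s : conjugate X) t l :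
  a20 (star (cjrb s)) l ∘ (t ▷ (cjob s ⊗ l) ∘ a02 (cjrb s) l) = lu l ∘ (trr s t ▷ l ∘ lu' l).
Proof. by rewrite -[idm (cjob s ⊗ l)]tensm1 -a22_tens a22_02 a20_02 /trr -(compA (star _)). Qed.

Lemma unit_tail_inj (f g : hom (unit_ob : ob C) unit_ob) :
  lu unit_ob ∘ (f ▷ unit_ob ∘ lu' unit_ob) = lu unit_ob ∘ (g ▷ unit_ob ∘ lu' unit_ob) -> f = g.
Proof. by move=> /eqh_mono /eqh_epi /rwh_inj. Qed.

Lemma trl_linear X (s : conjugate X) : linear (trl s).
Proof. by move=> a f g; rewrite /trl tens_lin_r comp_lin_r comp_lin_l. Qed.

Lemma trl_square X Y (s : conjugate X) (f : hom X Y) :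
  trl s (star f ∘ f) = star ((idm (cjob s) ⊠ f) ∘ cjr s) ∘ ((idm (cjob s) ⊠ f) ∘ cjr s).
Proof. by rewrite /trl star_comp star_lwh tens_compr -!compA. Qed.

Lemma cjr_faithful X Y (s : conjugate X) (f : hom X Y) : (idm (cjob s) ⊠ f) ∘ cjr s = 0 -> f = 0.
Proof.
move=> e; apply: rwh_inj; rewrite tens0l -[LHS]compf1.
rewrite -(dual_pairY (conjugate_dual' s) unit_ob) (reassoc _ (esym (a20_tail _ (f ▷ _)))).
rewrite -compA -tens_compr -a22_tens a22_02 e.
by rewrite a02E a12E tens0l comp0r comp0l tens0r comp0r.
Qed.

Lemma trl_faithful X Y (s : conjugate X) (f : hom X Y) : trl s (star f ∘ f) = 0 -> f = 0.
Proof. by rewrite trl_square => /star_positive /cjr_faithful. Qed.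

End Trace.

Section DualSum.
Context {K : fieldType} {C : tcat K}.
Variables (n : nat) (X Y : 'I_n -> ob C).
Variables (ev : forall k, hom (Y k ⊗ X k) unit_ob) (coev : forall k, hom unit_ob (X k ⊗ Y k)).
Variables (X' Y' : ob C) (a : forall k, hom (X k) X') (a' : forall k, hom X' (X k)).
Variables (b : forall k, hom (Y k) Y') (b' : forall k, hom Y' (Y k)).
Hypotheses (dp : forall k, dual_pair (ev k) (coev k)).
Hypotheses (a1 : forall k, a' k ∘ a k = idm _) (a0 : forall k j, k != j -> a' k ∘ a j = 0).
Hypotheses (b1 : forall k, b' k ∘ b k = idm _) (b0 : forall k j, k != j -> b' k ∘ b j = 0).
Hypotheses (aa : \sum_k a k ∘ a' k = idm X') (bb : \sum_k b k ∘ b' k = idm Y').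

Definition sum_ev : hom (Y' ⊗ X') unit_ob := \sum_k ev k ∘ (b' k ⊠ a' k).
Definition sum_coev : hom unit_ob (X' ⊗ Y') := \sum_k (a k ⊠ b k) ∘ coev k.

Lemma tens_split (A B l m : ob C) (f : hom A B) (u : hom l m) : f ⊠ u = f ▷ m ∘ A ◁ u.
Proof. by rewrite -tensm_comp comp1f compf1. Qed.

Lemma sum_ev_tail l : a20 sum_ev l = \sum_k a20 (ev k) l ∘ (b' k ⊠ (a' k ▷ l)).
Proof.
rewrite a20E a21E /sum_ev tens_suml comp_suml comp_sumr; apply: eq_bigr => k _.
by rewrite -a21E -a20E -a20_22 a22_tens.
Qed.
Lemma sum_coev_tail l : a02 sum_coev l = \sum_k (a k ⊠ (b k ▷ l)) ∘ a02 (coev k) l.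
Proof.
rewrite a02E a12E /sum_coev tens_suml comp_sumr comp_suml; apply: eq_bigr => k _.
by rewrite -a12E -a02E -a22_02 a22_tens.
Qed.

Lemma dual_pair_sum : dual_pair sum_ev sum_coev.
Proof.
split; apply: rwh_inj.
  rewrite zagzig_tail sum_ev_tail sum_coev_tail tens_sumr comp_suml -[in RHS]aa [in RHS]tens_suml.
  apply: eq_bigr => k _; rewrite comp_sumr (bigD1 k) //= big1 ?addr0 => [|j jk].
    rewrite tens_compr -!compA (compA (_ ◁ (b' k ⊠ _))) -tensm_comp comp1f -tensm_comp b1 compf1.
    rewrite (tens_split (a k)) -!compA -a02_tail.
    rewrite (compA (_ ◁ a20 _ _)) -exch -!compA (comp1K _ (dual_pairX (dp k) _)).
    by rewrite tens_compl.
  rewrite tens_compr -!compA (compA (_ ◁ (b' k ⊠ _))) -tensm_comp comp1f -tensm_comp.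
  by rewrite b0 1?eq_sym // tens0l tens0r comp0l comp0r.
rewrite zigzag_tail sum_ev_tail sum_coev_tail tens_sumr comp_suml -[in RHS]bb [in RHS]tens_suml.
apply: eq_bigr => k _; rewrite comp_sumr (bigD1 k) //= big1 ?addr0 => [|j jk].
  rewrite -!compA -tensm_comp compf1 (compA (a' k ▷ _)) -tensm_comp a1 comp1f.
  rewrite (tens_split (b' k)) exch tens_compr -!compA (compA (a20 _ _)) a20_tail -!compA.
  by rewrite (comp1K _ (dual_pairY (dp k) _)) tens_compl.
rewrite -!compA -tensm_comp compf1 (compA (a' k ▷ _)) -tensm_comp.
by rewrite a0 1?eq_sym // tens0l comp0l tens0r comp0r.
Qed.

End DualSum.

Section TensorDual.
Context {K : fieldType} {C : tcat K}.
Implicit Types X Y Z l : ob C.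

Definition tens_coev X Y X' Y' (cX : hom unit_ob (X ⊗ X')) (cY : hom unit_ob (Y ⊗ Y')) :
    hom unit_ob ((X ⊗ Y) ⊗ (Y' ⊗ X')) :=
  asc X Y (Y' ⊗ X') ∘ (idm X ⊠ (asc' Y Y' X' ∘ (cY ⊠ idm X') ∘ lu' X')) ∘ cX.
Definition tens_ev X Y X' Y' (eX : hom (X' ⊗ X) unit_ob) (eY : hom (Y' ⊗ Y) unit_ob) :
    hom ((Y' ⊗ X') ⊗ (X ⊗ Y)) unit_ob :=
  eY ∘ (idm Y' ⊠ (lu Y ∘ (eX ⊠ idm Y) ∘ asc X' X Y)) ∘ asc' Y' X' (X ⊗ Y).

Lemma tens_coev_tail X Y X' Y' (cX : hom unit_ob (X ⊗ X')) (cY : hom unit_ob (Y ⊗ Y')) l :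
  a02 (tens_coev cX cY) l = asc X Y ((Y' ⊗ X') ⊗ l)
    ∘ (X ◁ Y ◁ asc Y' X' l ∘ (X ◁ a02 cY (X' ⊗ l) ∘ a02 cX l)).
Proof.
rewrite /tens_coev !a02E !a12E !tens_compr !tens_compl -!compA.
rewrite /lu' /asc /asc' !eqh_tensr ?eqh_tensl ?eqh_tensr !eqh_compA.
apply/heq_eq/heq_cl/heq_mid; first exact: heq_cr (heq_refl _).
apply: heq_trans (heq_tensA' _ _ _) _; apply: heq_tens; [exact: heq_refl|exact: heq_rwh].
Qed.

Lemma tens_ev_tail X Y X' Y' (eX : hom (X' ⊗ X) unit_ob) (eY : hom (Y' ⊗ Y) unit_ob) l :
  a20 (tens_ev eX eY) l = a20 eY l ∘ (Y' ◁ a20 eX (Y ⊗ l)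
    ∘ (asc' Y' X' (X ⊗ (Y ⊗ l)) ∘ (Y' ⊗ X') ◁ asc' X Y l)).
Proof.
rewrite /tens_ev !a20E !a21E !tens_compr !tens_compl -!compA.
rewrite /lu /asc /asc' !eqh_tensr ?eqh_tensl ?eqh_tensr !eqh_comp !eqh_compA.
apply/heq_eq/heq_cl/heq_mid; last exact: heq_refl.
apply: heq_cr; apply: heq_trans (heq_tensA' _ _ _) _.
by apply: heq_tens; [exact: heq_refl|exact: heq_rwh].
Qed.

Lemma asc_whisk X Y l m (u : hom l m) : asc' X Y m ∘ ((X ⊗ Y) ◁ u ∘ asc X Y l) = X ◁ Y ◁ u.
Proof. by rewrite -asc_tail (comp1K _ (asc'K _ _ _)). Qed.

Lemma zagzig_tens X Y X' Y' (eX : hom (X' ⊗ X) unit_ob) (cX : hom unit_ob (X ⊗ X'))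
    (eY : hom (Y' ⊗ Y) unit_ob) (cY : hom unit_ob (Y ⊗ Y')) :
  dual_pair eX cX -> dual_pair eY cY ->
  zagzig (tens_ev eX eY) (tens_coev cX cY) = idm (X ⊗ Y).
Proof.
move=> dX dY; apply: rwh_inj; rewrite zagzig_tail tens_ev_tail tens_coev_tail tensm1.
set l := unit_ob; set m := (X ⊗ Y) ⊗ l.
set E := a20 eY l ∘ _; pose w := a20 eX (Y ⊗ l) ∘ X' ◁ asc' X Y l.
have hE : E ∘ asc Y' X' m = a20 eY l ∘ Y' ◁ w.
  by rewrite /E /w -!compA asc_whisk -tens_compr.
rewrite (compA ((X ⊗ Y) ◁ E)) -asc_tail -compA (compA (X ◁ Y ◁ E)) -!tens_compr hE.
rewrite tens_compr (compA (X ◁ _)) -tens_compr -compA -a02_tail.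
rewrite (comp1K _ (dual_pairX dY _)) /w tens_compr -compA -a02_tail.
by rewrite (comp1K _ (dual_pairX dX _)) ascK.
Qed.

Lemma trace_tens_l X Y X' Y' (eX : hom (X' ⊗ X) unit_ob) (cX : hom unit_ob (X' ⊗ X))
    (eY : hom (Y' ⊗ Y) unit_ob) (cY : hom unit_ob (Y' ⊗ Y)) (t : hom (X ⊗ Y) (X ⊗ Y)) l :
  a20 (tens_ev eX eY) l ∘ ((Y' ⊗ X') ◁ t ▷ l ∘ a02 (tens_coev cY cX) l)
    = a20 eY l ∘ (Y' ◁ (a20 eX (Y ⊗ l) ∘ (X' ◁ a22 t l ∘ a02 cX (Y ⊗ l))) ∘ a02 cY l).
Proof.
rewrite tens_ev_tail tens_coev_tail -!compA; congr (_ ∘ _).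
rewrite [in RHS]tens_compr -compA; congr (_ ∘ _).
rewrite (compA ((Y' ⊗ X') ◁ t ▷ l)) -asc_tail -!compA (compA ((Y' ⊗ X') ◁ asc' _ _ _)) -asc_tail.
by rewrite -!compA (comp1K _ (asc'K _ _ _)) a22E !tens_compr -!compA.
Qed.

Lemma trace_tens_r X Y X' Y' (eX : hom (X ⊗ X') unit_ob) (cX : hom unit_ob (X ⊗ X'))
    (eY : hom (Y ⊗ Y') unit_ob) (cY : hom unit_ob (Y ⊗ Y')) (t : hom (X ⊗ Y) (X ⊗ Y)) l :
  a20 (tens_ev eY eX) l ∘ (t ▷ ((Y' ⊗ X') ⊗ l) ∘ a02 (tens_coev cX cY) l)
    = a20 eX l ∘ (X ◁ a20 eY (X' ⊗ l) ∘ (a22 t (Y' ⊗ (X' ⊗ l)) ∘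
        (X ◁ a02 cY (X' ⊗ l) ∘ a02 cX l))).
Proof.
rewrite tens_ev_tail tens_coev_tail -!compA; congr (_ ∘ (_ ∘ _)).
rewrite (compA ((X ⊗ Y) ◁ _)) -exch -!compA (compA ((X ⊗ Y) ◁ _)) -asc_tail -!compA.
rewrite (compA (X ◁ Y ◁ asc' _ _ _)) -!tens_compr asc'K !tensm1 comp1f.
by rewrite a22E -!compA.
Qed.
End TensorDual.

Section Standard.
Context {K : numClosedFieldType} {C : star_tcat K}.
Implicit Types X Y Z l : ob C.
Hypotheses (ho : has_orthogonal_sums C) (hs : idempotents_split C) (hc : has_conjugates C).
Hypothesis s1 : is_simple (unit_ob : ob C).
Variables (n : nat) (S : 'I_n -> ob C).
Hypothesis rS : simple_representatives S.

Lemma balanced_conjugate X : idm X <> 0 ->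
  exists s : conjugate X, star (cjr s) ∘ cjr s = star (cjrb s) ∘ cjrb s.
Proof.
move=> X0; case: (hc X) => s.
have a0 := coef_sq_gt0 ho s1 (cjr_neq0 (s := s) X0).
have b0 := coef_sq_gt0 ho s1 (cjrb_neq0 (s := s) X0).
set a := coef _ in a0; set b := coef _ in b0.
have t0 : 0 < sqrtC (b / a) by rewrite sqrtC_gt0 divr_gt0.
(* Scaling multiplies one norm by the square of the constant and the other by the inverse of that
   square; the fourth root of [b / a] makes both equal to the geometric mean of [a] and [b]. *)
have [||s' [e e']] := scale_conjugate s (a := sqrtC (sqrtC (b / a))).
- by rewrite sqrtC_eq0 gt_eqF.
- by rewrite geC0_conj // sqrtC_ge0 ltW.
exists s'; rewrite e e' (coef_idm (star (cjr s) ∘ _) s1) (coef_idm (star (cjrb s) ∘ _) s1).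
rewrite -/a -/b !scalerA sqrtCK; congr (_ *: _); apply: (mulfI (lt0r_neq0 t0)).
by rewrite mulrA -expr2 sqrtCK divfK ?gt_eqF // mulrA mulfV ?mul1r // gt_eqF.
Qed.

Lemma rep_neq0 i : idm (S i) <> 0. Proof. by case: rS => h _ _; case: (h i). Qed.
Definition bS i : conjugate (S i) := sval (cid (balanced_conjugate (@rep_neq0 i))).
Lemma bSP i : star (cjr (bS i)) ∘ cjr (bS i) = star (cjrb (bS i)) ∘ cjrb (bS i).
Proof. exact: svalP (cid (balanced_conjugate (@rep_neq0 i))). Qed.
Definition dimS i := coef (star (cjr (bS i)) ∘ cjr (bS i)).

Definition orthogonal_decomposition X m (c : 'I_m -> 'I_n) (u : forall k, hom (S (c k)) X) :=
  [/\ forall k, isometric (u k), forall k j, k != j -> star (u k) ∘ u j = 0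
    & \sum_k u k ∘ star (u k) = idm X].

Definition tr0 X m (c : 'I_m -> 'I_n) (u : forall k, hom (S (c k)) X) (t : hom X X) : K :=
  \sum_k coef (star (u k) ∘ (t ∘ u k)) * dimS (c k).

Lemma rep_simple i : is_simple (S i). Proof. by case: rS. Qed.

(** The solution is the orthogonal sum of balanced solutions for the simple summands; being balanced
    makes the two traces agree summand by summand. *)
Lemma explicit_standard X m (c : 'I_m -> 'I_n) (u : forall k, hom (S (c k)) X) :
  orthogonal_decomposition u -> exists s : conjugate X,
  forall t, trl s t = tr0 u t *: idm _ /\ trr s t = tr0 u t *: idm _.
Proof.
move=> [iu ou su]; have [X' [v [v1 v0 vs]]] := ho (fun k => cjob (bS (c k))).
pose rb := sum_coev (fun k => cjrb (bS (c k))) u v.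
pose r := sum_coev (fun k => cjr (bS (c k))) v u.
have dp : dual_pair (sum_ev (fun k => star (cjr (bS (c k)))) (fun k => star (u k)) (fun k => star (v k))) rb.
  by apply: dual_pair_sum => // k; exact: conjugate_dual.
have sr : star r = sum_ev (fun k => star (cjr (bS (c k)))) (fun k => star (u k)) (fun k => star (v k)).
  by rewrite /r /sum_coev /sum_ev star_sum; apply: eq_bigr => k _; rewrite star_comp star_tens.
have srb : star rb = sum_ev (fun k => star (cjrb (bS (c k)))) (fun k => star (v k)) (fun k => star (u k)).
  by rewrite /rb /sum_coev /sum_ev star_sum; apply: eq_bigr => k _; rewrite star_comp star_tens.
rewrite -sr in dp; have [e1 e2] := dp.
have e1' : zigzag (star rb) r = idm X by rewrite -[r]starK -star_zagzig e1 star_idm.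
exists (Conjugate e1' e2) => t; split; rewrite /trl /trr /= -/r -/rb.
  rewrite sr /sum_ev /r /sum_coev comp_suml comp_sumr scaler_suml; apply: eq_bigr => k _.
  rewrite comp_suml (bigD1 k) //= big1 ?addr0 => [|j jk].
    rewrite -!compA (compA (idm X' ⊠ t)) -tensm_comp comp1f (compA (_ ⊠ _)) -tensm_comp v1.
    rewrite {1}(coef_idm (star (u k) ∘ (t ∘ u k)) (rep_simple _)) tensZr tensm1 compZl comp1f.
    by rewrite compZr {1}(coef_idm (star _ ∘ _) s1) scalerA.
  rewrite -!compA (compA (idm X' ⊠ t)) -tensm_comp comp1f (compA (_ ⊠ _)) -tensm_comp.
  by rewrite v0 // tens0l comp0l comp0r.
rewrite srb /sum_ev /rb /sum_coev comp_suml comp_sumr scaler_suml; apply: eq_bigr => k _.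
rewrite comp_suml (bigD1 k) //= big1 ?addr0 => [|j jk].
  rewrite -!compA (compA (t ⊠ idm X')) -tensm_comp comp1f (compA (_ ⊠ _)) -tensm_comp v1.
  rewrite {1}(coef_idm (star (u k) ∘ (t ∘ u k)) (rep_simple _)) tensZl tensm1 compZl comp1f.
  by rewrite compZr -bSP {1}(coef_idm (star _ ∘ _) s1) scalerA.
rewrite -!compA (compA (t ⊠ idm X')) -tensm_comp comp1f (compA (_ ⊠ _)) -tensm_comp.
by rewrite v0 // tens0r comp0l comp0r.
Qed.

(** Inserting the decomposition of the other object writes both sides as double sums. Terms with
    different types vanish by Schur's lemma, and for equal types the coefficients commute and the
    dimensions agree. *)
Lemma tr0_cyclic X Y m (c : 'I_m -> 'I_n) (u : forall k, hom (S (c k)) X)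
    m' (c' : 'I_m' -> 'I_n) (u' : forall k, hom (S (c' k)) Y) (f : hom X Y) (g : hom Y X) :
  orthogonal_decomposition u -> orthogonal_decomposition u' ->
  tr0 u (g ∘ f) = tr0 u' (f ∘ g).
Proof.
have half Z W p (a : 'I_p -> 'I_n) (v : forall k, hom (S (a k)) Z) p' (a' : 'I_p' -> 'I_n)
    (v' : forall k, hom (S (a' k)) W) (h : hom Z W) (h' : hom W Z) :
  orthogonal_decomposition v' -> tr0 v (h' ∘ h) = \sum_k \sum_j
    coef ((star (v k) ∘ (h' ∘ v' j)) ∘ (star (v' j) ∘ (h ∘ v k))) * dimS (a k).
  move=> [_ _ sv]; apply: eq_bigr => k _; rewrite -mulr_suml; congr (_ * _).
  rewrite -(linear_sumE (coef_linear (rep_simple _))); congr coef.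
  rewrite -[h in LHS]comp1f -sv !(comp_suml, comp_sumr); apply: eq_bigr => j _.
  by rewrite -!compA.
move=> du du'; rewrite (half _ _ _ _ u _ _ u' _ _ du') (half _ _ _ _ u' _ _ u _ _ du) exchange_big.
apply: eq_bigr => j _; apply: eq_bigr => k _.
rewrite coef_comm; try exact: rep_simple.
case: (pselect (c k = c' j)) => [e|ne]; first by congr (_ * dimS _).
have ne' : c' j != c k by apply/eqP => /esym.
rewrite ((reps_disjoint rS).2 _ _ ne' (star (u k) ∘ (g ∘ u' j))) comp0r.
by rewrite (coef_zero (rep_simple _)) !mul0r.
Qed.

Lemma ev_inj X Y (ev : hom (Y ⊗ X) unit_ob) (coev : hom unit_ob (X ⊗ Y)) (h : hom Y Y) :
  dual_pair ev coev -> (forall l, a20 ev l ∘ h ▷ (X ⊗ l) = a20 ev l) -> h = idm Y.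
Proof.
move=> dp e; apply: rwh_inj; rewrite tensm1.
transitivity (a20 ev (Y ⊗ unit_ob) ∘ (Y ◁ a02 coev unit_ob ∘ h ▷ unit_ob)).
  by rewrite compA (dual_pairY dp) comp1f.
by rewrite -exch compA e (dual_pairY dp).
Qed.

(** Compared with the explicit solution, an arbitrary one changes the left trace by an invertible
    [k] and the right trace by its inverse. When both are standard, [k] equals its inverse, and
    positivity then leaves only the identity. *)
Lemma standard_trace X m (c : 'I_m -> 'I_n) (u : forall k, hom (S (c k)) X) (s : conjugate X) :
  orthogonal_decomposition u -> is_standard s -> forall t, trl s t = tr0 u t *: idm _.
Proof.
move=> du ss; have [s0 s0P] := explicit_standard du.
have dL := conjugate_dual s; have dR := conjugate_dual' s.
have dL0 := conjugate_dual s0; have dR0 := conjugate_dual' s0.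
(* [a] carries the cup [r] of the explicit solution to that of [s], and [b] does the same for [rb];
   the adjoint of each is the inverse of the other. *)
pose a : hom (cjob s0) (cjob s) := comate (star (cjrb s0)) (cjr s) (idm X).
pose b : hom (cjob s0) (cjob s) := mate (cjrb s) (star (cjr s0)) (idm X).
have ra l : a ▷ (X ⊗ l) ∘ a02 (cjr s0) l = a02 (cjr s) l.
  by rewrite (comate_coev _ dR0) !tensm1 comp1f.
have ra' l : a20 (star (cjr s0)) l ∘ star a ▷ (X ⊗ l) = a20 (star (cjr s)) l.
  by rewrite -!star_a02 -star_rwh -star_comp ra.
have rb l : X ◁ b ▷ l ∘ a02 (cjrb s0) l = a02 (cjrb s) l.
  by rewrite (mate_coev _ dL0) !tensm1 comp1f.
have rb' l : a20 (star (cjrb s0)) l ∘ X ◁ star b ▷ l = a20 (star (cjrb s)) l.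
  by rewrite -!star_a02 -star_rwh -star_lwh -star_comp rb.
have be l : a20 (star (cjr s)) l ∘ b ▷ (X ⊗ l) = a20 (star (cjr s0)) l.
  by rewrite (mate_ev _ dL) !tensm1 compf1.
have ab : star a ∘ b = idm _.
  by apply: (ev_inj dL0) => l; rewrite tens_compl compA ra' be.
have ba : b ∘ star a = idm _.
  by apply: (ev_inj dL) => l; rewrite tens_compl compA be ra'.
have ab' : a ∘ star b = idm _ by rewrite -[a]starK -star_comp ba star_idm.
have ba' : star b ∘ a = idm _ by rewrite -[a]starK -star_comp ab star_idm.
pose q := star a ∘ a; pose q' := star b ∘ b.
pose M := mate (cjr s0) (star (cjrb s0)); pose k := M q; pose k' := M q'.
have kk' : k' ∘ k = idm X.
  rewrite /k /k' /M -(mate_comp _ _ dR0) /q /q' -compA (compA a) ab' comp1f ab.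
  exact: mate_id.
have k'k : k ∘ k' = idm X.
  rewrite /k /k' /M -(mate_comp _ _ dR0) /q /q' -compA (compA b) ba comp1f ba'.
  exact: mate_id.
have trlE t : trl s t = trl s0 (t ∘ k).
  apply: unit_tail_inj; rewrite -!trl_tail -ra -ra' -compA (compA (star a ▷ _)) exch -!compA.
  rewrite (compA (star a ▷ _)) -tens_compl -/q -(mate_coev _ dR0) -/M -/k.
  by rewrite tens_compl tens_compr -compA.
have trrE t : trr s t = trr s0 (k' ∘ t).
  apply: unit_tail_inj; rewrite -!trr_tail -rb -rb' -compA (compA (t ▷ _)) exch -!compA.
  rewrite (compA (X ◁ star b ▷ _)) -tens_compr -tens_compl -/q' tens_compl -compA.
  by rewrite [RHS]compA /k' /M (mate_ev _ dR0) -compA.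
have one0 := proj1 s1.
have trE t : tr0 u (t ∘ k) = tr0 u (t ∘ k').
  rewrite (tr0_cyclic k' t du du); apply: (scale_idm_inj one0).
  by rewrite -(proj1 (s0P _)) -(proj2 (s0P _)) -trlE -trrE; exact: ss.
have keq : k = k'.
  apply/eqP; rewrite -subr_eq0; apply/eqP; apply: (@trl_faithful _ _ _ _ s0).
  rewrite compBr (linear_BE (@trl_linear _ _ _ s0)).
  by rewrite !(proj1 (s0P _)) trE subrr.
have kk : k ∘ k = idm X by rewrite {2}keq.
have k1 : k = idm X.
  (* As [k] is an involution, [k ∘ d = - d], so the traces of [d ∘ star d] for the two solutions are
     opposite. Both are squares, hence zero. *)
  apply/eqP; rewrite -subr_eq0; apply/eqP/star_eq0; set d := k - idm X.
  have kd : k ∘ d = - d by rewrite /d compBr kk compf1 opprB.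
  have e : trl s (d ∘ star d) + trl s0 (d ∘ star d) = 0.
    rewrite trlE (proj1 (s0P _)) (tr0_cyclic k _ du du) compA kd compNl -(proj1 (s0P _)).
    by rewrite (linear_NE (@trl_linear _ _ _ s0)) addNr.
  rewrite -{1 3}[d]starK !trl_square in e.
  have [_ e0] := two_squares_eq0 ho e; exact: cjr_faithful e0.
by move=> t; rewrite trlE k1 compf1 (proj1 (s0P _)).
Qed.

Lemma standard_exists X : exists s : conjugate X, is_standard s.
Proof.
have [m [c [u du]]] := decomposition_reps ho hs rS X.
have [s sP] := explicit_standard du; exists s => t.
by have [e1 e2] := sP t; rewrite -/(trl s t) e1 -e2.
Qed.

Lemma standard_cyclic X Y (s : conjugate X) (s' : conjugate Y) (f : hom X Y) (g : hom Y X) :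
  is_standard s -> is_standard s' -> trl s' (f ∘ g) = trl s (g ∘ f).
Proof.
move=> ss ss'; have [m [c [u du]]] := decomposition_reps ho hs rS X.
have [m' [c' [u' du']]] := decomposition_reps ho hs rS Y.
by rewrite (standard_trace du ss) (standard_trace du' ss') (tr0_cyclic f g du du').
Qed.

(** Let [d] be the difference of the two transposes and [g] the morphism with transpose [star d].
    The square of [d] applied to the cup is the difference of the traces of [f ∘ g] and [g ∘ f],
    which is zero by cyclicity. *)
Lemma standard_transpose X Y (s : conjugate X) (s' : conjugate Y) (f : hom X Y) :
  is_standard s -> is_standard s' ->
  mate (cjrb s) (star (cjr s')) f = comate (star (cjrb s')) (cjr s) f.
Proof.
move=> ss ss'; have dL := conjugate_dual s; have dR := conjugate_dual' s.
have dL' := conjugate_dual s'; have dR' := conjugate_dual' s'.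
set fL := mate _ _ f; set fR := comate _ _ f; pose d := fL - fR.
pose g : hom Y X := comate (star (cjr s')) (cjrb s) (star d).
have gE : mate (cjrb s') (star (cjr s)) g = star d by exact: comateK.
have eL l : a20 (star (cjr s')) l ∘ ((star d ∘ fL) ▷ (Y ⊗ l) ∘ a02 (cjr s') l)
    = lu l ∘ (trl s' (f ∘ g) ▷ l ∘ lu' l).
  by rewrite -trl_tail -gE -(mate_comp _ _ dL) compA (mate_ev _ dL') -compA.
have eR l : a20 (star (cjr s')) l ∘ ((star d ∘ fR) ▷ (Y ⊗ l) ∘ a02 (cjr s') l)
    = lu l ∘ (trl s (g ∘ f) ▷ l ∘ lu' l).
  rewrite -trl_tail tens_compl -compA (comate_coev _ dR') -gE compA (mate_ev _ dL').
  by rewrite -compA tens_compl tens_compr -compA.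
have d0 l : d ▷ (Y ⊗ l) ∘ a02 (cjr s') l = 0.
  apply: star_positive; rewrite star_comp star_a02 star_rwh -compA (compA (star d ▷ _)).
  rewrite -tens_compl {2}/d compBr (linear_BE (tensm_linear_l _)) compBl compBr eL eR.
  by rewrite (standard_cyclic f g ss ss') subrr.
apply/eqP; rewrite -subr_eq0 -/d; apply/eqP/rwh_inj; rewrite tens0l -[LHS]compf1.
rewrite -(dual_pairX dR' unit_ob) compA exch -compA d0 comp0r //.
Qed.

Definition dual_of X (s : conjugate X) : two_sided_dual X :=
  TwoSidedDual (cjrb s) (star (cjr s)) (cjr s) (star (cjrb s)).

Lemma dual_of_two_sided X (s : conjugate X) : is_two_sided_dual (dual_of s).
Proof.
by have [e1 e2] := conjugate_dual s; have [e3 e4] := conjugate_dual' s; split.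
Qed.

Lemma dual_of_traceL X (s : conjugate X) t : traceL (dual_of s) t = trl s t.
Proof. by []. Qed.

Lemma transposeL_mate X Y (s : conjugate X) (s' : conjugate Y) (f : hom X Y) :
  transposeL (dual_of s) (dual_of s') f = mate (cjrb s) (star (cjr s')) f.
Proof.
apply: rwh_inj; rewrite mateE /transposeL bend_right_tail /=.
by rewrite -a20_22 a22_tens -compA.
Qed.

Lemma transposeR_comate X Y (s : conjugate X) (s' : conjugate Y) (f : hom X Y) :
  transposeR (dual_of s) (dual_of s') f = comate (star (cjrb s')) (cjr s) f.
Proof.
apply: rwh_inj; rewrite comateE /transposeR bend_left_tail /=.
by rewrite -a20_22 a22_tens tensm1 tens_compr -compA.
Qed.

Lemma transpose_standard X Y (s : conjugate X) (s' : conjugate Y) (f : hom X Y) :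
  is_standard s -> is_standard s' ->
  transposeL (dual_of s) (dual_of s') f = transposeR (dual_of s) (dual_of s') f.
Proof. by move=> ss ss'; rewrite transposeL_mate transposeR_comate standard_transpose. Qed.

Lemma standard_one : exists s : conjugate (unit_ob : ob C),
  is_standard s /\ dual_of s = dual_one.
Proof.
have l1 : star (lu' (unit_ob : ob C)) = lu unit_ob by rewrite /lu' star_eqh; exact: eqh_irr.
have e1 : zigzag (star (lu' unit_ob)) (lu' (unit_ob : ob C)) = idm unit_ob.
  rewrite l1 /zigzag /lu /lu' /asc /ru' eqh_tensl eqh_tensr !eqh_comp; exact: eqh1.
exists (Conjugate e1 e1); split; last by rewrite /dual_of /= l1.
move=> t /=; congr (_ ∘ _ ∘ _).
have [a ->] : exists a, t = a *: idm _ by case: s1.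
by rewrite tensZl tensZr.
Qed.

(** The left trace over [X ⊗ Y] closes X first, the right trace closes Y first. Standardness of [s']
    for the partial trace [pl] and of [s] for [pr] turns one nested diagram into the other. *)
Lemma standard_tens X Y (s : conjugate X) (s' : conjugate Y) :
  is_standard s -> is_standard s' -> exists s'' : conjugate (X ⊗ Y),
  is_standard s'' /\ dual_of s'' = dual_tens (dual_of s) (dual_of s').
Proof.
move=> ss ss'; have dL := conjugate_dual s; have dR := conjugate_dual' s.
have dL' := conjugate_dual s'; have dR' := conjugate_dual' s'.
pose r := tens_coev (cjr s') (cjr s); pose rb := tens_coev (cjrb s) (cjrb s').
have st U V U' V' (c : hom (unit_ob : ob C) (U ⊗ U')) (c' : hom (unit_ob : ob C) (V ⊗ V')) :
    star (tens_coev c c') = tens_ev (star c') (star c).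
  rewrite /tens_coev /tens_ev !star_comp !star_tens !star_comp !star_tens !star_idm !star_eqh -!compA.
  rewrite /lu /asc /asc' (eqh_irr (esym (esym _)) (tens1o U')).
  by rewrite (eqh_irr (esym (esym (tensA _ _ _))) (tensA V V' U')).
have srE : star r = tens_ev (star (cjr s)) (star (cjr s')) by exact: st.
have srbE : star rb = tens_ev (star (cjrb s')) (star (cjrb s)) by exact: st.
have e1 : zigzag (star rb) r = idm (X ⊗ Y).
  by rewrite -[r]starK -star_zagzig srE zagzig_tens // star_idm.
have e2 : zigzag (star r) rb = idm _.
  by rewrite -[rb]starK -star_zagzig srbE zagzig_tens // star_idm.
exists (Conjugate e1 e2); split; last by rewrite /dual_of /= srE srbE.
move=> t; rewrite -/(trl _ t) -/(trr _ t); apply: unit_tail_inj; rewrite -trl_tail -trr_tail /=.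
rewrite srE srbE trace_tens_l trace_tens_r; set l := unit_ob.
pose pl := m11 (fun l => a20 (star (cjr s)) (Y ⊗ l) ∘ (cjob s ◁ a22 t l ∘ a02 (cjr s) (Y ⊗ l))).
have plE m : pl ▷ m = a20 (star (cjr s)) (Y ⊗ m) ∘ (cjob s ◁ a22 t m ∘ a02 (cjr s) (Y ⊗ m)).
  by apply: m11E; tailmod_tac.
pose pr := m11 (fun l => X ◁ a20 (star (cjrb s')) l ∘ (a22 t (cjob s' ⊗ l) ∘ X ◁ a02 (cjrb s') l)).
have prE m : pr ▷ m = X ◁ a20 (star (cjrb s')) m ∘ (a22 t (cjob s' ⊗ m) ∘ X ◁ a02 (cjrb s') m).
  by apply: m11E; tailmod_tac.
have ssE : trl s pr = trr s pr by exact: ss.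
have ssE' : trl s' pl = trr s' pl by exact: ss'.
rewrite -plE trl_tail ssE' -trr_tail plE.
rewrite (compA (a22 t _)) (compA (X ◁ a20 _ _) _ (a02 _ _)) -prE trr_tail -ssE -trl_tail prE.
rewrite -!compA a02_tail (reassoc _ (esym (a20_tail _ (a20 (star (cjrb s')) l)))) -!compA.
by rewrite !tens_compr -!compA.
Qed.

End Standard.

(** * Induction to the center *)

Section Induction.
Context {K : numClosedFieldType} {C : star_tcat K}.
Implicit Types X Y Z W V T l m : ob C.
Hypotheses (ho : has_orthogonal_sums C) (hs : idempotents_split C) (hc : has_conjugates C).
Variables (n : nat) (S : 'I_n -> ob C).
Hypothesis rS : simple_representatives S.
Variable cS : forall i, conjugate (S i).

Local Notation Sb i := (cjob (cS i)).
Local Notation vec W i k := (fvec (f := fr ho hs rS W) i k).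

(** Expanded in both frames, each side is the same double sum over the coefficients of [g]: the
    canonical element given by a frame is natural and independent of choices. *)
Lemma frame_nat W W' (g : hom W W') i (U : lmodType K) (F : hom (S i) W' -> hom W (S i) -> U) :
  (forall v, linear (F^~ v)) -> (forall u, linear (F u)) ->
  \sum_k F (g ∘ vec W i k) (star (vec W i k)) = \sum_k F (vec W' i k) (star (vec W' i k) ∘ g).
Proof.
move=> Fl Fr.
transitivity (\sum_k \sum_j coef (star (vec W' i j) ∘ (g ∘ vec W i k)) *: F (vec W' i j) (star (vec W i k))).
  apply: eq_bigr => k _; rewrite {1}(expand_from (disjoint_reps rS) (frameP (fr ho hs rS W')) (g ∘ _)).
  rewrite (linear_sumE (Fl _)); apply: eq_bigr => j _; exact: (linear_ZE (Fl _)).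
rewrite exchange_big; apply: eq_bigr => j _.
rewrite {1}(expand_to (disjoint_reps rS) (frameP (fr ho hs rS W)) (star (vec W' i j) ∘ g)).
rewrite (linear_sumE (Fr _)); apply: eq_bigr => k _.
by rewrite (linear_ZE (Fr _)) compA.
Qed.

Variable V : ob C.
Variables (I : ob C) (v : forall i, hom (S i ⊗ (V ⊗ Sb i)) I).
Hypotheses (v1 : forall i, star (v i) ∘ v i = idm _)
  (v0 : forall i j, i != j -> star (v i) ∘ v j = 0) (vs : \sum_i v i ∘ star (v i) = idm I).

Local Notation F i l := (S i ⊗ (V ⊗ (Sb i ⊗ l))).

Definition inj i l : hom (F i l) (I ⊗ l) :=
  locked_with tail_key (v i ▷ l ∘ (asc (S i) (V ⊗ Sb i) l ∘ S i ◁ asc V (Sb i) l)).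
Definition prj i l : hom (I ⊗ l) (F i l) :=
  locked_with tail_key (S i ◁ asc' V (Sb i) l ∘ (asc' (S i) (V ⊗ Sb i) l ∘ star (v i) ▷ l)).
Lemma injE i l : inj i l = v i ▷ l ∘ (asc (S i) (V ⊗ Sb i) l ∘ S i ◁ asc V (Sb i) l).
Proof. by rewrite /inj locked_withE. Qed.
Lemma prjE i l : prj i l = S i ◁ asc' V (Sb i) l ∘ (asc' (S i) (V ⊗ Sb i) l ∘ star (v i) ▷ l).
Proof. by rewrite /prj locked_withE. Qed.

Lemma prj_inj i l : prj i l ∘ inj i l = idm _.
Proof.
rewrite prjE injE -!compA (compA (star (v i) ▷ l)) -tens_compl v1 tensm1 comp1f.
by rewrite (comp1K _ (asc'K _ _ _)) -tens_compr asc'K tensm1.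
Qed.
Lemma prj_inj0 i j l : i != j -> prj i l ∘ inj j l = 0.
Proof.
move=> ij; rewrite prjE injE -!compA (compA (star (v i) ▷ l)) -tens_compl v0 //.
by rewrite tens0l comp0l !comp0r.
Qed.
Lemma inj_prj l : \sum_i inj i l ∘ prj i l = idm (I ⊗ l).
Proof.
rewrite -tensm1 -vs tens_suml; apply: eq_bigr => i _; rewrite prjE injE -!compA tens_compl.
rewrite (compA (S i ◁ asc V _ _)) -tens_compr ascK tensm1 comp1f.
by rewrite (comp1K _ (ascK _ _ _)).
Qed.

Lemma inj_tail i l m (u : hom l m) : inj i m ∘ S i ◁ V ◁ Sb i ◁ u = I ◁ u ∘ inj i l.
Proof.
rewrite !injE -!compA -tens_compr asc_tail tens_compr (compA (asc _ _ _)) asc_tail.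
by rewrite !compA exch.
Qed.
Lemma prj_tail i l m (u : hom l m) : prj i m ∘ I ◁ u = S i ◁ V ◁ Sb i ◁ u ∘ prj i l.
Proof.
rewrite !prjE -!compA exch (reassoc _ (asc'_tail _ _ u)) -!compA (compA (S i ◁ _)) -tens_compr.
by rewrite asc'_tail tens_compr -!compA.
Qed.

Lemma tailmod_inj i : tailmod (inj i).
Proof.
apply: tailmod_ext (injE i) _; apply: tailmod_comp (@tailmod_rwh _ _ _ _ _).
by apply: tailmod_comp (@tailmod_asc _ _ _ _); apply: tailmod_whisk; exact: tailmod_asc.
Qed.
Lemma tailmod_prj i : tailmod (prj i).
Proof.
apply: tailmod_ext (prjE i) _; apply: tailmod_comp (tailmod_whisk _ (@tailmod_asc' _ _ _ _)).
by apply: tailmod_comp (@tailmod_rwh _ _ _ _ _) (@tailmod_asc' _ _ _ _).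
Qed.

(** The vertex [x] splits Z off the left leg [S i], and the bent [t] absorbs Y into the right leg
    [Sb i]. Y and Z agree in [ind_sum] but are kept apart here, so that naturality can be applied to
    one leg at a time. *)
Definition ind_block Y Z i j (x : hom (S i) (Z ⊗ S j)) (t : hom (Y ⊗ S j) (S i)) l :
    hom (F i (Y ⊗ l)) (Z ⊗ F j l) :=
  locked_with tail_key (a12 x (V ⊗ (Sb j ⊗ l)) ∘ S i ◁ V ◁ a21 (unbend' cS t) l).
Lemma ind_blockE Y Z i j (x : hom (S i) (Z ⊗ S j)) (t : hom (Y ⊗ S j) (S i)) l :
  ind_block x t l = a12 x (V ⊗ (Sb j ⊗ l)) ∘ S i ◁ V ◁ a21 (unbend' cS t) l.
Proof. by rewrite /ind_block locked_withE. Qed.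

Lemma unbend'_linear Y i j l : linear (fun t : hom (Y ⊗ S j) (S i) => a21 (unbend' cS t) l).
Proof.
by move=> a t t'; rewrite !unbend'E /bendl' a21_linear comp_lin_l tens_lin_r comp_lin_r.
Qed.
Lemma ind_block_linearl Y Z i j (t : hom (Y ⊗ S j) (S i)) l :
  linear (fun x : hom (S i) (Z ⊗ S j) => ind_block x t l).
Proof. by move=> a x x'; rewrite !ind_blockE a12_linear comp_lin_l. Qed.
Lemma ind_block_linearr Y Z i j (x : hom (S i) (Z ⊗ S j)) l :
  linear (fun t : hom (Y ⊗ S j) (S i) => ind_block x t l).
Proof. by move=> a t t'; rewrite !ind_blockE unbend'_linear !tens_lin_r comp_lin_r. Qed.

Definition ind_sum Y i j l : hom (F i (Y ⊗ l)) (Y ⊗ F j l) :=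
  \sum_k ind_block (vec (Y ⊗ S j) i k) (star (vec (Y ⊗ S j) i k)) l.
Definition ind_tail Y l : hom (I ⊗ (Y ⊗ l)) (Y ⊗ (I ⊗ l)) :=
  \sum_i \sum_j Y ◁ inj j l ∘ (ind_sum Y i j l ∘ prj i (Y ⊗ l)).
Definition ind_br Y : hom (I ⊗ Y) (Y ⊗ I) := m22 (ind_tail Y).

Lemma tailmod_ind_sum Y i j : tailmod (ind_sum Y i j).
Proof.
apply: tailmod_sum => [l m|l m|k]; rewrite ?tensA //.
apply: tailmod_ext (fun l => ind_blockE _ _ l) _; tailmod_tac.
Qed.

Lemma ind_brE Y l : a22 (ind_br Y) l = ind_tail Y l.
Proof.
apply: m22E; apply: tailmod_sum => [l1 m1|l1 m1|i]; rewrite ?tensA //.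
apply: tailmod_sum => [l1 m1|l1 m1|j]; rewrite ?tensA //.
apply: tailmod_comp; last by apply: tailmod_whisk; exact: tailmod_inj.
apply: tailmod_comp; last exact: tailmod_ind_sum.
by apply: (tailmod_at (t := fun l => Y ⊗ l)) (tailmod_prj i) _ => l1 m1; rewrite tensA.
Qed.

Lemma bendl'_pre Y Z (f : hom Y Z) i j (t : hom (Z ⊗ S j) (S i)) l :
  bendl' cS t l ∘ f ▷ l = bendl' cS (t ∘ f ▷ S j) l.
Proof.
by rewrite /bendl' -compA -exch compA -a21_22 a22_tens tensm1.
Qed.

Lemma unbend'_pre Y Z (f : hom Y Z) i j (t : hom (Z ⊗ S j) (S i)) l :
  a21 (unbend' cS t) l ∘ Sb i ◁ f ▷ l = a21 (unbend' cS (t ∘ f ▷ S j)) l.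
Proof. by rewrite !unbend'E -compA -tens_compr bendl'_pre. Qed.

Lemma ind_sum_nat Y Z (f : hom Y Z) i j l :
  f ▷ F j l ∘ ind_sum Y i j l = ind_sum Z i j l ∘ S i ◁ V ◁ Sb i ◁ f ▷ l.
Proof.
have := frame_nat (f ▷ S j) (i := i) (fun t => @ind_block_linearl Y Z i j t l)
  (fun x => @ind_block_linearr Y Z i j x l).
rewrite /ind_sum comp_suml comp_sumr => e.
transitivity (\sum_k ind_block (f ▷ S j ∘ vec (Y ⊗ S j) i k) (star (vec (Y ⊗ S j) i k)) l).
  by apply: eq_bigr => k _; rewrite !ind_blockE compA -a22_12 a22_tens tensm1.
rewrite e; apply: eq_bigr => k _.
by rewrite !ind_blockE -compA -!tens_compr unbend'_pre.
Qed.

Lemma ind_nat Y Z (f : hom Y Z) l :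
  f ▷ (I ⊗ l) ∘ a22 (ind_br Y) l = a22 (ind_br Z) l ∘ I ◁ f ▷ l.
Proof.
rewrite !ind_brE /ind_tail comp_suml comp_sumr; apply: eq_bigr => i _.
rewrite comp_suml comp_sumr; apply: eq_bigr => j _.
by rewrite -!compA prj_tail (reassoc _ (exch f _)) (compA (ind_sum Z i j l)) -ind_sum_nat -!compA.
Qed.

(* Composing frames of Z ⊗ S k and of the Y ⊗ S j gives a frame of (Y ⊗ Z) ⊗ S k. *)
Lemma frame_tens Y Z i k (U : lmodType K)
    (G : hom (S i) ((Y ⊗ Z) ⊗ S k) -> hom ((Y ⊗ Z) ⊗ S k) (S i) -> U) :
  (forall v, linear (G^~ v)) -> (forall u, linear (G u)) ->
  \sum_q G (vec ((Y ⊗ Z) ⊗ S k) i q) (star (vec ((Y ⊗ Z) ⊗ S k) i q))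
  = \sum_j \sum_m \sum_p
      G (asc Y Z (S k) ∘ (Y ◁ vec (Z ⊗ S k) j m ∘ vec (Y ⊗ S j) i p))
        (star (vec (Y ⊗ S j) i p) ∘ (Y ◁ star (vec (Z ⊗ S k) j m) ∘ asc' Y Z (S k))).
Proof.
move=> Gl Gr.
transitivity (\sum_j \sum_m \sum_q G (asc Y Z (S k) ∘ (Y ◁ vec (Z ⊗ S k) j m ∘
    ((Y ◁ star (vec (Z ⊗ S k) j m) ∘ asc' Y Z (S k)) ∘ vec ((Y ⊗ Z) ⊗ S k) i q)))
    (star (vec ((Y ⊗ Z) ⊗ S k) i q))).
  under [RHS]eq_bigr => j _ do rewrite exchange_big.
  rewrite [RHS]exchange_big; apply: eq_bigr => q _.
  set x := vec _ i q.
  have {1}-> : x = \sum_j \sum_m asc Y Z (S k) ∘ (Y ◁ vec (Z ⊗ S k) j m ∘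
    ((Y ◁ star (vec (Z ⊗ S k) j m) ∘ asc' Y Z (S k)) ∘ x)).
    have e : asc Y Z (S k) ∘ (Y ◁ (\sum_j \sum_m vec (Z ⊗ S k) j m ∘ star (vec (Z ⊗ S k) j m))
        ∘ asc' Y Z (S k)) = idm _.
      by rewrite (frameP (fr ho hs rS (Z ⊗ S k))) tensm1 comp1f ascK.
    rewrite -[LHS]comp1f -e tens_sumr !(comp_suml, comp_sumr); apply: eq_bigr => j _.
    rewrite tens_sumr !(comp_suml, comp_sumr); apply: eq_bigr => m _.
    by rewrite tens_compr -!compA.
  rewrite (linear_sumE (Gl _)); apply: eq_bigr => j _.
  exact: (linear_sumE (Gl _)).
apply: eq_bigr => j _; apply: eq_bigr => m _.
apply: (frame_nat (Y ◁ star (vec (Z ⊗ S k) j m) ∘ asc' Y Z (S k))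
  (F := fun a b => G (asc Y Z (S k) ∘ (Y ◁ vec (Z ⊗ S k) j m ∘ a)) b)) => [b a u u'|u]; last exact: Gr.
by rewrite !comp_lin_r Gl.
Qed.

Lemma asc_12 Y Z X T W (x : hom X (Y ⊗ T)) (z : hom T (Z ⊗ W)) l :
  a12 (asc Y Z W ∘ (Y ◁ z ∘ x)) l = asc Y Z (W ⊗ l) ∘ (Y ◁ a12 z l ∘ a12 x l).
Proof.
rewrite !a12E !tens_compr -!compA !tens_compl.
rewrite /asc /asc' !eqh_tensl !eqh_tensr !eqh_compA.
rewrite -[x ▷ l in LHS]comp1f -[idm _]/(eqh erefl).
apply/heq_eq/heq_cl; apply: (@heq_mid _ _ _ _ _ _ _ _ _ _ erefl); [exact: heq_refl|exact: heq_tensA'].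
Qed.

Lemma asc_21 Y Z X T W (t : hom (Y ⊗ T) X) (u : hom (Z ⊗ W) T) l :
  a21 (t ∘ (Y ◁ u ∘ asc' Y Z W)) l ∘ asc Y Z (W ⊗ l) = a21 t l ∘ Y ◁ a21 u l.
Proof.
rewrite !a21E !tens_compr !tens_compl -!compA.
rewrite /asc /asc' !eqh_tensl !eqh_tensr !eqh_comp.
rewrite -[(Y ◁ u) ▷ l ∘ _]comp1f -[idm _]/(eqh erefl).
apply/heq_eq; apply: (@heq_mid _ _ _ _ _ _ _ _ _ _ erefl); last exact: heq_refl.
by apply: heq_cr; exact: heq_tensA'.
Qed.

Lemma unbend'_tens Y Z i j k (t : hom (Y ⊗ S j) (S i)) (u : hom (Z ⊗ S k) (S j)) l :
  a21 (unbend' cS (t ∘ (Y ◁ u ∘ asc' Y Z (S k)))) l ∘ Sb i ◁ asc Y Z l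
  = a21 (unbend' cS u) l ∘ a21 (unbend' cS t) (Z ⊗ l).
Proof.
have e : bendl' cS (t ∘ (Y ◁ u ∘ asc' Y Z (S k))) l ∘ asc Y Z l
    = a21 t (Sb k ⊗ l) ∘ Y ◁ bendl' cS u l.
  by rewrite /bendl' -compA -asc_tail compA asc_21 -compA -tens_compr.
rewrite unbend'E -compA -tens_compr e -bendr_unbend' /bendr' (tens_compr Y) compA.
rewrite a21_tail -compA tens_compr (reassoc _ (a20_tail _ _)) -compA; congr (_ ∘ _).
by rewrite unbend'E.
Qed.

Lemma ind_inj Y i l :
  a22 (ind_br Y) l ∘ inj i (Y ⊗ l) = \sum_j Y ◁ inj j l ∘ ind_sum Y i j l.
Proof.
rewrite ind_brE /ind_tail comp_suml (bigD1 i) //= [X in _ + X]big1 ?addr0 => [|k ki].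
  rewrite comp_suml; apply: eq_bigr => j _.
  by rewrite -!compA prj_inj compf1.
by rewrite comp_suml big1 // => j _; rewrite -!compA prj_inj0 // !comp0r.
Qed.

(** By [frame_tens] the frame of [(Y ⊗ Z) ⊗ S k] may be taken to consist of composites through the
    [S j], and a block built on a composite is the composite of the blocks. *)
Lemma ind_hex Y Z l : a22 (ind_br (Y ⊗ Z)) l ∘ I ◁ asc Y Z l
  = asc Y Z (I ⊗ l) ∘ (Y ◁ a22 (ind_br Z) l ∘ a22 (ind_br Y) (Z ⊗ l)).
Proof.
rewrite (ind_brE (Y ⊗ Z)) (ind_brE Y) /ind_tail.
transitivity (\sum_i \sum_k (Y ⊗ Z) ◁ inj k l ∘ (asc Y Z (F k l) ∘
    (\sum_j Y ◁ ind_sum Z j k l ∘ ind_sum Y i j (Z ⊗ l)) ∘ prj i (Y ⊗ (Z ⊗ l)))).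
  rewrite comp_suml; apply: eq_bigr => i _; rewrite comp_suml; apply: eq_bigr => k _.
  rewrite -!compA; congr (_ ∘ _); rewrite prj_tail !compA; congr (_ ∘ _).
  rewrite /ind_sum comp_suml.
  pose G (x : hom (S i) ((Y ⊗ Z) ⊗ S k)) t := ind_block x t l ∘ S i ◁ V ◁ Sb i ◁ asc Y Z l.
  have Gl t : linear (G^~ t) by move=> a x x'; rewrite /G ind_block_linearl comp_lin_l.
  have Gr x : linear (G x) by move=> a t t'; rewrite /G ind_block_linearr comp_lin_l.
  rewrite (frame_tens Gl Gr) /G {Gl Gr G}.
  rewrite comp_sumr; apply: eq_bigr => j _.
  rewrite tens_sumr !comp_suml !comp_sumr; apply: eq_bigr => m _.
  rewrite !comp_sumr; apply: eq_bigr => p _.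
  rewrite !ind_blockE asc_12 -!compA -!tens_compr unbend'_tens; congr (_ ∘ _).
  rewrite !tens_compr -!compA; congr (_ ∘ _).
  by rewrite (reassoc _ (a12_tail _ _)) -compA.
rewrite !comp_sumr; apply: eq_bigr => i _; rewrite !comp_sumr.
transitivity (\sum_k \sum_j (Y ⊗ Z) ◁ inj k l ∘ (asc Y Z (F k l) ∘
    (Y ◁ ind_sum Z j k l ∘ (ind_sum Y i j (Z ⊗ l) ∘ prj i (Y ⊗ (Z ⊗ l)))))).
  apply: eq_bigr => k _; rewrite comp_sumr comp_suml comp_sumr; apply: eq_bigr => j _.
  by rewrite -!compA.
rewrite exchange_big; apply: eq_bigr => j _.
rewrite (compA (Y ◁ a22 _ _)) -tens_compr ind_inj tens_sumr comp_suml comp_sumr.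
by apply: eq_bigr => k _; rewrite tens_compr -!compA (reassoc _ (asc_tail _ _ _)) -!compA.
Qed.

Lemma lu_21 X l : a21 (lu X) l = lu (X ⊗ l).
Proof. by rewrite a21E /lu /asc eqh_tensl eqh_comp; exact: eqh_irr. Qed.
Lemma lu'_12 X l : a12 (lu' X) l = lu' (X ⊗ l).
Proof. by rewrite a12E /lu' /asc' eqh_tensl eqh_comp; exact: eqh_irr. Qed.

Lemma unbend'_lu j l : a21 (unbend' cS (lu (S j))) l = Sb j ◁ lu l.
Proof.
rewrite unbend'E /bendl' lu_21 lu_nat tens_compr compA.
by rewrite (zig2 cS) comp1f.
Qed.

Lemma ind_sum_one i j l : i != j -> ind_sum unit_ob i j l = 0.
Proof.
move=> ij; rewrite /ind_sum big1 // => k _; rewrite (_ : vec _ i k = 0).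
  by rewrite (linear_0E (ind_block_linearl _ _)).
rewrite -[LHS]comp1f -(lu'K (S j)) -compA.
by rewrite ((disjoint_reps rS).2 i j ij (lu (S j) ∘ _)) comp0r.
Qed.
(** The frame of [unit_ob ⊗ S j] may be replaced by the single isomorphism [lu' (S j)] with covector
    [lu (S j)]. *)
Lemma ind_sum_one_diag j l : ind_sum unit_ob j j l = lu' (F j l) ∘ S j ◁ V ◁ Sb j ◁ lu l.
Proof.
have sj : is_simple (S j) by case: rS.
transitivity (ind_block (lu' (S j)) (lu (S j)) l); last first.
  by rewrite ind_blockE unbend'_lu lu'_12.
rewrite /ind_sum {1}(expand_to (disjoint_reps rS) (frameP (fr ho hs rS (unit_ob ⊗ S j))) (lu (S j))).
rewrite (linear_sumE (ind_block_linearr _ _)); apply: eq_bigr => k _.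
rewrite (linear_ZE (ind_block_linearr _ _)) -(linear_ZE (ind_block_linearl _ _)).
set x := vec _ j k; rewrite -[x in ind_block x]comp1f -(lu'K (S j)) -compA.
by rewrite {1}(coef_idm (lu (S j) ∘ x) sj) compZr compf1.
Qed.

Lemma ind_one l : a22 (ind_br unit_ob) l ∘ I ◁ lu' l = lu' (I ⊗ l).
Proof.
rewrite -[LHS]compf1 -(inj_prj l) -[RHS]compf1 -(inj_prj l) !comp_sumr; apply: eq_bigr => i _.
rewrite -!compA (compA (I ◁ _)) -inj_tail -compA (compA (a22 _ _)) ind_inj.
rewrite comp_suml (bigD1 i) //= big1 ?addr0 => [|j ji]; last first.
  by rewrite ind_sum_one 1?eq_sym // comp0r comp0l.
rewrite ind_sum_one_diag (reassoc _ (lu'_nat _)) -!compA; congr (_ ∘ _).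
by rewrite (compA (S i ◁ V ◁ Sb i ◁ lu l)) -!tens_compr luK !tensm1 comp1f.
Qed.

Lemma ind_lax : lax_hb ind_br.
Proof. by split=> *; [exact: ind_nat|exact: ind_hex|exact: ind_one]. Qed.
Lemma ind_iso Y : is_iso (ind_br Y).
Proof.
by have [Y' [ev [coev dp]]] := conjugates_dualizable hc Y; exact: lax_iso ind_lax _ _ _ _ dp.
Qed.
Definition ind_hb : half_braiding I := mk_hb ind_lax ind_iso.

End Induction.

(** * Partial traces of the monodromy *)

Section Ring.
Context {K : numClosedFieldType} {C : star_tcat K}.
Implicit Types X Y Z W V B l m : ob C.

(* The partial trace over X of the monodromy of X and B. *)
Definition ring X (s : conjugate X) (e : half_braiding X) B (f : half_braiding B) l :
    hom (B ⊗ l) (B ⊗ l) :=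
  locked_with tail_key (a20 (star (cjr s)) (B ⊗ l)
    ∘ (cjob s ◁ a22 (f X) l ∘ (cjob s ◁ a22 (e B) l ∘ a02 (cjr s) (B ⊗ l)))).
Lemma ringE X (s : conjugate X) (e : half_braiding X) B (f : half_braiding B) l :
  ring s e f l = a20 (star (cjr s)) (B ⊗ l)
    ∘ (cjob s ◁ a22 (f X) l ∘ (cjob s ◁ a22 (e B) l ∘ a02 (cjr s) (B ⊗ l))).
Proof. by rewrite /ring locked_withE. Qed.

Lemma ring_nat X (s : conjugate X) (e : half_braiding X) B B' (f : half_braiding B)
    (f' : half_braiding B') (t : hom B B') l :
  (forall l, X ◁ t ▷ l ∘ a22 (f X) l = a22 (f' X) l ∘ t ▷ (X ⊗ l)) ->
  t ▷ l ∘ ring s e f l = ring s e f' l ∘ t ▷ l.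
Proof.
move=> h; rewrite !ringE -!compA a02_tail (compA (_ ◁ a22 (e B') l)) -tens_compr.
rewrite -(lax_nat (hb_lax e)) tens_compr -!compA (compA (_ ◁ a22 (f' X) l)) -tens_compr -h.
by rewrite (reassoc _ (esym (a20_tail _ _))) tens_compr -!compA.
Qed.

Section Unbending.
Variables (X : ob C) (s : conjugate X) (Y : ob C) (c : conjugate Y).

Definition rotate (y : hom unit_ob (X ⊗ Y)) : hom (cjob s) Y :=
  m11 (fun l => a20 (star (cjr s)) (Y ⊗ l) ∘ cjob s ◁ a02 y l).
Lemma rotateE y l : rotate y ▷ l = a20 (star (cjr s)) (Y ⊗ l) ∘ cjob s ◁ a02 y l.
Proof. by apply: m11E; tailmod_tac. Qed.
Definition unbend_in (y : hom unit_ob (X ⊗ Y)) : hom (cjob c) X :=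
  mate (cjr s) (star (cjr c)) (rotate y).
Definition unbend_out (t : hom (X ⊗ Y) unit_ob) : hom X (cjob c) :=
  m11 (fun l => a20 t (cjob c ⊗ l) ∘ X ◁ a02 (cjrb c) l).
Lemma unbend_outE t l : unbend_out t ▷ l = a20 t (cjob c ⊗ l) ∘ X ◁ a02 (cjrb c) l.
Proof. by apply: m11E; tailmod_tac. Qed.

Lemma a02_linear U V l : linear (fun y : hom unit_ob (U ⊗ V) => a02 y l).
Proof. by move=> a y y'; rewrite !a02E a12_linear comp_lin_l. Qed.
Lemma a20_linear U V l : linear (fun y : hom (U ⊗ V) unit_ob => a20 y l).
Proof. by move=> a y y'; rewrite !a20E a21_linear comp_lin_r. Qed.

Lemma unbend_in_linear : linear unbend_in.
Proof.
move=> a y y'; rewrite /unbend_in -mate_linear; congr mate; apply: rwh_inj.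
by rewrite tens_lin_l !rotateE a02_linear tens_lin_r comp_lin_r.
Qed.
Lemma unbend_out_linear : linear unbend_out.
Proof.
move=> a y y'; apply: rwh_inj.
by rewrite tens_lin_l !unbend_outE a20_linear comp_lin_l.
Qed.

Lemma unbend_in_eq0 y : unbend_in y = 0 -> y = 0.
Proof.
rewrite -(linear_0E (mate_linear (cjr s) (star (cjr c)))).
move/(mate_inj (conjugate_dual' s) (conjugate_dual c)) => y0; apply: a02_inj.
rewrite (linear_0E (@a02_linear _ _ _)) -[LHS]comp1f -(dual_pairX (conjugate_dual s)) -compA.
by rewrite a02_tail compA -tens_compr -rotateE y0 tens0l tens0r comp0l.
Qed.

Lemma unbend_out_surj (w : hom X (cjob c)) : unbend_out (star (cjr c) ∘ w ▷ Y) = w.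
Proof.
apply: rwh_inj; rewrite unbend_outE -a20_22 a22_tens tensm1 -compA exch compA.
by rewrite (dual_pairY (conjugate_dual c)) comp1f.
Qed.

(** Straightening the zigzags opens the loop of X: what remains is the strand X passing through [b],
    entering by [unbend_in y] and leaving by [unbend_out t]. *)
Lemma bend_ring V l (y : hom unit_ob (X ⊗ Y)) (t : hom (X ⊗ Y) unit_ob)
    (b : hom (X ⊗ (V ⊗ l)) (V ⊗ (X ⊗ l))) :
  a20 (star (cjr c)) (V ⊗ (cjob c ⊗ l)) ∘ cjob c ◁ (a20 (star (cjr s)) (Y ⊗ (V ⊗ (cjob c ⊗ l)))
      ∘ (cjob s ◁ a02 y (V ⊗ (cjob c ⊗ l)) ∘ (cjob s ◁ V ◁ unbend_out t ▷ l
      ∘ (cjob s ◁ b ∘ a02 (cjr s) (V ⊗ l)))))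
  = V ◁ unbend_out t ▷ l ∘ (b ∘ unbend_in y ▷ (V ⊗ l)).
Proof.
rewrite (compA (a20 (star (cjr s)) _)) -rotateE (compA (cjob s ◁ V ◁ _)) -tens_compr.
rewrite (compA (rotate y ▷ _)) exch -!compA tens_compr (reassoc _ (a20_tail _ _)).
by rewrite -!compA /unbend_in mateE -tens_compr.
Qed.

End Unbending.
End Ring.

Section RingInduction.
Context {K : numClosedFieldType} {C : star_tcat K}.
Implicit Types X Y Z W l m : ob C.
Hypotheses (ho : has_orthogonal_sums C) (hs : idempotents_split C) (hc : has_conjugates C).
Variables (n : nat) (S : 'I_n -> ob C).
Hypothesis rS : simple_representatives S.
Variable cS : forall i, conjugate (S i).
Hypothesis nS : forall i, star (cjr (cS i)) ∘ cjr (cS i) = idm unit_ob.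

Local Notation Sb i := (cjob (cS i)).
Local Notation cup i l := (a02 (cjr (cS i)) l).
Local Notation cap i l := (a20 (star (cjr (cS i))) l).
Local Notation vec W i k := (fvec (f := fr ho hs rS W) i k).

Variables (i0 : 'I_n) (th : hom unit_ob (S i0)) (th' : hom (S i0) unit_ob).
Hypothesis thK' : th ∘ th' = idm _.

Local Notation up m := (th ▷ m ∘ lu' m).
Local Notation dn m := (lu m ∘ th' ▷ m).

Lemma dn_nat l m (u : hom l m) : dn m ∘ S i0 ◁ u = u ∘ dn l.
Proof. by rewrite -compA exch (reassoc _ (lu_nat u)) -!compA. Qed.
Lemma up_dn m : up m ∘ dn m = idm _.
Proof. by rewrite -compA (comp1K _ (lu'K _)) -tens_compl thK' tensm1. Qed.
Lemma dn_tail m : dn (S i0 ⊗ m) = S i0 ◁ dn m.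
Proof.
have e : S i0 ◁ up m ∘ S i0 ◁ dn m = idm _ by rewrite -tens_compr up_dn tensm1.
by rewrite -[LHS]compf1 -e compA dn_nat up_dn comp1f.
Qed.

(** [S i0] is a copy of the unit, so its conjugate can be created next to any [m]: create the pair
    [Sb i0], [S i0] and delete [S i0] with [th']. *)
Definition cut m : hom m (Sb i0 ⊗ m) := locked_with tail_key (Sb i0 ◁ dn m ∘ cup i0 m).
Lemma cutE m : cut m = Sb i0 ◁ dn m ∘ cup i0 m.
Proof. by rewrite /cut locked_withE. Qed.

Lemma unbend'_cut X j (t : hom (X ⊗ S j) (S i0)) l :
  a21 (unbend' cS t) l ∘ cut (X ⊗ l) = unbend_out (cS j) (th' ∘ t) ▷ l.
Proof.
rewrite cutE unbend'E -compA (compA (Sb i0 ◁ bendl' _ _ _)) -tens_compr -dn_nat.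
rewrite dn_tail -tens_compr -a02_tail (comp1K _ (cap_cup nS _ _)).
by rewrite unbend_outE /bendl' -compA (compA (th' ▷ _)) a21_11 compA a20E.
Qed.

Variable V : ob C.
Variables (I : ob C) (v : forall i, hom (S i ⊗ (V ⊗ Sb i)) I).
Hypotheses (v1 : forall i, star (v i) ∘ v i = idm _)
  (v0 : forall i j, i != j -> star (v i) ∘ v j = 0) (vs : \sum_i v i ∘ star (v i) = idm I).

(** Since [S i0] and its conjugate are trivial, V itself is the summand of colour [i0] of the
    induced object; this is its inclusion. *)
Definition ind_unit : hom V I :=
  m11 (fun l => inj v i0 l ∘ (up (V ⊗ (Sb i0 ⊗ l)) ∘ V ◁ cut l)).
Lemma ind_unitE l : ind_unit ▷ l = inj v i0 l ∘ (up (V ⊗ (Sb i0 ⊗ l)) ∘ V ◁ cut l).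
Proof.
apply: m11E; apply: tailmod_comp; last exact: tailmod_inj.
apply: tailmod_comp.
  apply: tailmod_whisk; apply: tailmod_ext cutE _; apply: tailmod_comp (@tailmod_a02 _ _ _ _ _) _.
  by apply/tailmod_whisk/tailmod_comp; [exact: tailmod_rwh|exact: tailmod_lu].
apply: tailmod_comp.
  apply: (tailmod_at (t := fun l => V ⊗ (Sb i0 ⊗ l))) (@tailmod_lu' _ _) _ => l1 m1.
  by rewrite !tensA.
by tailmod_tac.
Qed.

Lemma ind_block_cut X j (x : hom (S i0) (X ⊗ S j)) (t : hom (X ⊗ S j) (S i0)) l :
  ind_block cS V x t l ∘ (up (V ⊗ (Sb i0 ⊗ (X ⊗ l))) ∘ V ◁ cut (X ⊗ l))
  = a02 (x ∘ th) (V ⊗ (Sb j ⊗ l)) ∘ V ◁ unbend_out (cS j) (th' ∘ t) ▷ l.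
Proof.
rewrite ind_blockE -!compA (compA (S i0 ◁ V ◁ _)) -exch -!compA.
rewrite (compA (unit_ob ◁ _)) -lu'_nat -compA -tens_compr unbend'_cut.
by rewrite (compA (a12 x _)) a12_11 compA a02E.
Qed.

Local Notation W := (ind_hb ho hs hc rS v1 v0 vs).

Lemma ind_unit_br X j l :
  X ◁ prj v j l ∘ (a22 (W X) l ∘ ind_unit ▷ (X ⊗ l))
  = \sum_k a02 (vec (X ⊗ S j) i0 k ∘ th) (V ⊗ (Sb j ⊗ l))
      ∘ V ◁ unbend_out (cS j) (th' ∘ star (vec (X ⊗ S j) i0 k)) ▷ l.
Proof.
rewrite ind_unitE (compA (a22 _ _)) [a22 (W X) l]/(a22 (ind_br ho hs rS v X) l) ind_inj //.
rewrite (compA (X ◁ prj _ _ _)) comp_sumr (bigD1 j) //= [T in _ + T]big1 ?addr0 => [|k kj].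
  rewrite (compA (X ◁ prj v j l)) -tens_compr prj_inj // tensm1 comp1f /ind_sum comp_suml.
  by apply: eq_bigr => k _; exact: ind_block_cut.
by rewrite compA -tens_compr prj_inj0 1?eq_sym // tens0r comp0l.
Qed.

Lemma ring_ind_unit X (s : conjugate X) (e : half_braiding X) j l :
  prj v j l ∘ (ring s e W l ∘ ind_unit ▷ l)
  = \sum_k a20 (star (cjr s)) (S j ⊗ (V ⊗ (Sb j ⊗ l)))
      ∘ (cjob s ◁ a02 (vec (X ⊗ S j) i0 k ∘ th) (V ⊗ (Sb j ⊗ l))
      ∘ (cjob s ◁ V ◁ unbend_out (cS j) (th' ∘ star (vec (X ⊗ S j) i0 k)) ▷ l
      ∘ (cjob s ◁ a22 (e V) l ∘ a02 (cjr s) (V ⊗ l)))).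
Proof.
rewrite ringE -!compA a02_tail (compA (_ ◁ a22 (e I) l)) -tens_compr.
rewrite -(lax_nat (hb_lax e)) tens_compr -!compA (reassoc _ (esym (a20_tail _ _))) -!compA.
rewrite (compA (cjob s ◁ a22 _ _)) -tens_compr (compA (cjob s ◁ X ◁ _)) -tens_compr ind_unit_br.
rewrite tens_sumr !(comp_suml, comp_sumr); apply: eq_bigr => k _.
by rewrite tens_compr -!compA.
Qed.

(** On the summand V, naturality reduces the half braiding of X with the induced object to [e V],
    and the induced half braiding contributes only its block from [i0] to [j]. Then [bend_ring]
    opens the loop. *)
Lemma ring_bend X (s : conjugate X) (e : half_braiding X) j l :
  cap j (V ⊗ (Sb j ⊗ l)) ∘ Sb j ◁ (prj v j l ∘ (ring s e W l ∘ ind_unit ▷ l))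
  = a22 (\sum_k matcoef e (unbend_in s (cS j) (vec (X ⊗ S j) i0 k ∘ th))
      (unbend_out (cS j) (th' ∘ star (vec (X ⊗ S j) i0 k))) V) l.
Proof.
rewrite ring_ind_unit tens_sumr comp_sumr (linear_sumE (@a22_linear _ _ _ _ _ _ _)).
apply: eq_bigr => k _; rewrite bend_ring.
by rewrite /matcoef -!a22_comp !a22_tens tensm1.
Qed.

End RingInduction.

(** * Linear independence of the partial traces *)

Section Independence.
Context {K : numClosedFieldType} {C : star_tcat K}.
Implicit Types X Y Z W T l : ob C.
Hypotheses (ho : has_orthogonal_sums C) (hs : idempotents_split C) (hc : has_conjugates C).
Hypothesis s1 : is_simple (unit_ob : ob C).
Variables (n : nat) (S : 'I_n -> ob C).
Hypothesis rS : simple_representatives S.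
Variable cS : forall i, conjugate (S i).
Hypothesis nS : forall i, star (cjr (cS i)) ∘ cjr (cS i) = idm unit_ob.

Local Notation D := (unitary_double C).
Local Notation "'e[' A ]" := (cbr (sval A)) (at level 0).
Local Notation vec W i k := (fvec (f := fr ho hs rS W) i k).

Lemma avg_linear X X' (e : half_braiding X) (e' : half_braiding X') : linear (avg cS e e').
Proof.
move=> a t t'; apply: rwh_inj; rewrite tens_lin_l !avgE /avg_tail scaler_sumr -big_split /=.
apply: eq_bigr => i _; rewrite !avg_atE tens_lin_l tens_lin_r.
by rewrite !(comp_lin_l, comp_lin_r).
Qed.

Lemma conj_component X : idm X <> 0 -> exists j (w : hom X (cjob (cS j))), w <> 0.
Proof.
move=> X0; have [c _] := coframe_inhabited ho hs hc rS cS X.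
apply: contrapT => h; apply: X0; rewrite -(coframeP c) big1 // => j _; rewrite big1 // => k _.
suff -> : cfcov j k = 0 by rewrite comp0r.
by apply: contrapT => w0; apply: h; exists j, (cfcov j k).
Qed.

(** Tested on induced objects, the relation becomes one between matrix coefficients of the [e[A a]].
    If [z b] were nonzero, the average of [star u ∘ u] for a component [u] of [A b] would be zero
    when computed through the frame, but positivity makes it nonzero. *)
Theorem ring_independent N (A : 'I_N -> ob D) (s : forall a, conjugate (cob (sval (A a))))
    (z : 'I_N -> K) :
  (forall a, is_simple (A a)) -> (forall a b, isomorphic (A a) (A b) -> a = b) ->
  (forall B : center_ob C, \sum_a z a *: ring (s a) e[A a] (cbr B) unit_ob = 0) ->
  forall a, z a = 0.
Proof.
move=> sA iA z0 b.
have [i0 [th [th' thK thK']]] : exists i, isomorphic unit_ob (S i) by case: rS => _ _; exact.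
pose x a j k := vec (cob (sval (A a)) ⊗ S j) i0 k.
pose p a j k := unbend_in (s a) (cS j) (x a j k ∘ th).
pose w a j k := unbend_out (cS j) (th' ∘ star (x a j k)).
have mat0 j V : \sum_a z a *: \sum_k matcoef e[A a] (p a j k) (w a j k) V = 0.
  have [I [v [v1 v0 vs]]] := ho (fun i => S i ⊗ (V ⊗ cjob (cS i))).
  apply: a22_inj; rewrite (linear_0E (@a22_linear _ _ _ _ _ _ _)).
  have := z0 (CenterOb (ind_hb ho hs hc rS v1 v0 vs)).
  move/(congr1 (fun f => a20 (star (cjr (cS j))) _ ∘ cjob (cS j) ◁
    (prj v j unit_ob ∘ (f ∘ ind_unit th th' v ▷ unit_ob)))).
  rewrite comp0l comp0r tens0r comp0r => e0; rewrite -[RHS]e0.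
  rewrite comp_suml comp_sumr tens_sumr comp_sumr (linear_sumE (@a22_linear _ _ _ _ _ _ _)).
  apply: eq_bigr => a _; rewrite (linear_ZE (@a22_linear _ _ _ _ _ _ _)).
  rewrite compZl compZr tensZr compZr; congr (_ *: _).
  exact/esym/ring_bend.
apply: contrapT => /eqP zb0; pose X := cob (sval (A b)).
have [j [u u0]] := conj_component (simple_cob_neq0 (sA b)).
(* [t] is the covector that unbends to [u], and the [c k] are its coordinates in the frame. *)
pose t := th ∘ (star (cjr (cS j)) ∘ u ▷ S j).
pose c k := coef (t ∘ x b j k).
have uE : u = \sum_k c k *: w b j k.
  rewrite -[LHS](unbend_out_surj u) -[in LHS](comp1f (star _ ∘ _)) -thK -compA -/t.
  rewrite [in LHS](expand_to (disjoint_reps rS) (frameP (fr ho hs rS (X ⊗ S j))) t) comp_sumr.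
  rewrite (linear_sumE (@unbend_out_linear _ _ _ _ (cS j))); apply: eq_bigr => k _.
  by rewrite compZr (linear_ZE (@unbend_out_linear _ _ _ _ (cS j))).
have lamP k : {a | avg cS e[A b] e[A b] (star u ∘ w b j k) = a *: idm X}.
  exact/cid/avg_scalar.
(* The average of [star u ∘ u] has scalar the sum of the [lam k * c k]. The individual [lam k] need
   not vanish; it suffices that pairing the relation [x0] with [t] yields exactly this sum. *)
pose lam k := sval (lamP k).
have p0 : \sum_k lam k *: p b j k = 0.
  have pE a : pair_avg cS e[A b] (star u) (fun i => \sum_k matcoef e[A a] (p a j k) (w a j k) (S i))
      = \sum_k (avg cS e[A a] e[A b] (star u ∘ w a j k) ∘ p a j k) ▷ unit_ob.
    under eq_bigr => k _ do rewrite -pair_avg_matcoef -[pair_avg _ _ _ _]scale1r.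
    rewrite -pair_avg_sum; congr pair_avg; apply: functional_extensionality_dep => i.
    by apply: eq_bigr => k _; rewrite scale1r.
  have := pair_avg0 cS e[A b] (star u) (fun i => mat0 j (S i)).
  rewrite pair_avg_sum (bigD1 b) //= big1 ?addr0 ?(pE b) => [|a ab].
    move=> /eqP; rewrite scaler_eq0 (negPf zb0) => /eqP e0; apply: rwh_inj; rewrite tens0l -e0.
    by rewrite tens_suml; apply: eq_bigr => k _; rewrite (svalP (lamP k)) compZl comp1f.
  rewrite (pE a) big1 ?scaler0 // => k _; rewrite avg_orthogonal // ?comp0l ?tens0l // => /iA ab'.
  by rewrite ab' eqxx in ab.
have x0 : \sum_k lam k *: x b j k = 0.
  have y0 : \sum_k lam k *: (x b j k ∘ th) = 0.
    apply: (@unbend_in_eq0 _ _ _ (s b) _ (cS j)); rewrite -[RHS]p0.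
    rewrite (linear_sumE (@unbend_in_linear _ _ _ _ _ _)); apply: eq_bigr => k _.
    exact: (linear_ZE (@unbend_in_linear _ _ _ _ _ _)).
  rewrite -[LHS]compf1 -thK' compA comp_suml; under eq_bigr => k _ do rewrite compZl.
  by rewrite y0 comp0l.
have [a a0 aE] := avg_positive ho hs hc s1 rS nS (sA b) u0.
suff : a = 0 by move=> a00; rewrite a00 ltxx in a0.
apply: (scale_idm_inj (simple_cob_neq0 (sA b))); rewrite -aE scale0r {2}uE.
rewrite comp_sumr (linear_sumE (@avg_linear _ _ _ _)).
transitivity (\sum_k (lam k * c k) *: idm X).
  apply: eq_bigr => k _; rewrite compZr (linear_ZE (@avg_linear _ _ _ _)) (svalP (lamP k)).
  by rewrite scalerA mulrC.
rewrite -scaler_suml; suff -> : \sum_k lam k * c k = 0 by rewrite scale0r.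
have si := rep_simple rS i0.
transitivity (coef (t ∘ \sum_k lam k *: x b j k)); last by rewrite x0 comp0r coef_zero.
rewrite comp_sumr (linear_sumE (coef_linear si)).
by apply: eq_bigr => k _; rewrite compZr (linear_ZE (coef_linear si)).
Qed.

End Independence.

(** * Invertibility of the S-matrix *)

Section PartialTrace.
Context {K : numClosedFieldType} {C : star_tcat K}.
Implicit Types X Y l : ob C.

Definition partial_tr X (s : conjugate X) Y (t : hom (X ⊗ Y) (X ⊗ Y)) : hom Y Y :=
  m11 (fun l => a20 (star (cjr s)) (Y ⊗ l) ∘ (cjob s ◁ a22 t l ∘ a02 (cjr s) (Y ⊗ l))).
Lemma partial_trE X (s : conjugate X) Y (t : hom (X ⊗ Y) (X ⊗ Y)) l :
  partial_tr s t ▷ l = a20 (star (cjr s)) (Y ⊗ l) ∘ (cjob s ◁ a22 t l ∘ a02 (cjr s) (Y ⊗ l)).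
Proof. by apply: m11E; tailmod_tac. Qed.

Hypotheses (ho : has_orthogonal_sums C) (hs : idempotents_split C).
Hypothesis s1 : is_simple (unit_ob : ob C).
Hypothesis hc : has_conjugates C.
Variables (n : nat) (S : 'I_n -> ob C).
Hypothesis rS : simple_representatives S.

Lemma trl_partial X Y (s : conjugate X) (s' : conjugate Y) (s'' : conjugate (X ⊗ Y)) t :
  is_standard s -> is_standard s' -> is_standard s'' ->
  trl s'' t = trl s' (partial_tr s t).
Proof.
move=> ss ss' ss''; have [s2 [ss2 e]] := standard_tens ss ss'.
(* Cyclicity with the identity as second factor compares any two standard solutions of one object,
   so [s''] may be exchanged for the tensor product of [s] and [s']. *)
have := standard_cyclic ho hs hc s1 rS t (idm _) ss2 ss''.
rewrite compf1 comp1f => ->; rewrite -dual_of_traceL e /traceL /=.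
apply: unit_tail_inj; rewrite -[in LHS]compA -a20_02.
rewrite -a22_02 a22_tens.
rewrite [LHS](trace_tens_l (star (cjr s)) (cjr s) (star (cjr s')) (cjr s') t unit_ob).
by rewrite -partial_trE trl_tail.
Qed.

(** Column [j] consists of the scalars [lam i j] times the dimension [d j], which is nonzero because
    the trace is faithful. A row vector in the kernel is therefore a relation between partial
    traces. *)
Lemma S_matrix_unit (s : forall X : ob C, conjugate X) (c : forall X Y : ob C, hom (X ⊗ Y) (Y ⊗ X)) :
  (forall X, is_standard (s X)) ->
  (forall z : 'I_n -> K,
    (forall j, \sum_i z i *: partial_tr (s (S i)) (c (S j) (S i) ∘ c (S i) (S j)) = 0) ->
    forall i, z i = 0) ->
  exists M : 'M[K]_n, is_S_matrix c (fun X => dual_of (s X)) S M /\ M \in unitmx.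
Proof.
move=> ss indep; have sS j : is_simple (S j) by case: rS.
pose lam i j := coef (partial_tr (s (S i)) (c (S j) (S i) ∘ c (S i) (S j))).
pose d j := coef (trl (s (S j)) (idm (S j))).
have lamE i j : partial_tr (s (S i)) (c (S j) (S i) ∘ c (S i) (S j)) = lam i j *: idm _.
  exact: coef_idm.
have ME i j : trl (s (S i ⊗ S j)) (c (S j) (S i) ∘ c (S i) (S j)) = (lam i j * d j) *: idm unit_ob.
  rewrite (trl_partial _ (ss (S i)) (ss (S j)) (ss _)).
  by rewrite lamE (linear_ZE (@trl_linear _ _ _ _)) (coef_idm (trl _ (idm _)) s1) scalerA.
have d0 j : d j != 0.
  apply/eqP => dj0; apply: (proj1 (sS j)); apply: (@trl_faithful _ _ _ _ (s (S j))).
  by rewrite star_idm comp1f (coef_idm (trl _ _) s1) -/(d j) dj0 scale0r.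
exists (\matrix_(i, j) (lam i j * d j)); split=> [i j|]; first by rewrite mxE; exact: ME.
rewrite -row_free_unit -kermx_eq0; apply/rowV0P => z /sub_kermxP zM.
apply/rowP => i; rewrite mxE; apply: indep => j.
have zl : \sum_i z 0 i * lam i j = 0.
  apply/eqP; rewrite -(mulIr_eq0 _ (mulIf (d0 j))); apply/eqP.
  have /matrixP /(_ 0 j) := zM; rewrite !mxE => e; rewrite -[RHS]e mulr_suml.
  by apply: eq_bigr => k _; rewrite mxE mulrA.
transitivity ((\sum_i z 0 i * lam i j) *: idm (S j)); last by rewrite zl scale0r.
by rewrite scaler_suml; apply: eq_bigr => k _; rewrite lamE scalerA.
Qed.
End PartialTrace.

Section CenterTail.
Context {K : numClosedFieldType} {C : star_tcat K}.
Local Notation D := (unitary_double C).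

Definition dval (A B : ob D) (f : hom A B) : hom (cob (sval A)) (cob (sval B)) := cval f.

Lemma dval_asc (X Y l : ob D) : dval (asc X Y l) = asc (cob (sval X)) (cob (sval Y)) (cob (sval l)).
Proof. exact: etrans (congr1 (@cval _ _ _ _) (asc_full X Y l)) (asc_center _ _ _). Qed.
Lemma dval_asc' (X Y l : ob D) : dval (asc' X Y l) = asc' (cob (sval X)) (cob (sval Y)) (cob (sval l)).
Proof. exact: etrans (congr1 (@cval _ _ _ _) (asc'_full X Y l)) (asc'_center _ _ _). Qed.
Lemma dval_lu (l : ob D) : dval (lu l) = lu (cob (sval l)).
Proof. exact: etrans (congr1 (@cval _ _ _ _) (lu_full l)) (lu_center _). Qed.
Lemma dval_lu' (l : ob D) : dval (lu' l) = lu' (cob (sval l)).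
Proof. exact: etrans (congr1 (@cval _ _ _ _) (lu'_full l)) (lu'_center _). Qed.
Lemma dval_zigzag (A B : ob D) (ev : hom (A ⊗ B) unit_ob) (coev : hom unit_ob (B ⊗ A)) :
  dval (zigzag ev coev)
  = zigzag (dval ev : hom (cob (sval A) ⊗ cob (sval B)) unit_ob) (dval coev).
Proof. exact: etrans (congr1 (@cval _ _ _ _) (zigzag_double ev coev)) (zigzag_center _ _). Qed.

Lemma dval_linear (A B : ob D) : linear (@dval A B).
Proof. exact: (@cval_linear _ _ (sval A) (sval B)). Qed.
Lemma dval_comp (A B E : ob D) (g : hom B E) (f : hom A B) : dval (g ∘ f) = dval g ∘ dval f.
Proof. by []. Qed.
Lemma dval_tens (A A' B B' : ob D) (f : hom A A') (g : hom B B') :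
  dval (f ⊠ g) = dval f ⊠ dval g.
Proof. by []. Qed.

Lemma dval_a22 (X Y X' Y' l : ob D) (f : hom (X ⊗ Y) (X' ⊗ Y')) :
  dval (a22 f l) = a22 (dval f : hom (cob (sval X) ⊗ cob (sval Y)) (cob (sval X') ⊗ cob (sval Y')))
    (cob (sval l)).
Proof. by rewrite !a22E !dval_comp dval_asc dval_asc'. Qed.
Lemma dval_a20 (X Y l : ob D) (f : hom (X ⊗ Y) unit_ob) :
  dval (a20 f l) = a20 (dval f : hom (cob (sval X) ⊗ cob (sval Y)) unit_ob) (cob (sval l)).
Proof. by rewrite !a20E !a21E !dval_comp dval_asc dval_lu. Qed.
Lemma dval_a02 (X Y l : ob D) (f : hom unit_ob (X ⊗ Y)) :
  dval (a02 f l) = a02 (dval f : hom unit_ob (cob (sval X) ⊗ cob (sval Y))) (cob (sval l)).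
Proof. by rewrite !a02E !a12E !dval_comp dval_asc' dval_lu'. Qed.

Definition dconj (A : ob D) (s : conjugate A) : conjugate (cob (sval A)) :=
  @Conjugate _ C (cob (sval A)) (cob (sval (cjob s))) (dval (cjr s)) (dval (cjrb s))
    (etrans (esym (dval_zigzag (star (cjrb s)) (cjr s))) (congr1 (@dval _ _) (cj_eq1 s)))
    (etrans (esym (dval_zigzag (star (cjr s)) (cjrb s))) (congr1 (@dval _ _) (cj_eq2 s))).

Local Notation "'e[' A ]" := (cbr (sval A)) (at level 0).

Lemma dval_partial_tr (A B : ob D) (s : conjugate A) :
  dval (partial_tr s (unitary_double_braid B A ∘ unitary_double_braid A B)) ▷ unit_ob
  = ring (dconj s) e[A] e[B] unit_ob.
Proof.
rewrite -[_ ▷ unit_ob]/(dval (_ ▷ (unit_ob : ob D))) partial_trE ringE !dval_comp.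
rewrite dval_a20 dval_a02 dval_tens dval_a22.
have -> : a22 (dval (unitary_double_braid B A ∘ unitary_double_braid A B)) unit_ob
    = a22 (e[B] (cob (sval A))) unit_ob ∘ a22 (e[A] (cob (sval B))) unit_ob.
  by rewrite a22_comp.
by rewrite [dval (idm _)]/(idm _) tens_compr -!compA.
Qed.
End CenterTail.

Section SMatrix.
Context {K : numClosedFieldType} {C : star_tcat K}.
Hypotheses (ho : has_orthogonal_sums C) (hs : idempotents_split C) (hc : has_conjugates C).
Hypothesis s1 : is_simple (unit_ob : ob C).
Variables (n : nat) (S : 'I_n -> ob C).
Hypothesis rS : simple_representatives S.
Variable cS : forall i, conjugate (S i).
Hypothesis nS : forall i, star (cjr (cS i)) ∘ cjr (cS i) = idm unit_ob.

Local Notation D := (unitary_double C).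
Local Notation "'e[' A ]" := (cbr (sval A)) (at level 0).
Let hoD : has_orthogonal_sums D := double_orthogonal_sums ho hc.
Let hsD : idempotents_split D := double_split ho hs hc s1 rS nS.

Variables (N : nat) (T : 'I_N -> ob D).
Hypothesis rT : simple_representatives T.
Variable s : forall A : ob D, conjugate A.

Local Notation c A B := (unitary_double_braid A B).

Lemma dval_ring_nat (A : ob D) (B B' : center_ob C) (t : @hom _ (center_tcat C) B B') l :
  cval t ▷ l ∘ ring (dconj (s A)) e[A] (cbr B) l = ring (dconj (s A)) e[A] (cbr B') l ∘ cval t ▷ l.
Proof.
apply: ring_nat => m; rewrite -[idm (_ ⊗ m)]tensm1 -!a22_tens !a22_comp.
by rewrite -cmorP.
Qed.

(** Partial traces are natural in B, so a relation on the simple objects spreads over decompositions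
    in D and then along isomorphisms with unitary representatives. All of Z is needed because the
    induced half braidings are not shown to be unitary. *)
Lemma ring_center_zero (z : 'I_N -> K) :
  (forall j, \sum_i z i *: ring (dconj (s (T i))) e[T i] e[T j] unit_ob = 0) ->
  forall B : center_ob C, \sum_i z i *: ring (dconj (s (T i))) e[T i] (cbr B) unit_ob = 0.
Proof.
move=> z0 B; pose F (B : center_ob C) := \sum_i z i *: ring (dconj (s (T i))) e[T i] (cbr B) unit_ob.
have Fnat (B1 B2 : center_ob C) (t : @hom _ (center_tcat C) B1 B2) :
    cval t ▷ unit_ob ∘ F B1 = F B2 ∘ cval t ▷ unit_ob.
  rewrite /F comp_suml comp_sumr; apply: eq_bigr => i _.
  by rewrite compZl compZr dval_ring_nat.
have FD (A : ob D) : F (sval A) = 0.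
  have [m [d [u [_ _ su]]]] := decomposition_reps hoD hsD rT A.
  have e : \sum_k dval (u k) ∘ dval (star (u k)) = idm (cob (sval A)).
    rewrite -[RHS]/(dval (idm A)) -su /dval cval_sum; exact: eq_bigr.
  transitivity (F (sval A) ∘ (\sum_k dval (u k) ∘ dval (star (u k))) ▷ unit_ob).
    by rewrite e tensm1 compf1.
  rewrite tens_suml comp_sumr big1 // => k _.
  rewrite tens_compl compA.
  by rewrite -(Fnat (sval (T (d k))) (sval A) (u k)) [F _]z0 comp0r comp0l.
have [A [f [g gf _]]] := unitary_representative ho hs hc s1 rS nS B.
have e : cval g ∘ cval f = idm (cob B) by exact: (congr1 (@cval _ _ _ _) gf).
transitivity ((cval g ∘ cval f) ▷ unit_ob ∘ F B); first by rewrite e tensm1 comp1f.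
by rewrite tens_compl -compA Fnat FD comp0l comp0r.
Qed.
Lemma partial_tr_independent (z : 'I_N -> K) :
  (forall j, \sum_i z i *: partial_tr (s (T i)) (c (T j) (T i) ∘ c (T i) (T j)) = 0) ->
  forall i, z i = 0.
Proof.
move=> z0.
apply: (ring_independent ho hs hc s1 rS nS (s := fun i => dconj (s (T i)))).
- by case: rT.
- by case: rT.
apply: ring_center_zero => j.
have e : dval (\sum_i z i *: partial_tr (s (T i)) (c (T j) (T i) ∘ c (T i) (T j))) ▷ unit_ob = 0.
  by rewrite z0; exact: tens0l.
rewrite -[RHS]e (linear_sumE (@dval_linear _ _ (T j) (T j))) tens_suml; apply: eq_bigr => i _.
by rewrite (linear_ZE (@dval_linear _ _ (T j) (T j))) tensZl dval_partial_tr.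
Qed.

End SMatrix.

(** * Modularity *)

Section Braiding.
Context {K : fieldType}.

Lemma center_braiding (C : tcat K) : is_braiding (D := center_tcat C) (@center_braid K C).
Proof.
split=> [A B|A A' B B' f g|A B E|A B E].
- by apply: (@center_is_iso _ _ (center_tens A B) (center_tens B A)); exact: hb_iso.
- apply: cval_inj; rewrite /= (tens_split (cval g) (cval f)) -compA cmorP compA hb_nat -compA.
  by rewrite -tensm_comp comp1f compf1.
- by apply: cval_inj; rewrite /= !asc_center asc'_center; exact: hb_tens.
- by apply: cval_inj; rewrite /= !asc'_center asc_center.
Qed.

Lemma full_braiding (E : tcat K) (P : ob E -> Prop) (P1 : P unit_ob)
    (PM : forall X Y, P X -> P Y -> P (X ⊗ Y)) (c : forall X Y : ob E, hom (X ⊗ Y) (Y ⊗ X)) :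
  is_braiding c -> is_braiding (D := full_tcat P1 PM) (fun X Y => c (sval X) (sval Y)).
Proof.
move=> [ci cn ch ch']; split=> [X Y|X X' Y Y' f g|X Y Z|X Y Z].
- exact: ci.
- exact: cn.
- by rewrite !asc_full asc'_full; exact: ch.
- by rewrite asc_full !asc'_full; exact: ch'.
Qed.

End Braiding.

Section Modularity.
Context {K : numClosedFieldType} {C : star_tcat K}.

Lemma double_braiding : is_braiding (@unitary_double_braid K C).
Proof. exact: (full_braiding _ _ (center_braiding C)). Qed.

Lemma orthogonal_direct_sums (E : star_tcat K) : has_orthogonal_sums E -> has_direct_sums E.
Proof.
by move=> h m T; have [X [v [v1 v0 vs]]] := h m T; exists X, v, (fun i => star (v i)).
Qed.

Lemma star_semisimple (E : star_tcat K) :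
  has_orthogonal_sums E -> idempotents_split E -> semisimple E.
Proof.
move=> ho hs; split=> [||X] //; first exact: orthogonal_direct_sums.
have [m [T [u [sT u1 u0 us]]]] := decomposition ho hs X.
by exists m, T; split=> //; exists u, (fun i => star (u i)).
Qed.

Section Spherical.
Variable E : star_tcat K.
Hypotheses (ho : has_orthogonal_sums E) (hs : idempotents_split E) (hc : has_conjugates E).
Hypothesis s1 : is_simple (unit_ob : ob E).
Variables (n : nat) (S : 'I_n -> ob E).
Hypothesis rS : simple_representatives S.

(** The conditions on tensor products and on the unit compare the chosen solutions with the product
    and the trivial ones, which are standard too, so the agreement of left and right transposes
    covers them. *)
Lemma standard_spherical (s : forall X : ob E, standard_conjugate X) :
  spherical_structure (fun X => standard_dual (s X)).
Proof.
have tr := transpose_standard ho hs hc s1 rS.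
split=> [X|X Y f|X Y||X t].
- exact: dual_of_two_sided.
- exact: tr (svalP (s X)) (svalP (s Y)).
- have [s' [ss' e]] := standard_tens (svalP (s X)) (svalP (s Y)).
  rewrite -[standard_dual (s X)]/(dual_of _) -[standard_dual (s Y)]/(dual_of _) -e.
  exact: tr (svalP (s _)) ss'.
- have [s' [ss' e]] := standard_one s1.
  rewrite -e; exact: tr (svalP (s _)) ss'.
exact: (svalP (s X)).
Qed.

Lemma modular_criterion (c : forall X Y : ob E, hom (X ⊗ Y) (Y ⊗ X)) : is_braiding c ->
  (forall s : (forall X : ob E, conjugate X), forall z : 'I_n -> K,
    (forall j, \sum_i z i *: partial_tr (s (S i)) (c (S j) (S i) ∘ c (S i) (S j)) = 0) ->
    forall i, z i = 0) ->
  star_modular c.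
Proof.
move=> bc indep; split=> [X|s].
  by have [s ss] := standard_exists ho hs hc s1 rS X; constructor; exists s.
split=> //; [exact: star_semisimple|exact: standard_spherical|].
have [M [SM uM]] := S_matrix_unit ho hs s1 hc rS (fun X => svalP (s X)) (indep (fun X => sval (s X))).
by exists n, S, M.
Qed.
End Spherical.

Hypotheses (ho : has_orthogonal_sums C) (hs : idempotents_split C) (hc : has_conjugates C).
Hypothesis s1 : is_simple (unit_ob : ob C).
Variables (n : nat) (S : 'I_n -> ob C).
Hypothesis rS : simple_representatives S.

Lemma normalised_conjugates :
  exists cS : forall i, conjugate (S i), forall i, star (cjr (cS i)) ∘ cjr (cS i) = idm unit_ob.
Proof.
have h i : {s : conjugate (S i) | star (cjr s) ∘ cjr s = idm unit_ob}.
  apply: cid; case: (hc (S i)) => s; apply: normalised_conjugate ho s1 _ s.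
  by case: rS => h _ _; case: (h i).
by exists (fun i => sval (h i)) => i; exact: (svalP (h i)).
Qed.

Lemma double_modular : star_modular (@unitary_double_braid K C).
Proof.
have [cS nS] := normalised_conjugates.
have [N [T rT]] := double_finite ho hs hc s1 rS nS.
exact: (modular_criterion (double_orthogonal_sums ho hc) (double_split ho hs hc s1 rS nS)
  (double_conjugates ho hs hc s1 rS nS) (double_simple_unit s1) rT double_braiding
  (partial_tr_independent ho hs hc s1 rS nS rT)).
Qed.

End Modularity.

Theorem theorem6p4 (R : realType) (C : star_tcat R[i]) :
  is_simple (unit_ob : ob C) ->
  finitely_many_simples C ->
  has_conjugates C ->
  has_orthogonal_sums C ->
  idempotents_split C ->
  monoidally_equivalent (unitary_double C) (center_tcat C) /\
  star_modular (@unitary_double_braid _ C).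
Proof.
move=> s1 [n [S rS]] hc ho hs; have [cS nS] := normalised_conjugates ho hc s1 rS.
by split; [exact: (double_equivalent ho hs hc s1 rS nS)|exact: (double_modular ho hs hc s1 rS)].
Qed.
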